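(* Let $\phi\in C_c^\infty(\mathbb{D})$ satisfy $\phi\equiv1$ on $\{z\in\mathbb{C}:|z|\le1/2\}$, and let $d$ be a positive integer. (i) Set $q_d=\tfrac12(d^2+d)+1$ and define $$\mathcal{E}b(\underline w)=\int_{\mathbb{C}}\mathrm{e}(w_1z+w_2z^2+\cdots+w_dz^d)\,b(z)\,\phi(z)\,dz,\qquad \underline w=(w_1,\ldots,w_d)\in\mathbb{C}^d.$$ Then $\mathcal{E}1\in L^q(\mathbb{C}^d)$ if and only if $q>q_d$. (ii) Let $k_1<k_2<\cdots<k_d$ be positive integers with $K:=k_1+\cdots+k_d<\tfrac12k_d(k_d+1)$, and let $\mathcal{E}b$ be defined instead with respect to the sparse polynomial $w_1z^{k_1}+\cdots+w_dz^{k_d}$, that is, $$\mathcal{E}b(\underline w)=\int_{\mathbb{C}}\mathrm{e}(w_1z^{k_1}+\cdots+w_dz^{k_d})\,b(z)\,\phi(z)\,dz,\qquad \underline w\in\mathbb{C}^d.$$ Then $\mathcal{E}1\in L^q(\mathbb{C}^d)$ if and only if $q>K$.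
   Context: For $z=x+iy\in\mathbb{C}$ (with $x,y$ real), $\mathrm{e}(z)=e^{2\pi i x}e^{2\pi i y}$. $\mathbb{D}=\{z\in\mathbb{C}:|z|\le1\}$; $C_c^\infty(\mathbb{D})$ denotes smooth (in the real sense) functions on $\mathbb{C}\simeq\mathbb{R}^2$ with compact support contained in $\mathbb{D}$. $\mathcal{E}1$ denotes $\mathcal{E}b$ with $b\equiv1$. $L^q(\mathbb{C}^d)$ is with respect to Lebesgue measure on $\mathbb{C}^d\simeq\mathbb{R}^{2d}$, and $dz$ is Lebesgue measure on $\mathbb{C}$.
   Formalization: Part (i) is proved for d ≥ 2 only: for d = 1 it is false, since E1 is then the Fourier transform of φ after an invertible linear change of variables, hence in every L^q, although q_1 = 2. *)

(* Defs.v *)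
From HB Require Import structures.
From mathcomp Require Import all_boot all_order all_algebra.
From mathcomp Require Import complex.
From mathcomp Require Import all_classical all_reals all_analysis.

Set Implicit Arguments.
Unset Strict Implicit.
Unset Printing Implicit Defensive.

Import Order.TTheory GRing.Theory Num.Theory.
Import numFieldNormedType.Exports.

Local Open Scope classical_set_scope.
Local Open Scope ring_scope.
Local Open Scope complex_scope.

(* The plane R^2 carries the product topology and Borel structure; points are
   identified with complex numbers by [toC].  Absolute values of complex numbers
   are always Euclidean ([ComplexField.normc]), whereas the norm of the normed
   space [R * R] is the sup norm. *)
Definition toC (R : realType) (p : R * R) : R[i] := p.1 +i* p.2.

Definition cabs (R : realType) (z : R[i]) : R := ComplexField.Normc.normc z.

Fixpoint iter_derive (R : realType) (V W : normedModType R) (vs : seq V)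
    (f : V -> W) : V -> W :=
  if vs is v :: vs' then iter_derive vs' (fun x => 'D_v f x) else f.

(* C^oo: all iterated directional derivatives of f (including f itself) are
   Frechet differentiable, hence exist and are continuous. *)
Definition smooth (R : realType) (V W : normedModType R) (f : V -> W) : Prop :=
  forall (vs : seq V) (x : V), differentiable (iter_derive vs f) x.

Definition smoothC (R : realType) (f : R[i] -> R[i]) : Prop :=
  smooth (fun p : R^o * R^o => complex.Re (f (toC p)) : R^o) /\
  smooth (fun p : R^o * R^o => complex.Im (f (toC p)) : R^o).

Definition Cc_oo_disk (R : realType) (f : R[i] -> R[i]) : Prop :=
  let supp := closure [set p : R * R | f (toC p) != 0] in
  [/\ smoothC f, compact supp & supp `<=` [set p | cabs (toC p) <= 1]].

Definition expi (R : realType) (t : R) : R[i] := cos t +i* sin t.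

(* e(x + iy) = exp(2 pi i x) exp(2 pi i y): a unimodular character of C, not
   the holomorphic exponential. *)
Definition echar (R : realType) (z : R[i]) : R[i] :=
  expi (2 * pi * complex.Re z) * expi (2 * pi * complex.Im z).

Section LebesgueC.
Variable R : realType.

Let plane := (measurableTypeR R * measurableTypeR R)%type.

Definition lebesgueC : set plane -> \bar R :=
  (@lebesgue_measure R \x @lebesgue_measure R)%E.

HB.instance Definition _ := Measure.on lebesgueC.

Lemma lebesgueC_sigma_finite : sigma_finite setT lebesgueC.
Proof.
have /sigma_finiteP[F [TF ndF Foo]] := sigma_finiteT (@lebesgue_measure R).
exists (fun n => F n `*` F n).
  rewrite -setXTT TF predeqE => -[x y]; split.
    move=> [/= [n _ Fnx] [k _ Fky]]; exists (maxn n k) => //; split.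
    - by move: x Fnx; exact/subsetPset/ndF/leq_maxl.
    - by move: y Fky; exact/subsetPset/ndF/leq_maxr.
  by move=> [n _ []/= ? ?]; split; exists n.
move=> k; have [? ?] := Foo k; split; first exact: measurableX.
by rewrite /lebesgueC product_measure1E// lte_mul_pinfty// ge0_fin_numE.
Qed.

HB.instance Definition _ :=
  @Measure_isSigmaFinite.Build _ _ _ lebesgueC lebesgueC_sigma_finite.

Definition integralC (f : R[i] -> R[i]) : R[i] :=
  (\int[lebesgueC]_p complex.Re (f (toC p)))%R +i*
  (\int[lebesgueC]_p complex.Im (f (toC p)))%R.

Definition consC n (p : n.-tuple plane * plane) : n.+1.-tuple plane :=
  [tuple of p.2 :: p.1].

Lemma measurable_consC n : measurable_fun setT (@consC n).
Proof. exact: measurable_cons. Qed.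

(* Lebesgue measure on C^n = R^(2n), a vector being the tuple of its n complex
   coordinates: the image of (measure on C^m) x (measure on C) under [consC]. *)
Fixpoint lebesgueCn n : {measure set (n.-tuple plane) -> \bar R} :=
  if n is m.+1 then
    measure_function_pushforward__canonical__measure_function_Measure
      (lebesgueCn m \x lebesgueC)%E (@measurable_consC m)
  else dirac [tuple].

(* Membership of a complex-valued function in L^q(mu), for 0 < q <= +oo; for
   q <= 0 the library's [Lnorm] takes unrelated conventional values. *)
Definition inLq d (T : measurableType d) (mu : {measure set T -> \bar R})
    (q : \bar R) (f : T -> R[i]) : Prop :=
  [/\ measurable_fun setT (fun x => complex.Re (f x)),
      measurable_fun setT (fun x => complex.Im (f x)) &
      finite_norm mu q (fun x => cabs (f x))].

(* (E b)(w) for the phase w_1 z^(k 1) + ... + w_d z^(k d).  The exponents [k] are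
   indexed from 1, so the coordinate [tnth w j], j : 'I_d, goes with [k j.+1]. *)
Definition extension d (k : nat -> nat) (phi b : R[i] -> R[i])
    (w : d.-tuple plane) : R[i] :=
  integralC (fun z =>
    echar (\sum_(j < d) toC (tnth w j) * z ^+ k j.+1) * b z * phi z).

End LebesgueC.

(* Main.v *)
(* Sufficiency.  Let P be the phase polynomial.  Integrating by parts along the gradient of
   the (harmonic) real phase bounds E1 by C times the integral over the unit disk of
   (1 + m|P''| + m|P'|) / (1 + m|P'|^2), for every m > 0.  Comparing P' with the distance to
   its nearest root, one gets either decay in the coefficients of P, or a point zeta in the
   disk of radius 2 and a number s >= 1 such that |E1| <= C s^(-r), for any prescribed r < 2,
   while the j-th Taylor coefficient of P at zeta is at most s^j.  In the second case the
   product over the exponents k_j of (1 + |c_{k_j}(z)|)^(-b), b > 2, where c_i(z) is the i-th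
   Taylor coefficient at z, is at least c s^(-bK) on the disk of radius 1/s around zeta, so
   s^(-2-bK) is at most a multiple of its integral in z.  For fixed z the map
   w |-> (c_{k_j}(z))_j is unipotent, so the integral in w is finite; by Tonelli this gives
   q > K + 1.  For sparse exponents some k_i - 1 >= 1 is not an exponent; moving a fraction
   tau < 1 of the weight from c_{k_i} to c_{k_i - 1} costs an integrable singularity
   |z|^(-2 tau) and improves the threshold to q > K.

   Necessity.  At scale delta around z0, consider the set of w whose Taylor coefficients
   c_{k_j}(z0) have size about delta^(-k_j).  Averaging over w_1 against the fourth power of a
   Fejer type kernel shows that the integral of |E1| over this set is at least
   c delta^(2-2K), its volume being about delta^(-2K).  With z0 = 0 in case (ii), and
   superposing over z0 in a disk in case (i), where a given w is covered by only O(delta^2)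
   of the points z0, Young's inequality contradicts the integrability of |E1|^q at the
   threshold exponent. *)
From HB Require Import structures.
Require Import Defs.
From mathcomp Require Import all_boot all_order all_algebra.
From mathcomp Require Import complex.
From mathcomp Require Import all_classical all_reals all_analysis.
From mathcomp Require Import measurable_realfun.
From mathcomp Require Import ring lra zify.

Set Implicit Arguments.
Unset Strict Implicit.
Unset Printing Implicit Defensive.

Import Order.TTheory GRing.Theory Num.Theory.
Import numFieldNormedType.Exports.

Local Open Scope classical_set_scope.
Local Open Scope ring_scope.

(** Two endpoint losses are paid for by the strict inequality between q and the threshold. Near a
    root x of P' the kernel is bounded by |z - x|^(-r), integrable in the plane only for r < 2, so
    the rate s^(-2) is missed by a small power; and b > 2 is what makes (1 + |u|)^(-b) integrable.
    The free parameter m is taken to be s^(-2), the square of the scale at which the phase is of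
    size one. For the lower bound, nothing is known about the sign of the integrand away from z0.
    Averaging over w_1 inserts a sinc-type kernel in (z - z0)^(k_1), which changes sign and is only
    bounded by a multiple of |z - z0|^(-k_1), too little when k_1 <= 2. Its fourth power is
    nonnegative and decays like |z - z0|^(-4 k_1), which is integrable at infinity for every k_1 >=
    1, so the tail can be beaten by a large constant B. A single centre only excludes exponents up
    to K. Reaching K + 1 in case (i) takes a continuum of centres with little overlap; keeping the
    last coefficient away from 0 ensures this. *)

Section Modulus.
Variable R : realType.
Implicit Types (z : R[i]) (t : R).

Lemma cabs_ge0 z : 0 <= cabs z.
Proof. by case: z => a b; rewrite /cabs /= sqrtr_ge0. Qed.
Hint Resolve cabs_ge0 : core.

Lemma cabs0 : cabs (0 : R[i]) = 0. Proof. exact: ComplexField.Normc.normc0. Qed.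
Lemma cabs1 : cabs (1 : R[i]) = 1. Proof. exact: ComplexField.Normc.normc1. Qed.

Lemma cabsM z1 z2 : cabs (z1 * z2) = cabs z1 * cabs z2.
Proof. exact: ComplexField.Normc.normcM. Qed.

Lemma cabsD z1 z2 : cabs (z1 + z2) <= cabs z1 + cabs z2.
Proof. exact: le_normcD. Qed.

Lemma cabsN z : cabs (- z) = cabs z.
Proof. exact: normcN. Qed.

Lemma cabsB z1 z2 : cabs (z1 - z2) = cabs (z2 - z1).
Proof. by rewrite -cabsN opprB. Qed.

Lemma cabsX z n : cabs (z ^+ n) = cabs z ^+ n.
Proof. by elim: n => [|n IH]; rewrite ?expr0 ?cabs1// !exprS cabsM IH. Qed.

Lemma cabs_eq0 z : (cabs z == 0) = (z == 0).
Proof.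
apply/eqP/eqP => [|->]; last exact: cabs0.
exact: ComplexField.Normc.eq0_normc.
Qed.

Lemma cabs_gt0 z : (0 < cabs z) = (z != 0).
Proof. by rewrite lt_def cabs_eq0 cabs_ge0 andbT. Qed.

Lemma cabs_sum I (r : seq I) (P : pred I) (F : I -> R[i]) :
  cabs (\sum_(i <- r | P i) F i) <= \sum_(i <- r | P i) cabs (F i).
Proof.
elim/big_ind2 : _ => //; first by rewrite cabs0.
by move=> *; apply: le_trans (cabsD _ _) _; exact: lerD.
Qed.

Lemma cabs_sqr z : cabs z ^+ 2 = complex.Re z ^+ 2 + complex.Im z ^+ 2.
Proof. by case: z => a b; rewrite /cabs /= sqr_sqrtr// addr_ge0 ?sqr_ge0. Qed.

Lemma cabs_real t : cabs t%:C%C = `|t|.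
Proof. by rewrite /cabs /= expr0n /= addr0 sqrtr_sqr. Qed.

Lemma cabs_nat n : cabs (n%:R : R[i]) = n%:R.
Proof. by rewrite -(rmorph_nat (real_complex R)) cabs_real normr_nat. Qed.

Lemma Re_cabs z : `|complex.Re z| <= cabs z.
Proof.
rewrite -ler_sqr ?nnegrE// cabs_sqr real_normK ?num_real//.
by rewrite lerDl sqr_ge0.
Qed.

Lemma Im_cabs z : `|complex.Im z| <= cabs z.
Proof.
rewrite -ler_sqr ?nnegrE// cabs_sqr real_normK ?num_real//.
by rewrite lerDr sqr_ge0.
Qed.

Lemma cabs_ReIm z : cabs z <= `|complex.Re z| + `|complex.Im z|.
Proof.
rewrite -ler_sqr ?nnegrE// ?addr_ge0// cabs_sqr sqrrD !real_normK ?num_real//.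
by rewrite [leRHS]addrAC lerDl mulrn_wge0// mulr_ge0.
Qed.

Lemma lerB_cabs z1 z2 : cabs z1 - cabs z2 <= cabs (z1 - z2).
Proof. by rewrite lerBlDr -{1}(subrK z2 z1); exact: cabsD. Qed.

Lemma ReCD z1 z2 : complex.Re (z1 + z2) = complex.Re z1 + complex.Re z2.
Proof. by case: z1 => a b; case: z2. Qed.
Lemma ImCD z1 z2 : complex.Im (z1 + z2) = complex.Im z1 + complex.Im z2.
Proof. by case: z1 => a b; case: z2. Qed.
Lemma ReCM z1 z2 : complex.Re (z1 * z2) =
  complex.Re z1 * complex.Re z2 - complex.Im z1 * complex.Im z2.
Proof. by case: z1 => a b; case: z2. Qed.
Lemma ImCM z1 z2 : complex.Im (z1 * z2) =
  complex.Re z1 * complex.Im z2 + complex.Im z1 * complex.Re z2.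
Proof. by case: z1 => a b; case: z2. Qed.

Lemma eqC z1 z2 : complex.Re z1 = complex.Re z2 ->
  complex.Im z1 = complex.Im z2 -> z1 = z2.
Proof. by case: z1 => a b; case: z2 => c d /= -> ->. Qed.

Lemma cabs_expi t : cabs (expi t) = 1.
Proof. by rewrite /cabs /expi /= cos2Dsin2 sqrtr1. Qed.

Lemma expiD s t : expi (s + t) = expi s * expi t.
Proof.
by apply: eqC; rewrite ?ReCM ?ImCM /expi /= ?cosD ?sinD //; rewrite addrC (mulrC (cos s)).
Qed.

Lemma echarE z : echar z = expi (2 * pi * (complex.Re z + complex.Im z)).
Proof. by rewrite /echar -expiD -mulrDr. Qed.

Lemma echarD z1 z2 : echar (z1 + z2) = echar z1 * echar z2.
Proof. by rewrite !echarE -expiD ReCD ImCD; congr expi; ring. Qed.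

Lemma cabs_echar z : cabs (echar z) = 1.
Proof. by rewrite echarE cabs_expi. Qed.

End Modulus.
#[global] Hint Extern 0 (is_true (0 <= cabs _)) => solve [apply: cabs_ge0] : core.

(** * Measurability of complex-valued functions via real and imaginary parts *)

Section Measurability.
Context {R : realType} {dX} {X : measurableType dX}.
Implicit Types f g : X -> R[i].

Definition cmeas f := measurable_fun setT (fun x => complex.Re (f x)) /\
  measurable_fun setT (fun x => complex.Im (f x)).

Lemma cmeas_cst (c : R[i]) : cmeas (fun=> c).
Proof. by split; exact: measurable_cst. Qed.

Lemma cmeasD f g : cmeas f -> cmeas g -> cmeas (fun x => f x + g x).
Proof.
move=> [fr fi] [gr gi]; split.
- by under eq_fun do rewrite ReCD; exact: measurable_funD.
- by under eq_fun do rewrite ImCD; exact: measurable_funD.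
Qed.

Lemma cmeasM f g : cmeas f -> cmeas g -> cmeas (fun x => f x * g x).
Proof.
move=> [fr fi] [gr gi]; split.
- by under eq_fun do rewrite ReCM; apply: measurable_funB; exact: measurable_funM.
- by under eq_fun do rewrite ImCM; apply: measurable_funD; exact: measurable_funM.
Qed.

Lemma cmeasX f n : cmeas f -> cmeas (fun x => f x ^+ n).
Proof.
move=> mf; elim: n => [|n IH].
  by under eq_fun do rewrite expr0; exact: cmeas_cst.
by under eq_fun do rewrite exprS; exact: cmeasM.
Qed.

Lemma cmeas_sum I (r : seq I) (F : I -> X -> R[i]) :
  (forall i, cmeas (F i)) -> cmeas (fun x => \sum_(i <- r) F i x).
Proof.
move=> mF; elim: r => [|i r IH].
  by under eq_fun do rewrite big_nil; exact: cmeas_cst.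
by under eq_fun do rewrite big_cons; exact: cmeasD.
Qed.

Lemma measurable_cabs f : cmeas f -> measurable_fun setT (fun x => cabs (f x)).
Proof.
move=> [fr fi].
rewrite (_ : (fun x => _) = Num.sqrt \o
  (fun x => complex.Re (f x) ^+ 2 + complex.Im (f x) ^+ 2)); last first.
  by apply/funext => x /=; rewrite -cabs_sqr sqrtr_sqr ger0_norm.
apply: measurableT_comp; last by apply: measurable_funD; exact: measurable_funX.
by apply: continuous_measurable_fun; exact: sqrt_continuous.
Qed.

Lemma cmeas_echar f : cmeas f -> cmeas (fun x => echar (f x)).
Proof.
move=> [fr fi]; split.
- under eq_fun do rewrite echarE /=.
  apply: (@measurableT_comp _ _ _ _ _ _ (@cos R)).
    by apply: continuous_measurable_fun; exact: continuous_cos.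
  by apply: measurable_funM => //; apply: measurable_funD.
- under eq_fun do rewrite echarE /=.
  apply: (@measurableT_comp _ _ _ _ _ _ (@sin R)).
    by apply: continuous_measurable_fun; exact: continuous_sin.
  by apply: measurable_funM => //; apply: measurable_funD.
Qed.

End Measurability.

Lemma cmeas_comp {R : realType} {dX dY} {X : measurableType dX}
    {Y : measurableType dY} (f : Y -> R[i]) (g : X -> Y) :
  cmeas f -> measurable_fun setT g -> cmeas (f \o g).
Proof.
by move=> [fr fi] mg; split;
  [exact: (measurableT_comp fr mg)|exact: (measurableT_comp fi mg)].
Qed.

Lemma measurable_le_set {R : realType} {dX} {X : measurableType dX}
    (f g : X -> R) : measurable_fun setT f -> measurable_fun setT g ->
  measurable [set x | f x <= g x].
Proof.
move=> mf mg; have /(_ measurableT [set true]) := measurable_fun_ler mf mg.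
by rewrite setTI; apply.
Qed.

(** * Areas of squares and disks *)

Section Plane.
Variable R : realType.
Notation plane := (measurableTypeR R * measurableTypeR R)%type.

Lemma cmeas_toC : cmeas (@toC R : plane -> R[i]).
Proof. by split => /=; [exact: measurable_fst|exact: measurable_snd]. Qed.

Lemma toC_surj (z : R[i]) : exists p : plane, toC p = z.
Proof. by case: z => a b; exists (a, b). Qed.

Definition disk (a : R[i]) (r : R) : set plane :=
  [set p | cabs (toC p - a) <= r].

Lemma disk0E r p : disk 0 r p = (cabs (toC p) <= r).
Proof. by rewrite /disk /mkset subr0. Qed.

Lemma measurable_disk (a : R[i]) (r : R) :
  measurable (disk a r).
Proof.
apply: measurable_le_set => //.
apply: measurable_cabs; apply: cmeasD; [exact: cmeas_toC|exact: cmeas_cst].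
Qed.

Lemma measurable_plane_itv (I J : interval R) :
  measurable ([set` I] `*` [set` J] : set plane).
Proof. by apply: measurableX; exact: measurable_itv. Qed.

Lemma lebesgueC_square (a b r : R) : 0 <= r ->
  lebesgueC (`[a - r, a + r]%classic `*` `[b - r, b + r]%classic) = (4 * r ^+ 2)%:E.
Proof.
move=> r0; rewrite /lebesgueC product_measure1E//=.
have itvE (c : R) : lebesgue_measure `[c - r, c + r]%classic = (2 * r)%:E.
  rewrite lebesgue_measure_itv /= lte_fin ltrBlDr -addrA ltrDl.
  have [r0'|] := ltP 0 (r + r); first by rewrite -EFinD; congr EFin; ring.
  by move=> r0'; congr EFin; lra.
by rewrite !itvE -EFinM; congr EFin; ring.
Qed.

Lemma lebesgueC_disk_le (a : R[i]) (r : R) : 0 <= r ->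
  (lebesgueC (disk a r) <= (4 * r ^+ 2)%:E)%E.
Proof.
move=> r0; rewrite -(lebesgueC_square (complex.Re a) (complex.Im a) r0).
apply: le_measure; rewrite ?inE; [exact: measurable_disk|
  exact: measurable_plane_itv|].
move=> [x y] /= h; case: a h => a b h.
have := le_trans (Re_cabs _) h; have := le_trans (Im_cabs _) h.
rewrite /= !ler_norml !in_itv /= => /andP[? ?] /andP[? ?].
by split; apply/andP; split; lra.
Qed.

Lemma lebesgueC_disk_ge (a : R[i]) (r : R) : 0 <= r ->
  ((r ^+ 2)%:E <= lebesgueC (disk a r))%E.
Proof.
move=> r0; have r20 : 0 <= r / 2 by lra.
have -> : r ^+ 2 = 4 * (r / 2) ^+ 2 by field.
rewrite -(lebesgueC_square (complex.Re a) (complex.Im a) r20).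
apply: le_measure; rewrite ?inE; [exact: measurable_plane_itv|
  exact: measurable_disk|].
move=> [x y] /= []; case: a => a b /=; rewrite !in_itv /= => /andP[? ?] /andP[? ?].
apply: le_trans (cabs_ReIm _) _ => /=.
have : `|x - a| <= r / 2 by rewrite ler_norml; apply/andP; split; lra.
have : `|y - b| <= r / 2 by rewrite ler_norml; apply/andP; split; lra.
lra.
Qed.

End Plane.

(** * Dyadic estimates for decaying and for singular radial functions *)

Section Dyadic.
Variable R : realType.
Notation plane := (measurableTypeR R * measurableTypeR R)%type.
Implicit Types (a : R[i]) (x y : R).

Lemma le_pow2 x : exists k : nat, x <= 2 ^+ k.
Proof.
exists (Num.truncn x).+1; apply: ltW; apply: lt_le_trans (truncnS_gt x) _.
by rewrite -natrX ler_nat ltnW// ltn_expl.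
Qed.

Lemma dyadic_ge x : 0 <= x -> exists k : nat, x <= 2 ^+ k.+1 /\ 2 ^+ k <= 1 + x.
Proof.
move=> x0.
have [k0 hk0] := le_pow2 x.
have ex : exists k : nat, x <= 2 ^+ k.+1.
  by exists k0; apply: le_trans hk0 _; rewrite exprS ler_peMl ?ler1n// exprn_ge0.
case: (ex_minnP ex) => k hk kmin; exists k; split=> //.
case: k hk kmin => [|k] hk kmin; first by rewrite expr0 lerDl.
apply: (@le_trans _ _ x); last by rewrite lerDr.
by rewrite leNgt; apply/negP => /ltW /kmin; rewrite ltnn.
Qed.

Lemma nneseries_ge (u : nat -> \bar R) k : (forall n, (0 <= u n)%E) ->
  (u k <= \sum_(n <oo) u n)%E.
Proof.
move=> u0; rewrite (@nneseriesD1 _ u k xpredT)//; apply: leeDl.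
by apply: nneseries_ge0.
Qed.

Lemma geometric_nneseries (C x : R) : 0 <= C -> 0 <= x < 1 ->
  (\sum_(n <oo) (C * x ^+ n)%:E <= (C / (1 - x))%:E)%E.
Proof.
move=> C0 /andP[x0 x1]; apply: lime_le.
  by apply: is_cvg_nneseries => n _ _; rewrite lee_fin mulr_ge0// exprn_ge0.
apply: nearW => n; rewrite sumEFin lee_fin -mulr_sumr ler_wpM2l//.
rewrite -(ler_pM2r (_ : 0 < 1 - x)) ?subr_gt0// mulVf ?gt_eqF ?subr_gt0//.
rewrite mulrC -opprB mulNr big_mkord -subrX1 opprB lerBlDr lerDl exprn_ge0//.
Qed.

(** Radial functions are dominated by series of indicators of dyadic disks: growing disks for decay
    at infinity, shrinking disks for a singularity. *)
Lemma integral_disk_series a (al r : nat -> R) :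
  (forall k, 0 <= al k) -> (forall k, 0 <= r k) ->
  (\int[@lebesgueC R]_p (\sum_(k <oo) (al k * \1_(disk a (r k)) p)%:E)
   <= \sum_(k <oo) (al k * (4 * r k ^+ 2))%:E)%E.
Proof.
move=> al0 r0; rewrite integral_nneseries//; last 2 first.
- by move=> k; apply/measurable_EFinP; apply: measurable_funM => //;
    apply: measurable_indic; exact: measurable_disk.
- by move=> k p _; rewrite lee_fin mulr_ge0.
apply: lee_nneseries => k _ //; first by move=> _; apply: integral_ge0 => p _; rewrite lee_fin mulr_ge0.
under eq_integral do rewrite EFinM.
rewrite ge0_integralZl_EFin//; last first.
  by apply/measurable_EFinP; apply: measurable_indic; exact: measurable_disk.
rewrite integral_indic//; last exact: measurable_disk.
by rewrite setIT EFinM lee_wpmul2l ?lee_fin// lebesgueC_disk_le.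
Qed.

Lemma powR_expr (x b : R) k : 0 <= x -> (x ^+ k) `^ b = (x `^ b) ^+ k.
Proof.
move=> x0; rewrite -(powR_mulrn _ x0) -(powR_mulrn _ (powR_ge0 _ _)).
by rewrite -!powRrM [_ * b]mulrC.
Qed.

Lemma powRN_le (x y b : R) : 0 <= b -> 0 < x -> x <= y -> y `^ (- b) <= x `^ (- b).
Proof.
move=> b0 x0 xy; have y0 := lt_le_trans x0 xy.
rewrite !powRN lef_pV2 ?posrE ?powR_gt0//.
by apply: ge0_ler_powR => //; rewrite nnegrE ltW.
Qed.

Lemma expr4 k : 4 ^+ k = (2 ^+ k) ^+ 2 :> R.
Proof. by rewrite -exprM mulnC exprM; congr (_ ^+ _); ring. Qed.

Lemma decay_integral (b : R) : 2 < b -> exists2 C : R, 0 <= C &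
  forall (l : R) a, 0 < l ->
  (\int[@lebesgueC R]_p ((1 + l * cabs (toC p - a)) `^ (- b))%:E <= (C / l ^+ 2)%:E)%E.
Proof.
move=> b2; have b0 : 0 <= b by lra.
pose y : R := 2 `^ (- b).
have y0 : 0 <= y by exact: powR_ge0.
have y1 : 4 * y < 1.
  rewrite /y powRN -ltr_pdivlMr ?invr_gt0 ?powR_gt0// invrK mul1r.
  have -> : 4 = 2 `^ 2 :> R by rewrite powR_mulrn//; ring.
  by rewrite /powR gt_eqF// ltr_expR ltr_pM2r// ln_gt0// ltr1n.
(* The k-th disk has radius 2^(k+1) / l and weight y^k, so the series is 16 / l^2 times a geometric
   series of ratio 4 y; b > 2 says that 4 y < 1. *)
exists (16 / (1 - 4 * y)); first by rewrite divr_ge0//; lra.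
move=> l a l0.
have -> : 16 / (1 - 4 * y) / l ^+ 2 = (16 / l ^+ 2) / (1 - 4 * y) by rewrite mulrAC.
apply: le_trans (geometric_nneseries _ _); last 2 first.
- by rewrite divr_ge0// exprn_ge0// ltW.
- by apply/andP; split=> //; lra.
pose r k : R := 2 ^+ k.+1 / l.
have r0 k : 0 <= r k by rewrite divr_ge0 ?exprn_ge0// ltW.
rewrite (_ : \sum_(n <oo) _ = \sum_(k <oo) (y ^+ k * (4 * r k ^+ 2))%:E)%E; last first.
  apply: eq_eseriesr => k _; congr EFin.
  rewrite /r exprMn expr4 (exprS _ k) expr_div_n; set u := 2 ^+ k.
  by rewrite exprMn; ring.
apply: le_trans (integral_disk_series a _ r0) => [|k]; last exact: exprn_ge0.
apply: ge0_le_integral => //.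
- by move=> p _; rewrite lee_fin powR_ge0.
- apply/measurable_EFinP.
  apply: (@measurableT_comp _ _ _ _ _ _ (fun x : R => x `^ (- b))).
    exact: measurable_powR.
  apply: measurable_funD => //; apply: measurable_funM => //.
  by apply: measurable_cabs; apply: cmeasD; [exact: cmeas_toC|exact: cmeas_cst].
- apply: ge0_emeasurable_sum => [k p _ _|k _].
    by rewrite lee_fin mulr_ge0// exprn_ge0.
  apply/measurable_EFinP; apply: measurable_funM => //.
  by apply: measurable_indic; exact: measurable_disk.
move=> p _; set x := l * cabs _.
have x0 : 0 <= x by rewrite mulr_ge0// ltW.
have [k [hk1 hk2]] := dyadic_ge x0.
apply: le_trans (nneseries_ge k _); last first.
  by move=> n; rewrite lee_fin mulr_ge0// exprn_ge0.
rewrite lee_fin indicE mem_set ?mulr1; last first.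
  by rewrite /disk /= /r ler_pdivlMr// mulrC.
by rewrite /y -powR_expr//; apply: powRN_le => //; exact: exprn_gt0.
Qed.

(* Majorant of p |-> |p - a|^(-r) on the disk of radius 1 around a; unlike a
   power, it is +oo at a. *)
Definition singular (r : R) a (p : plane) : \bar R :=
  (\sum_(k <oo) (((2 `^ r) ^+ k.+1) * \1_(disk a (2 ^- k)) p)%:E)%E.

Lemma singular_ge0 r a p : (0 <= singular r a p)%E.
Proof.
by apply: nneseries_ge0 => k _ _; rewrite lee_fin mulr_ge0// exprn_ge0// powR_ge0.
Qed.

Lemma measurable_singular r a : measurable_fun setT (singular r a).
Proof.
apply: ge0_emeasurable_sum => [k p _ _|k _].
  by rewrite lee_fin mulr_ge0// exprn_ge0// powR_ge0.
apply/measurable_EFinP; apply: measurable_funM => //.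
by apply: measurable_indic; exact: measurable_disk.
Qed.

(** Any t above the distance is allowed, so that at the centre itself t may tend to 0, which yields
    the value +oo there. *)
Lemma singular_ge r a p t : 0 <= r -> 0 < t <= 1 -> cabs (toC p - a) <= t ->
  ((t `^ (- r))%:E <= singular r a p)%E.
Proof.
move=> r0 /andP[t0 t1] pt.
have [k0 hk0] := le_pow2 t^-1.
have ex : exists k : nat, t^-1 <= 2 ^+ k.+1.
  by exists k0; apply: le_trans hk0 _; rewrite exprS ler_peMl ?ler1n// exprn_ge0.
have [k hk kmin] := ex_minnP ex.
have tk : t <= 2 ^- k.
  case: k hk kmin => [|k] hk kmin; first by rewrite expr0 invr1.
  rewrite -[leLHS]invrK lef_pV2 ?posrE ?invr_gt0 ?exprn_gt0//.
  by rewrite leNgt; apply/negP => /ltW /kmin; rewrite ltnn.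
apply: le_trans (nneseries_ge k _); last first.
  by move=> n; rewrite lee_fin mulr_ge0// exprn_ge0// powR_ge0.
rewrite lee_fin indicE mem_set ?mulr1; last exact: le_trans tk.
have -> : (2 `^ r) ^+ k.+1 = (2 ^- k.+1) `^ (- r).
  by rewrite -powR_expr// !powRN -powR_inv1 ?exprn_ge0// powRAC powR_inv1// ?invrK// powR_ge0.
apply: powRN_le => //.
by rewrite -[leRHS]invrK lef_pV2 ?posrE ?invr_gt0 ?exprn_gt0.
Qed.

Lemma integral_singular (r : R) : 0 <= r < 2 -> exists2 C : R, 0 <= C &
  forall a, (\int[@lebesgueC R]_p singular r a p <= C%:E)%E.
Proof.
move=> /andP[r0 r2]; pose y : R := 2 `^ r / 4.
have y0 : 0 <= y by rewrite divr_ge0// powR_ge0.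
have y1 : y < 1.
  rewrite /y ltr_pdivrMr// mul1r.
  have -> : 4 = 2 `^ 2 :> R by rewrite powR_mulrn//; ring.
  by rewrite /powR gt_eqF// ltr_expR ltr_pM2r// ln_gt0// ltr1n.
(* Weights 2^(r (k+1)) against areas at most 4 * 4^(-k): the ratio is 2^r / 4, below 1 because r <
   2. *)
exists (4 * 2 `^ r / (1 - y)).
  by rewrite divr_ge0// ?mulr_ge0 ?powR_ge0//; lra.
move=> a; apply: le_trans (geometric_nneseries _ _); last 2 first.
- by rewrite mulr_ge0// powR_ge0.
- exact/andP.
rewrite (_ : \sum_(n <oo) (_ * y ^+ n)%:E =
    \sum_(k <oo) ((2 `^ r) ^+ k.+1 * (4 * (2 ^- k) ^+ 2))%:E)%E; last first.
  apply: eq_eseriesr => k _; congr EFin; rewrite /y exprMn !exprVn.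
  by rewrite expr4 (exprS _ k); set u := 2 ^+ k; set v := _ ^+ k; ring.
apply: integral_disk_series => k; first by rewrite exprn_ge0// powR_ge0.
by rewrite invr_ge0 exprn_ge0.
Qed.

End Dyadic.

(** * Sigma-finiteness and Tonelli on C^n *)

Section LebesgueCn.
Variable R : realType.
Notation plane := (measurableTypeR R * measurableTypeR R)%type.

Lemma lebesgueCn_sigma_finite d : sigma_finite setT (lebesgueCn R d).
Proof.
elim: d => [|d IH].
  exists (fun=> setT); first by rewrite bigcup_const.
  by move=> n; split=> //=; rewrite diracT ltry.
have /sigma_finiteP[F [TF ndF Foo]] := IH.
have /sigma_finiteP[G [TG ndG Goo]] := @lebesgueC_sigma_finite R.
exists (fun n => [set w : d.+1.-tuple plane | F n [tuple of behead w] /\ G n (thead w)]).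
  apply/seteqP; split=> // w _.
  have : setT [tuple of behead w] by []; rewrite TF => -[i _ Fi].
  have : setT (thead w) by []; rewrite TG => -[j _ Gj].
  exists (maxn i j) => //; split.
  - by move: Fi; exact/subsetPset/ndF/leq_maxl.
  - by move: Gj; exact/subsetPset/ndG/leq_maxr.
move=> n; have [mF FF] := Foo n; have [mG GG] := Goo n.
have mS : measurable [set w : d.+1.-tuple plane |
    F n [tuple of behead w] /\ G n (thead w)].
  apply: measurableI.
    by rewrite -[X in measurable X]setTI; exact: measurable_behead.
  by rewrite -[X in measurable X]setTI; exact: (measurable_tnth ord0).
split=> //=; rewrite /pushforward.
rewrite (_ : _ @^-1` _ = F n `*` G n); last first.
  have E (t : d.-tuple plane) (x : plane) :
      [tuple of behead (consC (t, x))] = t by exact: val_inj.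
  by apply/seteqP; split=> -[t x] /=; rewrite -/(consC (t, x)) E.
by rewrite product_measure1E// lte_mul_pinfty// ge0_fin_numE.
Qed.

(** A named copy of the recursively defined measure, to which the sigma-finite structure required by
    Tonelli is attached. *)
Definition lebCn d : set (d.-tuple plane) -> \bar R := lebesgueCn R d.
HB.instance Definition _ d := Measure.copy (@lebCn d) (lebesgueCn R d).
HB.instance Definition _ d :=
  @Measure_isSigmaFinite.Build _ _ _ (@lebCn d) (lebesgueCn_sigma_finite d).

Lemma integral_lebesgueCn0 (f : 0.-tuple plane -> \bar R) :
  measurable_fun setT f ->
  (\int[lebesgueCn R 0]_w f w = f [tuple])%E.
Proof. by move=> mf; rewrite /= integral_dirac// diracT mul1e. Qed.

(** [consC] puts the new coordinate in front, so the inner integral runs over w_1. Both the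
    triangular integrals and the averaging over w_1 rely on this order. *)
Lemma integral_lebesgueCnS d (f : d.+1.-tuple plane -> \bar R) :
  measurable_fun setT f -> (forall w, 0 <= f w)%E ->
  (\int[lebesgueCn R d.+1]_w f w =
   \int[lebesgueCn R d]_t \int[@lebesgueC R]_x f (consC (t, x)))%E.
Proof.
move=> mf f0 /=.
rewrite ge0_integral_pushforward//=; last exact: measurable_consC.
rewrite preimage_setT.
have mfc : measurable_fun setT (f \o @consC R d).
  by apply: measurableT_comp => //; exact: measurable_consC.
exact: (@fubini_tonelli1 _ _ _ _ _ (@lebCn d) (@lebesgueC R) (f \o @consC R d) mfc
  (fun=> f0 _)).
Qed.

Lemma tonelli_lebesgueCn d (f : d.-tuple plane * plane -> \bar R) :
  measurable_fun setT f -> (forall w, 0 <= f w)%E ->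
  (\int[lebesgueCn R d]_w \int[@lebesgueC R]_z f (w, z) =
   \int[@lebesgueC R]_z \int[lebesgueCn R d]_w f (w, z))%E.
Proof.
move=> mf f0.
exact: (@fubini_tonelli _ _ _ _ _ (@lebCn d) (@lebesgueC R) f mf).
Qed.

End LebesgueCn.

(** * Integrals of products of triangular linear forms *)

Section Triangular.
Variable R : realType.
Notation plane := (measurableTypeR R * measurableTypeR R)%type.

Definition linform d (A : nat -> nat -> R[i]) (j : nat) (w : d.-tuple plane) : R[i] :=
  \sum_(l < d) A j l * toC (tnth w l).

Lemma cmeas_linform d A j : cmeas (@linform d A j).
Proof.
apply: cmeas_sum => l; apply: cmeasM; first exact: cmeas_cst.
by apply: cmeas_comp; [exact: cmeas_toC|exact: measurable_tnth].
Qed.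

Lemma linform_cons d (A : nat -> nat -> R[i]) j (t : d.-tuple plane) (x : plane) :
  linform A j (consC (t, x)) =
  A j 0%N * toC x + linform (fun j l => A j l.+1) j t.
Proof.
rewrite /linform big_ord_recl /= (tnth_nth (0, 0))/=; congr (_ + _).
by apply: eq_bigr => l _; rewrite !(tnth_nth (0, 0)).
Qed.

(** Joint measurability stated through compositions, in keeping with [cmeas], which tests complex
    functions on their real and imaginary parts. *)
Definition bimeas (g : R[i] -> R[i] -> R) := forall dX (X : measurableType dX)
  (u v : X -> R[i]), cmeas u -> cmeas v -> measurable_fun setT (fun x => g (u x) (v x)).

Lemma measurable_prodR dX (X : measurableType dX) d (F : 'I_d -> X -> R) :
  (forall j, measurable_fun setT (F j)) ->
  measurable_fun setT (fun x => \prod_(j < d) F j x).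
Proof.
elim: d F => [|d IH] F mF.
  by under eq_fun do rewrite big_ord0; exact: measurable_cst.
under eq_fun do rewrite big_ord_recl.
by apply: measurable_funM => //; exact: IH.
Qed.

Section Bounds.
Variables (g : nat -> R[i] -> R[i] -> R).
Hypothesis g0 : forall j u v, 0 <= g j u v.
Hypothesis mg : forall j, bimeas (g j).

(** Two forms per factor, because one factor of the majorant depends on c_{k_i} and c_{k_i - 1}
    together. *)
Definition triprod d (A B : nat -> nat -> R[i]) (w : d.-tuple plane) : R :=
  \prod_(j < d) g j (linform A j w) (linform B j w).

Lemma triprod_ge0 d A B (w : d.-tuple plane) : 0 <= triprod A B w.
Proof. by apply: prodr_ge0. Qed.

Lemma measurable_triprod d A B : measurable_fun setT (@triprod d A B).
Proof.
by apply: measurable_prodR => j; apply: mg; exact: cmeas_linform.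
Qed.

End Bounds.

Lemma triprod_cons (g : nat -> R[i] -> R[i] -> R) d (A B : nat -> nat -> R[i])
    (t : d.-tuple plane) (x : plane) :
  (forall j l, (l < j)%N -> A j l = 0) -> (forall j l, (l < j)%N -> B j l = 0) ->
  triprod g A B (consC (t, x)) =
  triprod (fun j => g j.+1) (fun j l => A j.+1 l.+1) (fun j l => B j.+1 l.+1) t *
  g 0%N (A 0%N 0%N * toC x + linform (fun j l => A j l.+1) 0 t)
        (B 0%N 0%N * toC x + linform (fun j l => B j l.+1) 0 t).
Proof.
move=> tA tB; rewrite /triprod big_ord_recl mulrC; congr (_ * _); last first.
  by rewrite !linform_cons.
by apply: eq_bigr => j _; rewrite !linform_cons tA// tB// !mul0r !add0r.
Qed.

(** By triangularity w_1 occurs only in the factor of index 0. It is integrated first; the other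
    coordinates act on that factor as translations [b], [b'], and a bound uniform in them leaves the
    same problem in one dimension less. This takes the place of a triangular change of variables. *)
Lemma integral_triprod_le (g : nat -> R[i] -> R[i] -> R) (c : nat -> R) d
    (A B : nat -> nat -> R[i]) :
  (forall j u v, 0 <= g j u v) -> (forall j, bimeas (g j)) ->
  (forall j, 0 <= c j) ->
  (forall j l, (l < j)%N -> A j l = 0) -> (forall j l, (l < j)%N -> B j l = 0) ->
  (forall j b b', (j < d)%N ->
    \int[@lebesgueC R]_x (g j (A j j * toC x + b) (B j j * toC x + b'))%:E <= (c j)%:E)%E ->
  (\int[lebesgueCn R d]_w (triprod g A B w)%:E <= (\prod_(j < d) c j)%:E)%E.
Proof.
elim: d g c A B => [|d IH] g c A B g0 mg c0 tA tB hg.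
  rewrite integral_lebesgueCn0; first by rewrite /triprod !big_ord0.
  by apply/measurable_EFinP; exact: measurable_triprod.
rewrite integral_lebesgueCnS; last 2 first.
- by apply/measurable_EFinP; exact: measurable_triprod.
- by move=> w; rewrite lee_fin triprod_ge0.
pose G := triprod (fun j => g j.+1) (fun j l => A j.+1 l.+1) (fun j l => B j.+1 l.+1).
have mG : measurable_fun setT (G d) by exact: measurable_triprod.
rewrite big_ord_recl EFinM.
apply: (@le_trans _ _ (\int[lebesgueCn R d]_t ((c 0%N)%:E * (G d t)%:E))%E); last first.
  rewrite ge0_integralZl_EFin//; last first.
  - exact/measurable_EFinP.
  - by move=> t _; rewrite lee_fin triprod_ge0.
  rewrite lee_wpmul2l ?lee_fin//; apply: (IH _ (fun j => c j.+1)) => //.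
  - by move=> j l lj; apply: tA; rewrite ltnS.
  - by move=> j l lj; apply: tB; rewrite ltnS.
  - by move=> j b b' jd; exact: hg.
apply: ge0_le_integral => //.
- by move=> t _; apply: integral_ge0 => x _; rewrite lee_fin triprod_ge0.
- apply: (@measurable_fun_fubini_tonelli_F _ _ _ _ _ (@lebesgueC R)
    (fun p => (triprod g A B (consC p))%:E)); last first.
    by move=> p; rewrite lee_fin triprod_ge0.
  apply/measurable_EFinP; apply: measurableT_comp; first exact: measurable_triprod.
  exact: measurable_consC.
- by apply/measurable_EFinP; exact: measurable_funM.
move=> t _.
under eq_integral do rewrite triprod_cons// EFinM.
rewrite ge0_integralZl_EFin//; last 3 first.
- by move=> x _; rewrite lee_fin.
- by apply/measurable_EFinP; apply: mg; (apply: cmeasD;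
    [apply: cmeasM; [exact: cmeas_cst|exact: cmeas_toC]|exact: cmeas_cst]).
- exact: triprod_ge0.
by rewrite muleC lee_wpmul2r ?lee_fin ?triprod_ge0//; exact: hg.
Qed.

Lemma integral_triprod_ge (g : nat -> R[i] -> R[i] -> R) (c : nat -> R) d
    (A B : nat -> nat -> R[i]) :
  (forall j u v, 0 <= g j u v) -> (forall j, bimeas (g j)) ->
  (forall j, 0 <= c j) ->
  (forall j l, (l < j)%N -> A j l = 0) -> (forall j l, (l < j)%N -> B j l = 0) ->
  (forall j b b', (j < d)%N ->
    (c j)%:E <= \int[@lebesgueC R]_x (g j (A j j * toC x + b) (B j j * toC x + b'))%:E)%E ->
  ((\prod_(j < d) c j)%:E <= \int[lebesgueCn R d]_w (triprod g A B w)%:E)%E.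
Proof.
elim: d g c A B => [|d IH] g c A B g0 mg c0 tA tB hg.
  rewrite integral_lebesgueCn0; first by rewrite /triprod !big_ord0.
  by apply/measurable_EFinP; exact: measurable_triprod.
rewrite integral_lebesgueCnS; last 2 first.
- by apply/measurable_EFinP; exact: measurable_triprod.
- by move=> w; rewrite lee_fin triprod_ge0.
pose G := triprod (fun j => g j.+1) (fun j l => A j.+1 l.+1) (fun j l => B j.+1 l.+1).
have mG : measurable_fun setT (G d) by exact: measurable_triprod.
rewrite big_ord_recl EFinM.
apply: (@le_trans _ _ (\int[lebesgueCn R d]_t ((c 0%N)%:E * (G d t)%:E))%E).
  rewrite ge0_integralZl_EFin//; last first.
  - exact/measurable_EFinP.
  - by move=> t _; rewrite lee_fin triprod_ge0.
  rewrite lee_wpmul2l ?lee_fin//; apply: (IH _ (fun j => c j.+1)) => //.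
  - by move=> j l lj; apply: tA; rewrite ltnS.
  - by move=> j l lj; apply: tB; rewrite ltnS.
  - by move=> j b b' jd; exact: hg.
apply: ge0_le_integral => //.
- by move=> t _; rewrite -EFinM lee_fin mulr_ge0// triprod_ge0.
- by apply/measurable_EFinP; exact: measurable_funM.
- apply: (@measurable_fun_fubini_tonelli_F _ _ _ _ _ (@lebesgueC R)
    (fun p => (triprod g A B (consC p))%:E)); last first.
    by move=> p; rewrite lee_fin triprod_ge0.
  apply/measurable_EFinP; apply: measurableT_comp; first exact: measurable_triprod.
  exact: measurable_consC.
move=> t _.
under eq_integral do rewrite triprod_cons// EFinM.
rewrite ge0_integralZl_EFin//; last 3 first.
- by move=> x _; rewrite lee_fin.
- by apply/measurable_EFinP; apply: mg; (apply: cmeasD;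
    [apply: cmeasM; [exact: cmeas_cst|exact: cmeas_toC]|exact: cmeas_cst]).
- exact: triprod_ge0.
by rewrite muleC lee_wpmul2l ?lee_fin ?triprod_ge0//; exact: hg.
Qed.

End Triangular.

(** * Borel measurability in the plane, and integrals of derivatives on the line *)

Section ContinuousPlane.
Variable R : realType.
Notation plane := (measurableTypeR R * measurableTypeR R)%type.

(** Preimages of open rays are open for the product topology, hence countable unions of rational
    boxes, which lie in the product sigma-algebra. *)
Lemma continuous_plane_measurable (f : R^o * R^o -> R^o) :
  continuous f -> measurable_fun setT (f : plane -> R).
Proof.
move=> cf mD; apply: (measurability _ (RGenOInfty.measurableE R)) => //.
move=> /= _ [_ [a ->] <-]; rewrite setTI.
set U := _ @^-1` _.
pose box (q1 q2 r : rat) : set plane :=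
  [set p | `|(p.1 : R) - ratr q1| < ratr r /\ `|(p.2 : R) - ratr q2| < ratr r].
have mbox q1 q2 r : measurable (box q1 q2 r).
  have -> : box q1 q2 r =
      `](ratr q1 - ratr r), (ratr q1 + ratr r)[%classic `*`
      `](ratr q2 - ratr r), (ratr q2 + ratr r)[%classic.
    by apply/seteqP; split=> -[x y]; rewrite /box /= !in_itv /= !ltr_distl.
  by apply: measurableX; exact: measurable_itv.
pose S q1 q2 r : set plane := [set p | box q1 q2 r p /\ box q1 q2 r `<=` U].
have mS q1 q2 r : measurable (S q1 q2 r).
  have [h|h] := pselect (box q1 q2 r `<=` U).
    rewrite (_ : S _ _ _ = box q1 q2 r)//.
    by apply/seteqP; split=> p => [[]|].
  by rewrite (_ : S _ _ _ = set0)//; apply/seteqP; split=> p => [[]|].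
suff -> : U = \bigcup_q1 \bigcup_q2 \bigcup_r S q1 q2 r.
  by apply: bigcupT_measurable_rat => q1; apply: bigcupT_measurable_rat => q2;
    apply: bigcupT_measurable_rat => r.
apply/seteqP; split=> [[x y] Uxy|p [q1 _ [q2 _ [r _ [pb]]]]]; last exact.
have oU : nbhs ((x, y) : R^o * R^o) U.
  apply: (cf (x, y)); move: Uxy; rewrite /U /= in_itv /= andbT => axy.
  by apply: open_nbhs_nbhs; split; [exact: interval_open|rewrite /= in_itv /= andbT].
have [e /= e0 he] := (nbhs_ballP _ _).1 oU.
have e40 : 0 < e / 4 by rewrite divr_gt0.
(* The box centre is within e/4 of the point and its half-side lies between e/4 and e/2, so the box
   contains the point and stays within e of it. *)
have [q1 hq1] := @rat_in_itvoo R (x - e / 4) (x + e / 4) ltac:(lra).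
have [q2 hq2] := @rat_in_itvoo R (y - e / 4) (y + e / 4) ltac:(lra).
have [r hr] := @rat_in_itvoo R (e / 4) (e / 2) ltac:(lra).
move: hq1 hq2 hr; rewrite !in_itv /= => /andP[? ?] /andP[? ?] /andP[? ?].
exists q1 => //; exists q2 => //; exists r => //; split.
  by split => /=; rewrite ltr_distl; apply/andP; split; lra.
move=> [x' y'] [/=]; rewrite !ltr_distl => /andP[? ?] /andP[? ?].
by apply: he; split => /=; rewrite /ball /= ltr_distl; apply/andP; split; lra.
Qed.

Lemma integral_derive0 (g g' : R -> R) :
  (forall x : R, is_derive x (1 : R) (g : R -> R) (g' x)) -> continuous (g' : R^o -> R^o) ->
  (forall x, 2 <= `|x| -> g x = 0) -> (forall x, 2 <= `|x| -> g' x = 0) ->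
  (\int[@lebesgue_measure R]_x (g' x)%:E = 0)%E.
Proof.
move=> dg cg' g0 g'0.
have dgx x : derivable g x 1 by have [] := dg x.
have cg : continuous (g : R^o -> R^o).
  by move=> x; apply: differentiable_continuous; apply/derivable1_diffP.
have -> : (\int[@lebesgue_measure R]_x (g' x)%:E =
    \int[@lebesgue_measure R]_(x in `[(- 2)%R, 2%R]) (g' x)%:E)%E.
  rewrite [RHS]integral_mkcond; apply: eq_integral => x _.
  rewrite patchE; case: ifPn => //; rewrite notin_setE /= in_itv /= => /negP.
  rewrite -ler_norml -ltNge => /ltW /g'0 -> //.
rewrite (@continuous_FTC2 _ g' g)//.
- by rewrite !g0 ?subee// ?normrN ger0_norm.
- by rewrite ltrNl; lra.
- exact: continuous_subspaceT.
- split; [by move=> x _; exact: dgx|by apply: cvg_at_right_filter; exact: cg|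
    by apply: cvg_at_left_filter; exact: cg].
- by move=> x _; rewrite derive1E; apply: derive_val.
Qed.

End ContinuousPlane.

(** * Bounded functions supported in the unit disk *)

Section BoundedSupport.
Variable R : realType.
Notation plane := (measurableTypeR R * measurableTypeR R)%type.

Definition bsupp (M : R) (f : plane -> R) :=
  [/\ measurable_fun setT f, forall p, `|f p| <= M &
      forall p, 1 < cabs (toC p) -> f p = 0].

Lemma lebesgueC_disk_lty (a : R[i]) r : 0 <= r -> (lebesgueC (disk a r) < +oo)%E.
Proof. by move=> r0; apply: le_lt_trans (lebesgueC_disk_le a r0) _; rewrite ltry. Qed.

Lemma bsupp_restrict M f : bsupp M f -> f = f \_ (disk 0 1).
Proof.
move=> [_ _ f0]; apply/funext => p; rewrite patchE; case: ifPn => //.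
rewrite notin_setE disk0E => /negP; rewrite -ltNge => h.
by rewrite f0.
Qed.

Lemma bsupp_integrable M f : bsupp M f ->
  (@lebesgueC R).-integrable setT (EFin \o f).
Proof.
move=> bf; have [mf fM f0] := bf.
rewrite (bsupp_restrict bf) -restrict_EFin -integrable_mkcond; last exact: measurable_disk.
apply: measurable_bounded_integrable.
- exact: measurable_disk.
- exact: lebesgueC_disk_lty.
- exact: measurable_funTS.
- exists M; split; first exact: num_real.
  by move=> y My p _; apply: le_trans (fM p) _; exact: ltW.
Qed.

Lemma bsupp_fubini12 M f : bsupp M f ->
  (\int[@lebesgueC R]_p (f p)%:E =
   \int[@lebesgue_measure R]_x \int[@lebesgue_measure R]_y (f (x, y))%:E)%E.
Proof.
move=> /bsupp_integrable fi.
by rewrite /lebesgueC -(integral12_prod_meas1 fi).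
Qed.

Lemma bsupp_fubini21 M f : bsupp M f ->
  (\int[@lebesgueC R]_p (f p)%:E =
   \int[@lebesgue_measure R]_y \int[@lebesgue_measure R]_x (f (x, y))%:E)%E.
Proof.
move=> /bsupp_integrable fi.
by rewrite /lebesgueC -(integral21_prod_meas1 fi).
Qed.

End BoundedSupport.

(** * Partial derivatives of test functions *)

Section TestFunctions.
Variable R : realType.
Notation plane := (measurableTypeR R * measurableTypeR R)%type.

Lemma continuous_bsupp (f : R^o * R^o -> R^o) (K : set (R * R)) :
  continuous f -> compact K -> K `<=` [set p | cabs (toC p) <= 1] ->
  (forall p, ~ K p -> f p = 0) -> exists M, bsupp M (f : plane -> R).
Proof.
move=> cf cK K1 f0.
have /compact_bounded : compact (f @` K).
  by apply: continuous_compact => //; exact: continuous_subspaceT.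
move=> -[M [Mr hM]]; exists (Num.max M 0 + 1); split.
- exact: continuous_plane_measurable.
- move=> p; have [Kp|/f0 ->] := pselect (K p); last first.
    by rewrite normr0 addr_ge0// le_max lexx orbT.
  apply: (hM (Num.max M 0 + 1)); last by exists p.
  by rewrite ltr_pwDr// le_max lexx.
- by move=> p p1; apply: f0 => /K1 /=; rewrite leNgt p1.
Qed.

Lemma derive_off_supp (f : R^o * R^o -> R^o) (K : set (R * R)) v :
  closed (K : set (R^o * R^o)) -> (forall p, ~ K p -> f p = 0) ->
  forall p, ~ K p -> 'D_v f p = 0.
Proof.
move=> cK f0 p nKp.
rewrite (@near_eq_derive _ _ _ f (cst 0)); first exact: derive_cst.
have : nbhs (p : R^o * R^o) (~` K).
  by apply: open_nbhs_nbhs; split=> //; exact: closed_openC.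
by apply: filterS => q /f0 ->.
Qed.

Lemma is_derive_fst (f : R^o * R^o -> R^o) (x y : R) :
  differentiable f (x, y) ->
  is_derive (x : R^o) (1 : R^o) (fun t : R^o => f (t, y)) ('D_(1, 0) f (x, y)).
Proof.
move=> df; have dd := @diff_derivable _ _ _ f (x, y) (1, 0) df.
have E : (fun h : R => h^-1 *: (((fun t : R^o => f (t, y)) \o shift x) (h *: (1 : R^o)) - f (x, y))) =
  (fun h : R => h^-1 *: ((f \o shift (x, y)) (h *: ((1, 0) : R^o * R^o)) - f (x, y))).
  apply/funext => h /=; congr (_ *: (f _ - _)).
  rewrite /= [RHS](_ : _ = (h *: (1 : R^o) + x, h *: (0 : R^o) + y)) //.
  by rewrite scaler0 add0r.
by constructor; rewrite ?/derivable ?/derive E.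
Qed.

Lemma is_derive_snd (f : R^o * R^o -> R^o) (x y : R) :
  differentiable f (x, y) ->
  is_derive (y : R^o) (1 : R^o) (fun t : R^o => f (x, t)) ('D_(0, 1) f (x, y)).
Proof.
move=> df; have dd := @diff_derivable _ _ _ f (x, y) (0, 1) df.
have E : (fun h : R => h^-1 *: (((fun t : R^o => f (x, t)) \o shift y) (h *: (1 : R^o)) - f (x, y))) =
  (fun h : R => h^-1 *: ((f \o shift (x, y)) (h *: ((0, 1) : R^o * R^o)) - f (x, y))).
  apply/funext => h /=; congr (_ *: (f _ - _)).
  rewrite /= [RHS](_ : _ = (h *: (0 : R^o) + x, h *: (1 : R^o) + y)) //.
  by rewrite scaler0 add0r.
by constructor; rewrite ?/derivable ?/derive E.
Qed.

(** What integration by parts along horizontal and vertical lines uses: partial derivatives as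
    derivatives in one variable, continuous along their line, and one common bound and support. *)
Record C1supp (M : R) (f fx fy : R * R -> R) : Prop := {
  C1_f : bsupp M (f : plane -> R);
  C1_fx : bsupp M (fx : plane -> R);
  C1_fy : bsupp M (fy : plane -> R);
  C1_dx : forall x y : R, is_derive (x : R) (1 : R) (fun t : R => f (t, y)) (fx (x, y));
  C1_dy : forall x y : R, is_derive (y : R) (1 : R) (fun t : R => f (x, t)) (fy (x, y));
  C1_cx : forall y : R, continuous ((fun t => fx (t, y)) : R^o -> R^o);
  C1_cy : forall x : R, continuous ((fun t => fy (x, t)) : R^o -> R^o) }.

Lemma bsuppW M M' f : M <= M' -> bsupp M f -> bsupp M' (f : plane -> R).
Proof. by move=> MM [mf fM f0]; split=> // p; apply: le_trans MM. Qed.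

Lemma smooth_C1supp (f : R^o * R^o -> R^o) (K : set (R * R)) :
  smooth f -> compact K -> K `<=` [set p | cabs (toC p) <= 1] ->
  (forall p, ~ K p -> f p = 0) ->
  exists M, C1supp M f ('D_(1, 0) f) ('D_(0, 1) f).
Proof.
move=> sf cK K1 f0.
have df p : differentiable f p by exact: (sf [::] p).
have dfx v p : differentiable ('D_v f) p by exact: (sf [:: v] p).
have cf : continuous f by move=> p; exact: differentiable_continuous.
have cD v : continuous ('D_v f) by move=> p; exact: differentiable_continuous.
have clK : closed (K : set (R^o * R^o)).
  by apply: compact_closed => //; exact: norm_hausdorff.
have [M0 b0] := continuous_bsupp cf cK K1 f0.
have [M1 b1] := continuous_bsupp (cD (1, 0)) cK K1 (@derive_off_supp f K (1, 0) clK f0).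
have [M2 b2] := continuous_bsupp (cD (0, 1)) cK K1 (@derive_off_supp f K (0, 1) clK f0).
exists (Num.max M0 (Num.max M1 M2)); split.
- by apply: bsuppW b0; rewrite !le_max lexx.
- by apply: bsuppW b1; rewrite !le_max lexx !orbT.
- by apply: bsuppW b2; rewrite !le_max lexx !orbT.
- by move=> x y; exact: is_derive_fst.
- by move=> x y; exact: is_derive_snd.
- move=> y x; apply: (@continuous_comp _ _ _ (fun t : R^o => (t, y) : R^o * R^o) ('D_(1, 0) f)); last exact: cD.
  by apply: (@cvg_pair _ _ _ (nbhs x) (nbhs x) (nbhs y)); [exact: cvg_id|exact: cvg_cst].
- move=> x y; apply: (@continuous_comp _ _ _ (fun t : R^o => (x, t) : R^o * R^o) ('D_(0, 1) f)); last exact: cD.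
  by apply: (@cvg_pair _ _ _ (nbhs y) (nbhs x) (nbhs y)); [exact: cvg_cst|exact: cvg_id].
Qed.

End TestFunctions.

(** * Cauchy-Riemann for polynomials, and the flux in one variable *)

Section PolyDerivative.
Variable R : realType.
Implicit Types P Q : {poly R[i]}.

Definition reP P (x y : R) := complex.Re P.[toC (x, y)].
Definition imP P (x y : R) := complex.Im P.[toC (x, y)].

Lemma is_derive_poly_x P (x y : R) :
  is_derive (x : R) (1 : R) (fun t : R => reP P t y) (reP P^`() x y) /\
  is_derive (x : R) (1 : R) (fun t : R => imP P t y) (imP P^`() x y).
Proof.
elim/poly_ind: P => [|P c [IH1 IH2]].
  rewrite /reP /imP deriv0 !horner0 /=.
  by split; under eq_fun do rewrite horner0 /=; exact: is_derive_cst.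
have E1 : (fun t => reP (P * 'X + c%:P) t y) =
    (fun t => reP P t y * t - imP P t y * y + complex.Re c).
  by apply/funext => t; rewrite /reP /imP hornerMXaddC ReCD ReCM.
have E2 : (fun t => imP (P * 'X + c%:P) t y) =
    (fun t => reP P t y * y + imP P t y * t + complex.Im c).
  by apply/funext => t; rewrite /reP /imP hornerMXaddC ImCD ImCM.
rewrite E1 E2 /reP /imP derivMXaddC hornerD hornerMX ReCD ImCD ReCM ImCM /=.
by split; apply: is_derive_eq; rewrite /GRing.scale /= /reP /imP; ring.
Qed.

(** Moving in y multiplies P' by the imaginary unit, which exchanges its real and imaginary parts
    with a sign. *)
Lemma is_derive_poly_y P (x y : R) :
  is_derive (y : R) (1 : R) (fun t : R => reP P x t) (- imP P^`() x y) /\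
  is_derive (y : R) (1 : R) (fun t : R => imP P x t) (reP P^`() x y).
Proof.
elim/poly_ind: P => [|P c [IH1 IH2]].
  rewrite /reP /imP deriv0 !horner0 /= oppr0.
  by split; under eq_fun do rewrite horner0 /=; exact: is_derive_cst.
have E1 : (fun t => reP (P * 'X + c%:P) x t) =
    (fun t => reP P x t * x - imP P x t * t + complex.Re c).
  by apply/funext => t; rewrite /reP /imP hornerMXaddC ReCD ReCM.
have E2 : (fun t => imP (P * 'X + c%:P) x t) =
    (fun t => reP P x t * t + imP P x t * x + complex.Im c).
  by apply/funext => t; rewrite /reP /imP hornerMXaddC ImCD ImCM.
rewrite E1 E2 /reP /imP derivMXaddC hornerD hornerMX ReCD ImCD ReCM ImCM /=.
by split; apply: is_derive_eq; rewrite /GRing.scale /= /reP /imP; ring.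
Qed.

Lemma derive_continuous (f f' : R -> R) :
  (forall x : R, is_derive (x : R) (1 : R) f (f' x)) -> continuous (f : R^o -> R^o).
Proof.
move=> df x; apply: differentiable_continuous; apply/derivable1_diffP.
by have [] := df x.
Qed.

Lemma contD (f g : R -> R) : continuous (f : R^o -> R^o) -> continuous (g : R^o -> R^o) ->
  continuous ((fun x => f x + g x) : R^o -> R^o).
Proof. by move=> cf cg x; apply: cvgD; [exact: cf|exact: cg]. Qed.

Lemma contM (f g : R -> R) : continuous (f : R^o -> R^o) -> continuous (g : R^o -> R^o) ->
  continuous ((fun x => f x * g x) : R^o -> R^o).
Proof. by move=> cf cg x; apply: cvgM; [exact: cf|exact: cg]. Qed.

Lemma contN (f : R -> R) : continuous (f : R^o -> R^o) ->
  continuous ((fun x => - f x) : R^o -> R^o).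
Proof. by move=> cf x; apply: cvgN; exact: cf. Qed.

Lemma contX (f : R -> R) n : continuous (f : R^o -> R^o) ->
  continuous ((fun x => f x ^+ n) : R^o -> R^o).
Proof.
move=> cf; elim: n => [|n IH]; first by under eq_fun do rewrite expr0; move=> x; exact: cvg_cst.
by under eq_fun do rewrite exprS; exact: contM.
Qed.

Lemma contC (r : R) : continuous ((fun=> r) : R^o -> R^o).
Proof. by move=> x; exact: cvg_cst. Qed.

Ltac continuity_tac := repeat lazymatch goal with
  | |- continuous (fun x => (@?f x + @?g x)%R) => apply: (@contD f g)
  | |- continuous (fun x => (- @?f x)%R) => apply: (@contN f)
  | |- continuous (fun x => (@?f x * @?g x)%R) => apply: (@contM f g)
  | |- continuous (fun x => (@?f x ^+ ?n)%R) => apply: (@contX f n)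
  | |- continuous (fun=> _) => apply: contC
  | _ => assumption
  end.

(* Derivative along one coordinate of sin (theta + c) chi m a / (1 + m (a^2 + b^2)). *)
Definition flux_deriv (m c th th' ch ch' a a' b b' : R) : R :=
  let N := 1 + m * (a ^+ 2 + b ^+ 2) in
  cos (th + c) * th' * ch * (m * a / N) + sin (th + c) * (ch' * (m * a / N)
  + ch * (m * a' / N - m * a * (m * (2 * a * a' + 2 * b * b')) / N ^+ 2)).

Lemma integral_flux0 (m c : R) (th th' ch ch' a a' b b' : R -> R) : 0 < m ->
  (forall x : R, is_derive (x : R) (1 : R) th (th' x)) ->
  (forall x : R, is_derive (x : R) (1 : R) ch (ch' x)) ->
  (forall x : R, is_derive (x : R) (1 : R) a (a' x)) ->
  (forall x : R, is_derive (x : R) (1 : R) b (b' x)) ->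
  continuous (th' : R^o -> R^o) -> continuous (ch' : R^o -> R^o) ->
  continuous (a' : R^o -> R^o) -> continuous (b' : R^o -> R^o) ->
  (forall x, 2 <= `|x| -> ch x = 0) -> (forall x, 2 <= `|x| -> ch' x = 0) ->
  (\int[@lebesgue_measure R]_x (flux_deriv m c (th x) (th' x) (ch x) (ch' x)
     (a x) (a' x) (b x) (b' x))%:E = 0)%E.
Proof.
move=> m0 dth dch da db cth' cch' ca' cb' ch0 ch'0.
have N0 x : 1 + m * (a x ^+ 2 + b x ^+ 2) != 0.
  by rewrite gt_eqF// ltr_pwDl// mulr_ge0 ?addr_ge0 ?sqr_ge0// ltW.
apply: (@integral_derive0 _
    (fun x => sin (th x + c) * ch x * (m * a x * (1 + m * (a x ^+ 2 + b x ^+ 2))^-1))).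
- move=> x.
  have dN : is_derive (x : R) (1 : R) (fun x => 1 + m * (a x ^+ 2 + b x ^+ 2))
      (m * (2 * a x * a' x + 2 * b x * b' x)).
    by apply: is_derive_eq; rewrite /GRing.scale /=; ring.
  have dV := @is_deriveV _ (fun x => 1 + m * (a x ^+ 2 + b x ^+ 2)) x _ 1 (N0 x) dN.
  have ds : is_derive (x : R) (1 : R) (fun x => sin (th x + c)) (cos (th x + c) * th' x).
    have d1 : is_derive (x : R) (1 : R) (fun x => th x + c) (th' x).
      by apply: is_derive_eq; rewrite addr0.
    exact: (@is_derive1_comp _ sin (fun x => th x + c)).
  have d2 : is_derive (x : R) (1 : R) (fun x => m * a x * (1 + m * (a x ^+ 2 + b x ^+ 2))^-1)
     (m * a' x / (1 + m * (a x ^+ 2 + b x ^+ 2)) -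
      m * a x * (m * (2 * a x * a' x + 2 * b x * b' x)) / (1 + m * (a x ^+ 2 + b x ^+ 2)) ^+ 2).
    apply: is_derive_eq; rewrite /GRing.scale /=; field.
    exact: N0.
  apply: is_derive_eq; rewrite /flux_deriv /GRing.scale /=; field.
  exact: N0.
- have cth := derive_continuous dth. have cch := derive_continuous dch.
  have ca := derive_continuous da. have cb := derive_continuous db.
  have cN : continuous ((fun x => 1 + m * (a x ^+ 2 + b x ^+ 2)) : R^o -> R^o).
    by continuity_tac.
  have cV : continuous ((fun x => (1 + m * (a x ^+ 2 + b x ^+ 2))^-1) : R^o -> R^o).
    by move=> x; apply: cvgV; [exact: N0|exact: cN].
  have cs (f : R -> R) : continuous (f : R^o -> R^o) -> continuous ((fun x => f (th x + c)) : R^o -> R^o).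
    move=> cf x; apply: (@continuous_comp _ _ _ (fun x : R^o => th x + c : R^o) f).
      by apply: cvgD; [exact: cth|exact: cvg_cst].
    exact: cf.
  have ccos := cs _ (@continuous_cos R). have csin := cs _ (@continuous_sin R).
  have cV2 : continuous ((fun x => ((1 + m * (a x ^+ 2 + b x ^+ 2)) ^+ 2)^-1) : R^o -> R^o).
    move=> x; apply: cvgV; first by rewrite expf_neq0.
    by apply: contX cN x.
  rewrite /flux_deriv; by continuity_tac.
- by move=> x /ch0 ->; rewrite mulr0 mul0r.
- by move=> x x2; rewrite /flux_deriv ch0// ch'0//; ring.
Qed.

(** A crude bound from 1/N <= 1, which serves only to make the fluxes integrable; the sharp estimate
    comes after adding the two fluxes, where second derivatives cancel. *)
Lemma flux_bound (m c th th' ch ch' a a' b b' : R) : 0 < m ->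
  `|flux_deriv m c th th' ch ch' a a' b b'| <=
  `|th'| * `|ch| * (m * `|a|) + (`|ch'| * (m * `|a|) +
   `|ch| * (m * `|a'| + m * `|a| * (m * (2 * `|a| * `|a'| + 2 * `|b| * `|b'|)))).
Proof.
move=> m0; rewrite /flux_deriv; set N := 1 + _.
have N1 : 1 <= N by rewrite lerDl mulr_ge0 ?addr_ge0 ?sqr_ge0// ltW.
have N0 : 0 < N by exact: lt_le_trans N1.
have dN (u v : R) : `|u| <= v -> `|u / N| <= v.
  move=> uv; rewrite normrM normfV (gtr0_norm N0) ler_pdivrMr//.
  by apply: (le_trans uv); rewrite ler_peMr// (le_trans _ uv).
have dN2 (u v : R) : `|u| <= v -> `|u / N ^+ 2| <= v.
  by move=> uv; rewrite expr2 invfM mulrA; do 2 apply: (dN).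
have mn (u : R) : `|m * u| = m * `|u| by rewrite normrM gtr0_norm.
apply: le_trans (ler_normD _ _) _; apply: lerD.
  rewrite !(normrM (_ * _)) !normrM ler_pM// ?mulr_ge0//.
    rewrite -!mulrA ler_piMl ?mulr_ge0//.
    by rewrite ler_norml cos_geN1 cos_le1.
  by rewrite -!normrM dN// mn.
rewrite normrM; apply: (@le_trans _ _ (1 * `|ch' * (m * a / N) +
   ch * (m * a' / N - m * a * (m * (2 * a * a' + 2 * b * b')) / N ^+ 2)|)).
  by rewrite ler_wpM2r// ler_norml sin_geN1 sin_le1.
rewrite mul1r; apply: le_trans (ler_normD _ _) _; apply: lerD.
  by rewrite normrM ler_wpM2l// dN// mn.
rewrite normrM ler_wpM2l//; apply: le_trans (ler_normB _ _) _; apply: lerD.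
  by rewrite dN// mn.
apply: dN2; rewrite !(normrM (_ * a)) !mn ler_wpM2l ?mulr_ge0 ?(ltW m0)//.
rewrite ler_wpM2l ?(ltW m0)//; apply: le_trans (ler_normD _ _) _.
by rewrite !normrM normr_nat.
Qed.

End PolyDerivative.

(** * Integration by parts along the gradient of the phase *)

Section PolyPlane.
Variable R : realType.
Notation plane := (measurableTypeR R * measurableTypeR R)%type.
Implicit Types P Q : {poly R[i]}.

Definition l1norm P : R := \sum_(i < size P) cabs P`_i.

Lemma l1norm_ge0 P : 0 <= l1norm P.
Proof. by apply: sumr_ge0. Qed.

Lemma horner_l1norm P z : cabs z <= 1 -> cabs P.[z] <= l1norm P.
Proof.
move=> z1; rewrite horner_coef; apply: le_trans (cabs_sum _ _ _) _.
apply: ler_sum => i _; rewrite cabsM cabsX ler_piMr//.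
by rewrite exprn_ile1.
Qed.

Lemma cmeas_horner dX (X : measurableType dX) P (f : X -> R[i]) :
  cmeas f -> cmeas (fun x => P.[f x]).
Proof.
move=> mf; under eq_fun do rewrite horner_coef.
by apply: cmeas_sum => i; apply: cmeasM; [exact: cmeas_cst|exact: cmeasX].
Qed.

Lemma measurable_inv_ge0 dX (X : measurableType dX) (g : X -> R) :
  (forall x, 0 <= g x) -> measurable_fun setT g ->
  measurable_fun setT (fun x => (g x)^-1).
Proof.
move=> g0 mg; under eq_fun do rewrite -powR_inv1//.
by apply: (measurableT_comp (measurable_powR _)).
Qed.

Ltac measurable_tac := repeat lazymatch goal with
  | |- measurable_fun _ (fun x => (@?f x + - @?g x)%R) => apply: (@measurable_funB _ _ _ _ f g)
  | |- measurable_fun _ (fun x => (@?f x + @?g x)%R) => apply: (@measurable_funD _ _ _ _ f g)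
  | |- measurable_fun _ (fun x => (- @?f x)%R) => apply: (@measurable_funN _ _ _ _ f)
  | |- measurable_fun _ (fun x => (@?f x * @?g x)%R) => apply: (@measurable_funM _ _ _ _ f g)
  | |- measurable_fun _ (fun=> _) => apply: measurable_cst
  | _ => assumption
  end.

Definition kern (m : R) P (p : plane) : R :=
  (1 + m * cabs P^`().[toC p] + m * cabs P^`()^`().[toC p]) /
  (1 + m * cabs P^`().[toC p] ^+ 2).

Lemma kern_den_gt0 (m : R) P (p : plane) : 0 < m -> 0 < 1 + m * cabs P^`().[toC p] ^+ 2.
Proof. by move=> m0; rewrite ltr_pwDl// mulr_ge0 ?exprn_ge0// ltW. Qed.

Lemma kern_ge0 m P p : 0 < m -> 0 <= kern m P p.
Proof.
move=> m0; rewrite divr_ge0 ?(ltW (kern_den_gt0 _ _ m0))//.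
by rewrite !addr_ge0// mulr_ge0// ltW.
Qed.

Lemma measurable_kern m P : 0 < m -> measurable_fun setT (kern m P).
Proof.
move=> m0; have mh Q : measurable_fun setT (fun p : plane => cabs Q.[toC p]).
  by apply: measurable_cabs; apply: cmeas_horner; exact: cmeas_toC.
apply: measurable_funM.
  by do ![apply: measurable_funD => //|apply: measurable_funM => //].
apply: measurable_inv_ge0 => [p|]; first exact/ltW/kern_den_gt0.
apply: measurable_funD => //; apply: measurable_funM => //.
exact: measurable_funX.
Qed.

(** The character of P is exp(i phase), and phase = 2 pi Re ((1 - i) P), a harmonic function. *)
Definition phase P (p : plane) : R :=
  2 * pi * (complex.Re P.[toC p] + complex.Im P.[toC p]).

Section IBP.
Variables (M : R) (f fx fy : R * R -> R) (P : {poly R[i]}) (m c : R).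
Hypothesis hf : C1supp M f fx fy.
Hypothesis m0 : 0 < m.

(** Up to the factor 2 pi, [al] and [be] are the partial derivatives of the phase in x and y, [A]
    and [- A] its pure second derivatives, [B] the mixed one. *)
Let al p := complex.Re P^`().[toC p] + complex.Im P^`().[toC p].
Let be p := complex.Re P^`().[toC p] - complex.Im P^`().[toC p].
Let A p := complex.Re P^`()^`().[toC p] + complex.Im P^`()^`().[toC p].
Let B p := complex.Re P^`()^`().[toC p] - complex.Im P^`()^`().[toC p].
(** [G1 + G2] is the divergence of the field sin (phase + c) f m (al, be) / (1 + m (al^2 + be^2)),
    so its integral vanishes. *)
Let G1 (p : plane) := flux_deriv m c (phase P p) (2 * pi * al p) (f p) (fx p)
  (al p) (A p) (be p) (B p).
Let G2 (p : plane) := flux_deriv m c (phase P p) (2 * pi * be p) (f p) (fy p)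
  (be p) (- A p) (al p) (B p).

Let M0 : 0 <= M.
Proof. by have [_ /(_ (0, 0)) h _] := C1_f hf; exact: le_trans h. Qed.

Let mRe Q : measurable_fun setT (fun p : plane => complex.Re Q.[toC p]).
Proof. by have [] := @cmeas_horner _ _ Q _ (@cmeas_toC R). Qed.
Let mIm Q : measurable_fun setT (fun p : plane => complex.Im Q.[toC p]).
Proof. by have [] := @cmeas_horner _ _ Q _ (@cmeas_toC R). Qed.

Lemma measurable_flux dX (X : measurableType dX) (th th' ch ch' a a' b b' : X -> R) :
  measurable_fun setT th -> measurable_fun setT th' -> measurable_fun setT ch ->
  measurable_fun setT ch' -> measurable_fun setT a -> measurable_fun setT a' ->
  measurable_fun setT b -> measurable_fun setT b' ->
  measurable_fun setT (fun x => flux_deriv m c (th x) (th' x) (ch x) (ch' x)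
    (a x) (a' x) (b x) (b' x)).
Proof.
move=> m1 m2 m3 m4 m5 m6 m7 m8; rewrite /flux_deriv.
have mc : measurable_fun setT (fun x => cos (th x + c)).
  apply: (@measurableT_comp _ _ _ _ _ _ (@cos R)).
    by apply: continuous_measurable_fun; exact: continuous_cos.
  exact: measurable_funD.
have ms : measurable_fun setT (fun x => sin (th x + c)).
  apply: (@measurableT_comp _ _ _ _ _ _ (@sin R)).
    by apply: continuous_measurable_fun; exact: continuous_sin.
  exact: measurable_funD.
have mN : measurable_fun setT (fun x => 1 + m * (a x ^+ 2 + b x ^+ 2)).
  by apply: measurable_funD => //; apply: measurable_funM => //;
    apply: measurable_funD; exact: measurable_funX.
have N0 x : 0 <= 1 + m * (a x ^+ 2 + b x ^+ 2).
  by rewrite addr_ge0// mulr_ge0 ?addr_ge0 ?sqr_ge0// ltW.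
have mN1 : measurable_fun setT (fun x => (1 + m * (a x ^+ 2 + b x ^+ 2))^-1).
  exact: measurable_inv_ge0.
have mN2 : measurable_fun setT (fun x => ((1 + m * (a x ^+ 2 + b x ^+ 2)) ^+ 2)^-1).
  by apply: measurable_inv_ge0 => [x|]; [exact: exprn_ge0|exact: measurable_funX].
by measurable_tac.
Qed.

Let mphase : measurable_fun setT (phase P).
Proof. by apply: measurable_funM => //; exact: measurable_funD. Qed.

Let mal : measurable_fun setT (al : plane -> R). Proof. exact: measurable_funD. Qed.
Let mbe : measurable_fun setT (be : plane -> R). Proof. exact: measurable_funB. Qed.
Let mA : measurable_fun setT (A : plane -> R). Proof. exact: measurable_funD. Qed.
Let mB : measurable_fun setT (B : plane -> R). Proof. exact: measurable_funB. Qed.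

Let mf : measurable_fun setT (f : plane -> R). Proof. by have [] := C1_f hf. Qed.
Let mfx : measurable_fun setT (fx : plane -> R). Proof. by have [] := C1_fx hf. Qed.
Let mfy : measurable_fun setT (fy : plane -> R). Proof. by have [] := C1_fy hf. Qed.

Let ReIm_le Q (p : plane) : cabs (toC p) <= 1 ->
  `|complex.Re Q.[toC p]| + `|complex.Im Q.[toC p]| <= 2 * l1norm Q.
Proof.
move=> p1; have h := horner_l1norm Q p1.
have := le_trans (Re_cabs _) h; have := le_trans (Im_cabs _) h; lra.
Qed.

Let bound_sum (u v L : R) : `|u| + `|v| <= L -> `|u + v| <= L /\ `|u - v| <= L.
Proof.
by move=> h; split; apply: le_trans h; [exact: ler_normD|exact: ler_normB].
Qed.

Let L := 2 * l1norm P^`() + 2 * l1norm P^`()^`().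
Let bal p : cabs (toC p) <= 1 -> `|al p| <= L /\ `|be p| <= L.
Proof.
move=> /(ReIm_le P^`())/bound_sum[h1 h2].
by have := l1norm_ge0 P^`()^`(); rewrite /L /al /be; split; lra.
Qed.
Let bA p : cabs (toC p) <= 1 -> `|A p| <= L /\ `|B p| <= L.
Proof.
move=> /(ReIm_le P^`()^`())/bound_sum[h1 h2].
by have := l1norm_ge0 P^`(); rewrite /L /A /B; split; lra.
Qed.

Let bsupp_flux (g h k l : R * R -> R) : measurable_fun setT (g : plane -> R) ->
  measurable_fun setT (h : plane -> R) -> measurable_fun setT (k : plane -> R) ->
  measurable_fun setT (l : plane -> R) ->
  (forall p, cabs (toC p) <= 1 ->
    [/\ `|g p| <= L, `|h p| <= L, `|k p| <= L & `|l p| <= L]) ->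
  forall fz, bsupp M (fz : plane -> R) ->
  bsupp (2 * pi * L * M * (m * L) + (M * (m * L) + M * (m * L + m * L * (m * (2 * L * L + 2 * L * L)))))
    (fun p : plane => flux_deriv m c (phase P p) (2 * pi * g p) (f p) (fz p) (g p) (h p) (k p) (l p)).
Proof.
move=> mg mh mk ml bd fz [mz zM z0]; have [_ fM f0] := C1_f hf.
split.
- by apply: measurable_flux => //; exact: measurable_funM.
- move=> p; have [p1|p1] := leP (cabs (toC p)) 1.
    have [gL hL kL lL] := bd p p1; apply: le_trans (flux_bound _ _ _ _ _ _ _ _ _ m0) _.
    have mge : 0 <= m by exact: ltW.
    have pi0 : 0 <= 2 * pi :> R by rewrite mulr_ge0// pi_ge0.
    rewrite normrM (ger0_norm pi0).
    have L0 : 0 <= L by exact: le_trans gL.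
    by do ?[assumption|exact: lexx|exact: ler0n|exact: normr_ge0|apply: lerD|apply: ler_pM|apply: mulr_ge0|apply: addr_ge0].
  rewrite /flux_deriv f0// z0//.
  rewrite [X in `|X|](_ : _ = 0) ?normr0; last by ring.
    have L0 : 0 <= L.
      by rewrite addr_ge0// mulr_ge0// l1norm_ge0.
    have mge : 0 <= m by exact: ltW.
    have pi0 : 0 <= 2 * pi :> R by rewrite mulr_ge0// pi_ge0.
    by do ?[assumption|exact: ler0n|exact: pi_ge0|apply: addr_ge0|apply: mulr_ge0].
- by move=> p p1; rewrite /flux_deriv f0// z0//; ring.
Qed.

Let bG1 : exists K, bsupp K G1.
Proof.
eexists; apply: bsupp_flux; [exact: mal|exact: mA|exact: mbe|exact: mB| |exact: (C1_fx hf)].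
by move=> p p1; have [? ?] := bal p1; have [? ?] := bA p1.
Qed.

Let bG2 : exists K, bsupp K G2.
Proof.
eexists; apply: bsupp_flux; [exact: mbe| |exact: mal|exact: mB| |exact: (C1_fy hf)].
  exact: measurable_funN.
by move=> p p1; have [? ?] := bal p1; have [? ?] := bA p1; split; rewrite ?normrN.
Qed.

Let far (x y : R) : 2 <= `|x| -> 1 < cabs (toC (x, y)).
Proof. by move=> x2; apply: lt_le_trans (Re_cabs _) => /=; lra. Qed.
Let far' (x y : R) : 2 <= `|y| -> 1 < cabs (toC (x, y)).
Proof. by move=> x2; apply: lt_le_trans (Im_cabs _) => /=; lra. Qed.

Let intG1 : (\int[@lebesgueC R]_p (G1 p)%:E = 0)%E.
Proof.
have [K bK] := bG1; rewrite (bsupp_fubini21 bK).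
rewrite (eq_integral (fun=> 0%E)) ?integral0// => y _.
have [_ _ f0] := C1_f hf; have [_ _ fx0] := C1_fx hf.
have dth x : is_derive (x : R) (1 : R) (fun t => phase P (t, y)) (2 * pi * al (x, y)).
  have [d1 d2] := is_derive_poly_x P x y.
  have d3 : is_derive (x : R) (1 : R) (fun t => 2 * pi * (reP P t y + imP P t y))
     (2 * pi * al (x, y)) by apply: is_derive_eq; rewrite /GRing.scale /= /al /reP /imP; ring.
  exact: d3.
have dab Q x : is_derive (x : R) (1 : R) (fun t => reP Q t y + imP Q t y)
     (reP Q^`() x y + imP Q^`() x y) /\
   is_derive (x : R) (1 : R) (fun t => reP Q t y - imP Q t y)
     (reP Q^`() x y - imP Q^`() x y).
  have [d1 d2] := is_derive_poly_x Q x y.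
  by split; apply: is_derive_eq.
apply: (@integral_flux0 _ m c (fun x => phase P (x, y)) (fun x => 2 * pi * al (x, y))
  (fun x => f (x, y)) (fun x => fx (x, y)) (fun x => al (x, y)) (fun x => A (x, y))
  (fun x => be (x, y)) (fun x => B (x, y))) => //.
- by move=> x; exact: C1_dx hf x y.
- by move=> x; have [] := dab P^`() x.
- by move=> x; have [] := dab P^`() x.
- apply: contM; first exact: contC.
  by apply: derive_continuous => x; have [h _] := dab P^`() x; exact: h.
- exact: C1_cx hf y.
- by apply: derive_continuous => x; have [h _] := dab P^`()^`() x; exact: h.
- by apply: derive_continuous => x; have [_ h] := dab P^`()^`() x; exact: h.
- by move=> x x2; exact/f0/far.
- by move=> x x2; exact/fx0/far.
Qed.

Let intG2 : (\int[@lebesgueC R]_p (G2 p)%:E = 0)%E.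
Proof.
have [K bK] := bG2; rewrite (bsupp_fubini12 bK).
rewrite (eq_integral (fun=> 0%E)) ?integral0// => x _.
have [_ _ f0] := C1_f hf; have [_ _ fy0] := C1_fy hf.
have dth y : is_derive (y : R) (1 : R) (fun t => phase P (x, t)) (2 * pi * be (x, y)).
  have [d1 d2] := is_derive_poly_y P x y.
  have d3 : is_derive (y : R) (1 : R) (fun t => 2 * pi * (reP P x t + imP P x t))
     (2 * pi * be (x, y)) by apply: is_derive_eq; rewrite /GRing.scale /= /be /reP /imP; ring.
  exact: d3.
have dab Q y : is_derive (y : R) (1 : R) (fun t => reP Q x t + imP Q x t)
     (reP Q^`() x y - imP Q^`() x y) /\
   is_derive (y : R) (1 : R) (fun t => reP Q x t - imP Q x t)
     (- (reP Q^`() x y + imP Q^`() x y)).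
  have [d1 d2] := is_derive_poly_y Q x y.
  by split; apply: is_derive_eq; ring.
apply: (@integral_flux0 _ m c (fun y => phase P (x, y)) (fun y => 2 * pi * be (x, y))
  (fun y => f (x, y)) (fun y => fy (x, y)) (fun y => be (x, y)) (fun y => - A (x, y))
  (fun y => al (x, y)) (fun y => B (x, y))) => //.
- by move=> y; exact: C1_dy hf x y.
- by move=> y; have [] := dab P^`() y.
- by move=> y; have [] := dab P^`() y.
- apply: contM; first exact: contC.
  by apply: derive_continuous => y; have [_ h] := dab P^`() y; exact: h.
- exact: C1_cy hf x.
- by apply: contN; apply: derive_continuous => y; have [h _] := dab P^`()^`() y; exact: h.
- by apply: derive_continuous => y; have [_ h] := dab P^`()^`() y; exact: h.
- by move=> y y2; exact/f0/far'.
- by move=> y y2; exact/fy0/far'.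
Qed.

Lemma ReIm_cabs2 (z : R[i]) :
  [/\ `|complex.Re z + complex.Im z| <= 2 * cabs z,
      `|complex.Re z - complex.Im z| <= 2 * cabs z &
      (complex.Re z + complex.Im z) ^+ 2 + (complex.Re z - complex.Im z) ^+ 2 =
      2 * cabs z ^+ 2].
Proof.
have h1 := Re_cabs z; have h2 := Im_cabs z; split.
- by apply: le_trans (ler_normD _ _) _; lra.
- by apply: le_trans (ler_normB _ _) _; lra.
- by rewrite cabs_sqr; ring.
Qed.

Let osc (p : plane) : R := 2 * pi * (f p * cos (phase P p + c)).

Let rest (p : plane) : R := osc p - (G1 p + G2 p).

Let rest_le (p : plane) : `|rest p| <= 8 * M * (2 * pi) * (kern m P p * \1_(disk (0%R : R[i]) 1%R) p).
Proof.
have [_ fM f0] := C1_f hf; have [_ fxM fx0] := C1_fx hf; have [_ fyM fy0] := C1_fy hf.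
have [p1|p1] := leP (cabs (toC p)) 1; last first.
  rewrite /rest /osc /G1 /G2 /flux_deriv f0// fx0// fy0//.
  rewrite [X in `|X|](_ : _ = 0) ?normr0; last by ring.
  by do ?[assumption|exact: ler0n|exact: pi_ge0|exact: kern_ge0|apply: mulr_ge0].
rewrite indicE mem_set ?mulr1; last by rewrite disk0E.
have [al2 be2 sq] := ReIm_cabs2 P^`().[toC p].
have [A2 B2 _] := ReIm_cabs2 P^`()^`().[toC p].
rewrite -/(al p) -/(be p) in al2 be2 sq; rewrite -/(A p) -/(B p) in A2 B2.
rewrite /kern; set D := 1 + m * _ ^+ 2; set N := 1 + m * (al p ^+ 2 + be p ^+ 2).
have D0 : 0 < D by exact: kern_den_gt0.
have DN : D <= N.
  by rewrite /D /N sq lerD2l ler_wpM2l ?(ltW m0)// ler_peMl ?exprn_ge0// ler1n.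
have N0 : 0 < N by exact: lt_le_trans DN.
(* The cosine terms combine through 1 - m (al^2 + be^2) / N = 1 / N, and the terms m A / N and - m A
   / N cancel by harmonicity. Everything left carries a factor 1 / N. *)
have -> : rest p =
  (2 * pi * f p * cos (phase P p + c)
   - sin (phase P p + c) * (m * (fx p * al p + fy p * be p))
   + sin (phase P p + c) * f p * (2 * m * (m * (al p ^+ 2 * A p + 2 * al p * be p * B p - be p ^+ 2 * A p)) / N)) / N.
  have N0' : 1 + m * (al p ^+ 2 + be p ^+ 2) != 0 by exact: lt0r_neq0.
  rewrite /rest /osc /G1 /G2 /flux_deriv (addrC (be p ^+ 2)) /N.
  by field.
rewrite normrM normfV (gtr0_norm N0) [leRHS]mulrA.
set a := cabs _ in al2 be2 sq *; set b := cabs _ in A2 B2 *.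
have a0 : 0 <= a by exact: cabs_ge0. have b0 : 0 <= b by exact: cabs_ge0.
have pi2 := pi_ge2 R.
have cs1 : `|cos (phase P p + c)| <= 1 by rewrite ler_norml cos_geN1 cos_le1.
have sn1 : `|sin (phase P p + c)| <= 1 by rewrite ler_norml sin_geN1 sin_le1.
have X1 : `|2 * pi * f p * cos (phase P p + c)| <= 2 * pi * M.
  rewrite normrM -[leRHS]mulr1 ler_pM// normrM ger0_norm ?mulr_ge0 ?pi_ge0//.
  by rewrite ler_wpM2l// mulr_ge0// pi_ge0.
have Y1 : `|sin (phase P p + c) * (m * (fx p * al p + fy p * be p))| <= 4 * m * M * a.
  rewrite normrM -[leRHS]mul1r ler_pM// normrM (gtr0_norm m0).
  rewrite (_ : 4 * m * M * a = m * (M * (2 * a) + M * (2 * a))); last by ring.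
  rewrite ler_wpM2l ?(ltW m0)//; apply: le_trans (ler_normD _ _) _.
  by rewrite !normrM; apply: lerD; exact: ler_pM.
(* The quadratic form in [al], [be] produced by differentiating 1 / N is absorbed by m (al^2 + be^2)
   <= N. *)
have Z0 : `|m * (al p ^+ 2 * A p + 2 * al p * be p * B p - be p ^+ 2 * A p) / N| <= 4 * b.
  rewrite normrM normfV (gtr0_norm N0) ler_pdivrMr// normrM (gtr0_norm m0).
  apply: (@le_trans _ _ (m * ((al p ^+ 2 + be p ^+ 2) * (4 * b)))); last first.
    by rewrite mulrA [leRHS]mulrC ler_wpM2r ?mulr_ge0// /N lerDr.
  rewrite ler_wpM2l ?(ltW m0)//.
  have -> : al p ^+ 2 * A p + 2 * al p * be p * B p - be p ^+ 2 * A p =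
    (al p ^+ 2 - be p ^+ 2) * A p + 2 * al p * be p * B p by ring.
  apply: le_trans (ler_normD _ _) _; rewrite 2!normrM.
  have -> : 4 * b = 2 * b + 2 * b by ring.
  rewrite [leRHS]mulrDr; apply: lerD; apply: ler_pM => //.
    by rewrite ler_norml; have := sqr_ge0 (al p); have := sqr_ge0 (be p);
      move=> ? ?; apply/andP; split; lra.
  rewrite ler_norml; have := sqr_ge0 (al p + be p); have := sqr_ge0 (al p - be p).
  by rewrite !expr2 => ? ?; apply/andP; split; nra.
have Z1 : `|sin (phase P p + c) * f p * (2 * m *
   (m * (al p ^+ 2 * A p + 2 * al p * be p * B p - be p ^+ 2 * A p)) / N)| <= 8 * m * M * b.
  rewrite (_ : 8 * m * M * b = 1 * M * (2 * m * (4 * b))); last by ring.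
  rewrite normrM; apply: ler_pM => //; first by rewrite normrM; exact: ler_pM.
  rewrite -[X in `|X|]mulrA normrM (ger0_norm (_ : 0 <= 2 * m)); last by rewrite mulr_ge0// ltW.
  by rewrite ler_wpM2l// mulr_ge0// ltW.
apply: ler_pM => //; first by rewrite invr_ge0 ltW.
  apply: (@le_trans _ _ (2 * pi * M + 4 * m * M * a + 8 * m * M * b)).
    apply: le_trans (ler_normD _ _) _; apply: lerD => //.
    by apply: le_trans (ler_normB _ _) _; exact: lerD.
  rewrite -subr_ge0.
  rewrite (_ : _ - _ = M * (pi * 14 + (m * a) * (16 * pi - 4) + (m * b) * (16 * pi - 8))); last by ring.
  have ma : 0 <= m * a by rewrite mulr_ge0// ltW.
  have mb : 0 <= m * b by rewrite mulr_ge0// ltW.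
  by rewrite mulr_ge0// !addr_ge0// mulr_ge0//; lra.
by rewrite lef_pV2.
Qed.

Let bosc : bsupp (2 * pi * M) osc.
Proof.
have [mf' fM f0] := C1_f hf.
have pi0 : 0 <= 2 * pi :> R by rewrite mulr_ge0// pi_ge0.
have mc : measurable_fun setT (fun p => cos (phase P p + c)).
  apply: (@measurableT_comp _ _ _ _ _ _ (@cos R)).
    by apply: continuous_measurable_fun; exact: continuous_cos.
  exact: measurable_funD.
split.
- by rewrite /osc; apply: measurable_funM => //; exact: measurable_funM.
- move=> p; rewrite normrM (ger0_norm pi0) ler_wpM2l// normrM.
  rewrite -[leRHS]mulr1; apply: ler_pM => //.
  by rewrite ler_norml cos_geN1 cos_le1.
- by move=> p p1; rewrite /osc f0// mul0r mulr0.
Qed.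

Lemma oscillatory_ibp :
  (`|\int[@lebesgueC R]_p (f p * cos (phase P p + c))%:E| <=
   (8 * M)%:E * \int[@lebesgueC R]_(p in disk (0%R : R[i]) 1%R) (kern m P p)%:E)%E.
Proof.
have pi0 : 0 < 2 * pi :> R by rewrite mulr_gt0// pi_gt0.
have [K1 bK1] := bG1; have [K2 bK2] := bG2.
have i1 := bsupp_integrable bK1; have i2 := bsupp_integrable bK2.
have io := bsupp_integrable bosc.
have i12 : (@lebesgueC R).-integrable setT (fun p => (G1 p)%:E + (G2 p)%:E)%E.
  exact: integrableD.
have E : (\int[@lebesgueC R]_p (osc p)%:E = \int[@lebesgueC R]_p (rest p)%:E)%E.
  rewrite /rest; under [RHS]eq_integral do rewrite EFinB EFinD.
  rewrite (integralB _ io i12)//; rewrite (integralD _ i1 i2)//.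
  by rewrite intG1 intG2 adde0 sube0.
have io' : (@lebesgueC R).-integrable setT (EFin \o (fun p => f p * cos (phase P p + c))).
  have := integrableZl measurableT (2 * pi)^-1 io.
  by apply: eq_integrable => // p _ /=; rewrite /osc -EFinM mulKf// gt_eqF.
rewrite -(@lee_pmul2l _ (2 * pi)%:E)//.
rewrite -[X in (X * `| _ |)%E]gee0_abs ?lee_fin ?(ltW pi0)// -abseM.
rewrite -integralZl//.
under eq_integral do rewrite -EFinM.
rewrite -[X in `|X|%E]/(\int[@lebesgueC R]_p (osc p)%:E)%E E.
have mrest : measurable_fun setT rest.
  have [m1 _ _] := bosc; have [m2 _ _] := bK1; have [m3 _ _] := bK2.
  by apply: measurable_funB => //; exact: measurable_funD.
apply: le_trans (le_abse_integral _ _ _) _ => //; first exact/measurable_EFinP.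
have mk : measurable_fun setT (kern m P) by exact: measurable_kern.
have mD : measurable (disk (0%R : R[i]) 1%R) by exact: measurable_disk.
have M8 : 0 <= 8 * M * (2 * pi).
  by do ?[assumption|exact: ler0n|exact: pi_ge0|apply: mulr_ge0].
apply: (@le_trans _ _ (\int[@lebesgueC R]_p ((8 * M * (2 * pi))%:E * (kern m P p * \1_(disk (0%R : R[i]) 1%R) p)%:E))%E).
  apply: ge0_le_integral => //.
  - by apply: measurableT_comp => //; exact/measurable_EFinP.
  - apply/measurable_EFinP; apply: measurable_funM => //; exact: measurable_funM.
  - by move=> p _; rewrite lee_fin; exact: rest_le.
rewrite ge0_integralZl_EFin//; last 2 first.
- by move=> p _; rewrite lee_fin mulr_ge0// kern_ge0.
- by apply/measurable_EFinP; apply: measurable_funM => //; exact: measurable_indic.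
rewrite muleA -EFinM (mulrC (2 * pi)) lee_wpmul2l ?lee_fin//.
rewrite [leRHS]integral_mkcond; apply: ge0_le_integral => //.
- by move=> p _; rewrite lee_fin mulr_ge0// kern_ge0.
- by apply/measurable_EFinP; apply: measurable_funM => //; exact: measurable_indic.
- apply/(measurable_restrictT _ _).1 => //; apply: measurable_funTS; exact/measurable_EFinP.
- move=> p _; rewrite patchE indicE; case: ifPn => _; rewrite ?mulr1 ?mulr0//.
Qed.

End IBP.
End PolyPlane.

Ltac nneg := do ?[assumption | exact: ler01 | exact: ler0n | exact: cabs_ge0 | exact: powR_ge0
  | exact: l1norm_ge0 | apply: ltW; assumption | apply: addr_ge0 | apply: mulr_ge0
  | apply: exprn_ge0 | rewrite invr_ge0].

(** * Coefficient norms of polynomials relative to a centre and a scale *)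

Section PolynomialNorm.
Variable R : realType.
Implicit Types (f g p : {poly R[i]}) (u z : R[i]) (t : R).

Definition shiftp u f := f \Po ('X + u%:P).

(** Applied to [shiftp u f], this measures the Taylor coefficients at u at scale t. A linear factor
    with root x multiplies it by at most t + |u - x|, so it can be compared with a product over the
    roots. *)
Definition nrm t f : R := \sum_(i < size f) cabs f`_i * t ^+ i.

Lemma nrm_wide n t f : (size f <= n)%N -> nrm t f = \sum_(i < n) cabs f`_i * t ^+ i.
Proof.
move=> fn; rewrite /nrm (big_ord_widen n (fun i => cabs f`_i * t ^+ i) fn).
rewrite big_mkcond; apply: eq_bigr => i _; case: ifPn => //.
by rewrite -leqNgt => fi; rewrite nth_default// cabs0 mul0r.
Qed.

Lemma nrm_ge0 t f : 0 <= t -> 0 <= nrm t f.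
Proof. by move=> t0; apply: sumr_ge0 => i _; rewrite mulr_ge0// exprn_ge0. Qed.

Lemma nrm_term t f i : 0 <= t -> cabs f`_i * t ^+ i <= nrm t f.
Proof.
move=> t0; have [fi|fi] := leqP (size f) i.
  by rewrite nth_default// cabs0 mul0r nrm_ge0.
rewrite /nrm (bigD1 (Ordinal fi))//= lerDl sumr_ge0// => j _.
by rewrite mulr_ge0// exprn_ge0.
Qed.

Lemma nrmD t f g : 0 <= t -> nrm t (f + g) <= nrm t f + nrm t g.
Proof.
move=> t0; set n := maxn (size f) (size g).
rewrite (@nrm_wide n t (f + g)) ?size_polyD// (@nrm_wide n t f) ?leq_maxl//.
rewrite (@nrm_wide n t g) ?leq_maxr// -big_split; apply: ler_sum => i _ /=.
by rewrite coefD -mulrDl ler_wpM2r ?exprn_ge0// cabsD.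
Qed.

Lemma nrmZ t f (c : R[i]) : nrm t (c *: f) = cabs c * nrm t f.
Proof.
rewrite (@nrm_wide (size f)) ?size_scale_leq// /nrm mulr_sumr.
by apply: eq_bigr => i _; rewrite coefZ cabsM mulrA.
Qed.

Lemma nrmC t c : nrm t c%:P = cabs c.
Proof.
rewrite (@nrm_wide 1) ?size_polyC_leq1// big_ord_recl big_ord0 coefC eqxx.
by rewrite expr0 mulr1 addr0.
Qed.

Lemma nrmMXaddC t f c : nrm t (f * 'X + c%:P) = cabs c + nrm t f * t.
Proof.
rewrite (@nrm_wide (size f).+1); last first.
  by rewrite size_MXaddC; case: ifP.
rewrite big_ord_recl coefD coefMX coefC eqxx add0r expr0 mulr1; congr (_ + _).
rewrite /nrm mulr_suml; apply: eq_bigr => i _.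
by rewrite coefD coefMX coefC /= addr0 exprSr mulrA.
Qed.

Lemma nrmMX t f : nrm t (f * 'X) = nrm t f * t.
Proof. by have := nrmMXaddC t f 0; rewrite addr0 cabs0 add0r. Qed.

Lemma nrmMXadd t f u : 0 <= t -> nrm t (f * ('X + u%:P)) <= nrm t f * (t + cabs u).
Proof.
move=> t0; rewrite mulrDr (le_trans (nrmD _ _ t0))// nrmMX mulrDr lerD2l.
by rewrite mulrC mul_polyC nrmZ mulrC.
Qed.

Lemma nrm_shift t f u : 0 <= t -> nrm t (shiftp u f) <= nrm (t + cabs u) f.
Proof.
move=> t0; elim/poly_ind: f => [|f c IH].
  by rewrite /shiftp comp_poly0 /nrm size_poly0 !big_ord0.
rewrite nrmMXaddC /shiftp comp_poly_MXaddC addrC -/(shiftp u f).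
apply: le_trans (nrmD _ _ t0) _; rewrite nrmC lerD2l.
apply: le_trans (nrmMXadd _ _ t0) _.
by rewrite ler_wpM2r// addr_ge0.
Qed.

Lemma nrm_scale n t f (K : R) : 0 <= t -> 1 <= K -> (size f <= n.+1)%N ->
  nrm (K * t) f <= K ^+ n * nrm t f.
Proof.
move=> t0 K1 fn; rewrite !(@nrm_wide n.+1)// mulr_sumr; apply: ler_sum => i _.
rewrite exprMn mulrCA ler_wpM2r ?mulr_ge0 ?exprn_ge0//.
by rewrite ler_weXn2l// -ltnS.
Qed.

Lemma shiftpK u f : shiftp (- u) (shiftp u f) = f.
Proof.
rewrite /shiftp -comp_polyA comp_polyD comp_polyX comp_polyC polyCN.
by rewrite subrK comp_polyXr.
Qed.

Lemma size_shiftp u f : size (shiftp u f) = size f.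
Proof. by rewrite /shiftp size_comp_poly2// size_XaddC. Qed.

Lemma horner_shiftp u f z : (shiftp u f).[z] = f.[z + u].
Proof. by rewrite /shiftp horner_comp hornerD hornerX hornerC. Qed.

Lemma coef0_shiftp u f : (shiftp u f)`_0 = f.[u].
Proof. by rewrite -horner_coef0 horner_shiftp add0r. Qed.

Lemma deriv_shiftp u f : (shiftp u f)^`() = shiftp u f^`().
Proof. by rewrite /shiftp deriv_comp derivD derivX derivC addr0 mulr1. Qed.

Lemma coef_shiftp_deriv u f j : (shiftp u f^`())`_j = (shiftp u f)`_j.+1 *+ j.+1.
Proof. by rewrite -deriv_shiftp coef_deriv. Qed.

Lemma nrm_prod (rs : seq R[i]) t u : 0 <= t ->
  nrm t (shiftp u (\prod_(x <- rs) ('X - x%:P))) <= \prod_(x <- rs) (t + cabs (u - x)).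
Proof.
move=> t0; elim: rs => [|x rs IH].
  by rewrite !big_nil /shiftp -polyC1 comp_polyC nrmC cabs1.
rewrite !big_cons /shiftp comp_polyM -!/(shiftp u _) mulrC.
rewrite (_ : shiftp u ('X - x%:P) = 'X + (u - x)%:P); last first.
  by rewrite /shiftp comp_polyB comp_polyX comp_polyC polyCB addrA.
apply: le_trans (nrmMXadd _ _ t0) _; rewrite mulrC.
by rewrite ler_wpM2l// addr_ge0.
Qed.

(** Compares, root by root, the norm at (u, t) with the value at z: all Taylor coefficients at u are
    controlled by a single value taken far enough from the roots. *)
Lemma nrm_shift_roots (rs : seq R[i]) c p t u z (K : R) : 0 <= t -> 0 <= K ->
  p = c *: \prod_(x <- rs) ('X - x%:P) ->
  (forall x, x \in rs -> t + cabs (u - x) <= K * cabs (z - x)) ->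
  nrm t (shiftp u p) <= K ^+ size rs * cabs p.[z].
Proof.
move=> t0 K0 -> h; rewrite /shiftp comp_polyZ nrmZ hornerZ cabsM mulrCA.
rewrite ler_wpM2l//; apply: le_trans (nrm_prod _ _ t0) _.
elim: rs h => [|x rs IH] h; first by rewrite !big_nil expr0 mul1r hornerC cabs1.
rewrite !big_cons hornerM cabsM hornerXsubC exprS mulrACA.
apply: ler_pM.
- by rewrite addr_ge0.
- by elim/big_ind: _ => // *; [exact: mulr_ge0|exact: addr_ge0].
- by apply: h; rewrite inE eqxx.
- by apply: IH => y yrs; apply: h; rewrite inE yrs orbT.
Qed.

Lemma l1normE f : l1norm f = nrm 1 f.
Proof. by apply: eq_bigr => i _; rewrite expr1n mulr1. Qed.

Lemma nrm_deriv n f : (size f <= n.+1)%N -> nrm 1 f^`() <= n%:R * nrm 1 f.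
Proof.
move=> fn; rewrite (@nrm_wide n); last first.
  by apply: leq_trans (size_poly _ _) _; rewrite -subn1 leq_subLR add1n.
rewrite (@nrm_wide n.+1 _ f)// big_ord_recl mulrDr.
apply: ler_wpDl; first by rewrite mulr_ge0// mulr_ge0.
rewrite mulr_sumr; apply: ler_sum => i _.
rewrite coef_deriv !expr1n !mulr1 -[_ *+ _]mulr_natl cabsM cabs_nat ler_wpM2r//.
by rewrite ler_nat.
Qed.

(* The polynomial is recentred at z and back, each recentring costing 2^n. *)
Lemma nrm1_le_of_far (rs : seq R[i]) n c p z : (size p <= n.+1)%N -> p != 0 ->
  p = c *: \prod_(x <- rs) ('X - x%:P) -> (size rs <= n)%N -> cabs z <= 1 ->
  (forall x, x \in rs -> 1 <= cabs (z - x)) -> nrm 1 p <= 4 ^+ n * cabs p.[z].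
Proof.
move=> pn p0 pE rn z1 h.
have h1 : nrm 1 (shiftp z p) <= 2 ^+ size rs * cabs p.[z].
  by apply: (nrm_shift_roots (c := c)) => // x /h xz; rewrite mulr_natl mulr2n lerD2r.
rewrite -{1}(shiftpK z p); apply: le_trans (nrm_shift _ _ _) _ => //.
apply: (@le_trans _ _ (nrm (2 * 1) (shiftp z p))).
  apply: ler_sum => i _; rewrite ler_wpM2l// lerXn2r ?nnegrE ?addr_ge0//.
  by rewrite cabsN mulr1; lra.
apply: le_trans (nrm_scale (n := n) _ _ _) _; rewrite ?size_shiftp ?ler1n//.
rewrite (_ : 4 ^+ n = 2 ^+ n * 2 ^+ n); last first.
  by rewrite -exprMn; congr (_ ^+ _); ring.
rewrite -mulrA ler_wpM2l ?exprn_ge0//; apply: (le_trans h1).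
by rewrite ler_wpM2r// ler_weXn2l// ler1n.
Qed.

End PolynomialNorm.

(** * The kernel and the nearest critical point *)

Section Geometry.
Variable R : realType.
Notation plane := (measurableTypeR R * measurableTypeR R)%type.
Implicit Types (p P : {poly R[i]}) (z u : R[i]).

(* x / (1 + x^2) and 1 / (1 + x^2) beat y^(-r), r < 2, as soon as 1 + x >~ y. *)
Lemma kern_pointwise (r s K a b t : R) : 1 <= r <= 2 -> 1 <= s -> 1 <= K ->
  0 < t <= 1 -> 0 <= a -> 0 <= b -> b * t <= K * a ->
  s * t <= K * (1 + a / s) ->
  (1 + s ^- 2 * a + s ^- 2 * b) / (1 + s ^- 2 * a ^+ 2) <=
  6 * K ^+ 2 * s `^ (- r) * t `^ (- r).
Proof.
move=> /andP[r1 r2] s1 K1 /andP[t0 t1] a0 b0 hb hx.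
have s0 : 0 < s by exact: lt_le_trans s1.
have K0 : 0 < K by exact: lt_le_trans K1.
set x := a / s in hx *.
have x0 : 0 <= x by rewrite divr_ge0// ltW.
have y0 : 0 < s * t by rewrite mulr_gt0.
have -> : s ^- 2 * a ^+ 2 = x ^+ 2 by rewrite /x expr_div_n mulrC.
have D0 : 0 < 1 + x ^+ 2 by rewrite ltr_pwDl// exprn_ge0.
rewrite -[leRHS]mulrA -powRM ?(ltW s0) ?(ltW t0)//.
rewrite ler_pdivrMr//.
(* Each of the two terms is at most K x / (s t): the first because t <= 1 <= K, the second by b t <=
   K a. *)
have n1 : 1 + s ^- 2 * a + s ^- 2 * b <= 1 + 2 * (K * x / (s * t)).
  rewrite -addrA lerD2l mulr_natl mulr2n; apply: lerD.
    rewrite (_ : s ^- 2 * a = x / s); last first.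
      by rewrite /x; field; exact: lt0r_neq0.
    rewrite ler_pdivlMr// (_ : x / s * (s * t) = x * t); last by field; exact: lt0r_neq0.
    by rewrite mulrC ler_pM// ?(ltW t0)// (le_trans t1).
  rewrite ler_pdivlMr//.
  rewrite (_ : s ^- 2 * b * (s * t) = b * t / s); last by field; exact: lt0r_neq0.
  by rewrite /x mulrA ler_wpM2r// invr_ge0 ltW.
apply: (le_trans n1); set y := s * t in y0 hx *.
(* y^(-r) dominates 1 when y <= 1 and y^(-2) when y >= 1 *)
have [yle|yge] := leP y 1.
  have py : 1 <= y `^ (- r).
    by have := powRN_le (_ : 0 <= r) y0 yle; rewrite powR1; apply; lra.
  have py' : y^-1 <= y `^ (- r).
    rewrite powRN lef_pV2 ?posrE ?powR_gt0//.
    by apply: ge1r_powR => //; rewrite y0 yle.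
  have hx1 : x <= 1 + x ^+ 2 by have := sqr_ge0 (x - 1); have := sqr_ge0 x; nra.
  apply: (@le_trans _ _ (y `^ (- r) * (1 + x ^+ 2) + 2 * K * (y `^ (- r) * (1 + x ^+ 2)))).
    apply: lerD; first by rewrite -[leLHS]mulr1 ler_pM// lerDl exprn_ge0.
    rewrite mulrA mulrA -mulrA ler_wpM2l ?mulr_ge0 ?(ltW K0)//.
    by rewrite mulrC ler_pM// invr_ge0 ltW.
  have : 0 <= y `^ (- r) * (1 + x ^+ 2) by rewrite mulr_ge0 ?powR_ge0// ltW.
  set A := _ * (1 + x ^+ 2) => A0.
  rewrite -[leRHS]mulrA -/A; rewrite expr2.
  rewrite -subr_ge0 (_ : _ - _ = A * (6 * (K * K) - 1 - 2 * K)); last by ring.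
  by rewrite mulr_ge0//; nra.
have py : y ^- 2 <= y `^ (- r).
  rewrite powRN lef_pV2 ?posrE ?powR_gt0 ?exprn_gt0// -powR_mulrn ?(ltW y0)//.
  by apply: ler_powR => //; exact: ltW.
apply: (@le_trans _ _ (6 * K ^+ 2 * y ^- 2 * (1 + x ^+ 2))); last first.
  by rewrite ler_wpM2r ?(ltW D0)// ler_wpM2l// mulr_ge0// exprn_ge0// ltW.
rewrite (_ : 6 * K ^+ 2 * y ^- 2 * (1 + x ^+ 2) = (6 * K ^+ 2 * (1 + x ^+ 2)) / y ^+ 2); last by ring.
rewrite ler_pdivlMr ?exprn_gt0//.
rewrite (_ : (1 + 2 * (K * x / y)) * y ^+ 2 = y ^+ 2 + 2 * K * x * y); last first.
  by field; exact: lt0r_neq0.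
have h1 : y ^+ 2 <= K ^+ 2 * (2 * (1 + x ^+ 2)).
  apply: (@le_trans _ _ ((K * (1 + x)) ^+ 2)).
    by rewrite lerXn2r ?nnegrE ?mulr_ge0 ?addr_ge0// ltW.
  rewrite exprMn ler_wpM2l ?exprn_ge0// ?(ltW K0)//.
  by have := sqr_ge0 (x - 1); nra.
have h2 : 2 * K * x * y <= K ^+ 2 * (4 * (1 + x ^+ 2)).
  apply: (@le_trans _ _ (2 * K * x * (K * (1 + x)))).
    by apply: ler_wpM2l => //; nneg.
  rewrite (_ : 2 * K * x * (K * (1 + x)) = K ^+ 2 * (2 * x * (1 + x))); last by ring.
  rewrite ler_wpM2l ?exprn_ge0// ?(ltW K0)//.
  by have := sqr_ge0 (x - 1); nra.
nra.
Qed.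

(** s is the largest of 1 and the a_j^(1/j), 2 <= j <= n; the last alternative records where the
    maximum is reached. Order 1 is left out because the linear Taylor coefficient vanishes at a
    critical point. *)
Lemma root_scale (a : nat -> R) n : (forall j, 0 <= a j) -> exists s : R,
  [/\ 1 <= s, forall j, (2 <= j <= n)%N -> a j <= s ^+ j &
      s = 1 \/ exists2 j, (2 <= j <= n)%N & s ^+ j <= a j].
Proof.
move=> a0; elim: n => [|n [s [s1 hs hs']]].
  by exists 1; split=> [//|j|]; [case: j => [|[]]|left].
have [n1|n1] := leqP 1 n; last first.
  exists 1; split=> [//|j|]; last by left.
  by move=> /andP[j2 /(leq_trans j2)]; rewrite ltnS => /leq_trans/(_ n1).
have [h|h] := leP (a n.+1) (s ^+ n.+1).
  exists s; split=> [//|j|].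
    move=> /andP[j2]; rewrite leq_eqVlt => /predU1P[->//|]; rewrite ltnS => jn.
    by apply: hs; rewrite j2.
  case: hs' => [|[j /andP[j2 jn] hj]]; [by left|right; exists j => //].
  by rewrite j2 ltnW// ltnS.
pose s' := a n.+1 `^ (n.+1%:R^-1).
have s'n : s' ^+ n.+1 = a n.+1.
  rewrite -powR_mulrn ?powR_ge0// /s' -powRrM mulVf ?pnatr_eq0//.
  by rewrite powRr1.
have ss' : s <= s'.
  rewrite -(ler_pXn2r (ltn0Sn n)) ?nnegrE ?powR_ge0//; last exact: le_trans s1.
  by rewrite s'n ltW.
exists s'; split=> [|j|]; first exact: le_trans ss'.
  move=> /andP[j2]; rewrite leq_eqVlt => /predU1P[->|]; first by rewrite s'n.
  rewrite ltnS => jn; apply: le_trans (hs j _) _; first by rewrite j2.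
  by apply: lerXn2r; rewrite ?nnegrE ?powR_ge0//; exact: le_trans s1.
by right; exists n.+1; rewrite ?s'n ?lexx// ltnS n1 leqnn.
Qed.

Lemma seq_argmin (T : eqType) (f : T -> R) (s : seq T) : s != [::] ->
  exists2 x, x \in s & forall y, y \in s -> f x <= f y.
Proof.
elim: s => // x [|x' s] IH _.
  by exists x; rewrite ?inE// => y; rewrite inE => /eqP ->.
have [x0 x0s hx0] := IH isT.
have [h|h] := leP (f x) (f x0).
  exists x; first by rewrite inE eqxx.
  by move=> y; rewrite inE => /predU1P[->//|/hx0]; exact: le_trans.
exists x0; first by rewrite inE x0s orbT.
by move=> y; rewrite inE => /predU1P[->|/hx0//]; exact: ltW.
Qed.

Lemma poly_roots_seq p : p != 0 -> exists (c : R[i]) (rs : seq R[i]),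
  [/\ c != 0, p = c *: \prod_(x <- rs) ('X - x%:P) & size p = (size rs).+1].
Proof.
move=> p0; have [rs pE] := closed_field_poly_normal p.
have c0 : lead_coef p != 0 by rewrite lead_coef_eq0.
exists (lead_coef p), rs; split=> //.
by rewrite pE size_scale// size_prod_XsubC.
Qed.

Lemma measurable_sum_singular (r : R) (rs : seq R[i]) :
  measurable_fun setT (fun p : plane => \sum_(x <- rs) singular r x p)%E.
Proof. by apply: emeasurable_sum => x; exact: measurable_singular. Qed.

Lemma integral_kern_singular (r C A m : R) (rs : seq R[i]) P : 0 < m -> 0 <= A -> 0 <= C ->
  (forall x, (\int[@lebesgueC R]_p singular r x p <= C%:E)%E) ->
  (forall p : plane, cabs (toC p) <= 1 ->
     ((kern m P p)%:E <= A%:E * (1 + \sum_(x <- rs) singular r x p))%E) ->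
  (\int[@lebesgueC R]_(p in disk (0%R : R[i]) 1%R) (kern m P p)%:E <=
     (A * (4 + (size rs)%:R * C))%:E)%E.
Proof.
move=> m0 A0 C0 hC hk.
have mD : measurable (disk (0 : R[i]) 1) by exact: measurable_disk.
have sg0 (p : plane) : (0 <= \sum_(x <- rs) singular r x p)%E.
  by apply: sume_ge0 => x _; exact: singular_ge0.
apply: (@le_trans _ _ (\int[@lebesgueC R]_(p in disk (0%R : R[i]) 1%R)
   (A%:E * (1 + \sum_(x <- rs) singular r x p)))%E).
  apply: ge0_le_integral => //.
  - by move=> p _; rewrite lee_fin kern_ge0.
  - by apply/measurable_EFinP; apply: measurable_funTS; exact: measurable_kern.
  - apply: measurable_funTS; apply: measurable_funeM; apply: emeasurable_funD => //.
    exact: measurable_sum_singular.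
  - by move=> p; rewrite disk0E; exact: hk.
rewrite ge0_integralZl_EFin//; last 2 first.
- by move=> p _; rewrite adde_ge0.
- apply: measurable_funTS; apply: emeasurable_funD => //.
  exact: measurable_sum_singular.
rewrite EFinM lee_wpmul2l ?lee_fin//.
rewrite ge0_integralD//; last first.
  by apply: measurable_funTS; exact: measurable_sum_singular.
rewrite EFinD; apply: leeD.
  rewrite integral_cst// mul1e; apply: le_trans (lebesgueC_disk_le _ _) _ => //.
  by rewrite lee_fin expr1n mulr1.
apply: (@le_trans _ _ (\int[@lebesgueC R]_p \sum_(x <- rs) singular r x p)%E).
  apply: ge0_subset_integral => //; exact: measurable_sum_singular.
rewrite ge0_integral_sum//; last 2 first.
- by move=> x; exact: measurable_singular.
- by move=> x p _; exact: singular_ge0.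
elim: (rs) => [|x l IH]; first by rewrite big_nil mul0r.
by rewrite big_cons /= -natr1 mulrDl mul1r addrC EFinD leeD.
Qed.

Lemma coef_shiftp_le u P j : cabs (shiftp u P)`_j.+1 <= cabs (shiftp u P^`())`_j.
Proof.
by rewrite coef_shiftp_deriv -mulr_natl cabsM cabs_nat ler_peMl// ler1n.
Qed.

Lemma powR_unit_ge (t r : R) : 1 <= r -> 0 < t <= 1 -> t^-1 <= t `^ (- r).
Proof.
move=> r1 /andP[t0 t1]; rewrite powRN lef_pV2 ?posrE ?powR_gt0//.
by apply: ge1r_powR => //; rewrite t0 t1.
Qed.

(* The pointwise bound of the kernel away from the roots, in terms of the
   distance t to the nearest root (capped at 1). *)
Lemma kern_root_bound n (r s : R) P (c : R[i]) (rs : seq R[i]) (p : plane) :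
  1 <= r <= 2 -> 1 <= s -> (size P^`() <= n.+1)%N ->
  P^`() != 0 -> P^`() = c *: \prod_(x <- rs) ('X - x%:P) -> (size rs <= n)%N ->
  s ^+ 2 <= 3 ^+ n * nrm 1 P^`() ->
  (forall x, x \in rs -> cabs x <= 2 ->
    exists2 j, (1 < j)%N & s ^+ j <= cabs (shiftp x P)`_j) ->
  cabs (toC p) <= 1 ->
  ((kern (s ^- 2) P p)%:E <= (6 * (12 ^+ n) ^+ 2 * s `^ (- r))%:E *
    (1 + \sum_(x <- rs) singular r x p))%E.
Proof.
move=> r12 s1 pn p0 pE rn sW hroot z1; have /andP[r1 r2] := r12.
set q := P^`() in pn p0 pE sW *; set z := toC p in z1 *.
have s0 : 0 < s by exact: lt_le_trans s1.
set K : R := 12 ^+ n; have K1 : 1 <= K by rewrite exprn_ege1// ler1n.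
have K0 : 0 < K by exact: lt_le_trans K1.
have c0 : 0 < 6 * K ^+ 2 * s `^ (- r).
  by rewrite !mulr_gt0 ?exprn_gt0 ?powR_gt0.
set c1 := 6 * _ * _ in c0 *.
have sg0 x : (0 <= singular r x p)%E by exact: singular_ge0.
have sum_ge x : x \in rs -> (singular r x p <= 1 + \sum_(x <- rs) singular r x p)%E.
  move=> xrs; apply: (@le_trans _ _ (\sum_(x <- rs) singular r x p)%E).
    by rewrite (big_rem x)//= leeDl// sume_ge0.
  by rewrite leeDr.
have [/rootP qz|qz] := boolP (root q z).
  have zrs : z \in rs.
    by move: qz; rewrite pE => /rootP; rewrite rootZ ?root_prod_XsubC//;
      apply: contraNneq p0 => c00; rewrite pE c00 scale0r.
  set v := kern _ _ _; have v0 : 0 <= v by rewrite kern_ge0// invr_gt0 exprn_gt0.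
  (* z is itself a root, where the singular term exceeds t^(-r) for every t. This t gives c1 / t =
     c1 + v, which is at least v. *)
  pose t := c1 / (c1 + v).
  have cv : 0 < c1 + v by rewrite ltr_pwDl.
  have t01 : 0 < t <= 1.
    by rewrite /t divr_gt0//= ler_pdivrMr// mul1r lerDl.
  apply: (@le_trans _ _ (c1%:E * (t `^ (- r))%:E)%E); last first.
    rewrite lee_wpmul2l ?lee_fin ?(ltW c0)//; apply: le_trans (sum_ge _ zrs).
    apply: singular_ge => //; first lra.
    by rewrite subrr cabs0; case/andP: t01 => /ltW.
  rewrite -EFinM lee_fin; apply: (@le_trans _ _ (c1 * t^-1)); last first.
    by rewrite ler_wpM2l ?(ltW c0)// powR_unit_ge.
  by rewrite /t invf_div mulrC divfK ?gt_eqF// lerDr ltW.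
have nz x : x \in rs -> 0 < cabs (z - x).
  move=> xrs; rewrite cabs_gt0 subr_eq0; apply: contraNneq qz => ->.
  by rewrite pE rootZ ?root_prod_XsubC//;
    apply: contraNneq p0 => c00; rewrite pE c00 scale0r.
(* |q'(z)| t is one term of the norm of q at centre z and scale t, and each factor obeys t + |z - x|
   <= 2 |z - x|. *)
have hb t : 0 <= t -> (forall x, x \in rs -> t <= cabs (z - x)) ->
    cabs q^`().[z] * t <= K * cabs q.[z].
  move=> t0 ht.
  have := @nrm_shift_roots _ rs c q t z z 2 t0 (ler0n _ _) pE.
  move=> /(_ _)-h; apply: le_trans (le_trans _ (h _)) _.
  - have := nrm_term (shiftp z q) 1 t0; rewrite expr1.
    by have := coef_shiftp_deriv z q 0; rewrite coef0_shiftp mulr1n => ->.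
  - by move=> x /ht xz; rewrite mulr_natl mulr2n lerD2r.
  - rewrite ler_wpM2r// (@le_trans _ _ (2 ^+ n))// /K.
      by rewrite ler_weXn2l// ler1n.
    by apply: lerXn2r; rewrite ?nnegrE// ler_nat.
have main t : 0 < t <= 1 -> (forall x, x \in rs -> t <= cabs (z - x)) ->
    s * t <= K * (1 + cabs q.[z] / s) -> kern (s ^- 2) P p <= c1 * t `^ (- r).
  move=> t01 ht hx; apply: kern_pointwise => //.
  by apply: hb => //; case/andP: t01 => /ltW.
(* With no root within 1 of z, take t = 1: the whole coefficient norm of q is at most 4^n |q(z)|,
   and s^2 is at most 3^n times that norm, which explains 12^n. *)
have [h1|/allPn[x0 x0rs]] := boolP (all (fun x => 1 <= cabs (z - x)) rs).
  have {}h1 x : x \in rs -> 1 <= cabs (z - x) by move/(allP h1).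
  apply: (@le_trans _ _ (c1%:E * 1)%E); last first.
    by rewrite lee_wpmul2l ?lee_fin ?(ltW c0)// leeDl// sume_ge0.
  have := main 1; rewrite powR1 mulr1 mule1 lee_fin; apply => //.
    by rewrite ltr01 lexx.
  rewrite mulr1; apply: (@le_trans _ _ (K * (cabs q.[z] / s))); last first.
    by rewrite ler_wpM2l ?(ltW K0)// lerDr.
  rewrite mulrA ler_pdivlMr// -expr2; apply: (le_trans sW).
  have := nrm1_le_of_far pn p0 pE rn z1 h1.
  rewrite -(ler_pM2l (_ : 0 < 3 ^+ n)) ?exprn_gt0// mulrA -exprMn.
  by move=> /le_trans; apply; rewrite ler_wpM2r// /K -natrM.
rewrite -ltNge => x01.
have [x xrs hx] := @seq_argmin _ (fun x => cabs (z - x)) rs ltac:(by case: (rs) x0rs).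
set t := cabs (z - x) in hx.
have t0 : 0 < t by exact: nz.
have t1 : t < 1 by apply: le_lt_trans (hx _ x0rs) x01.
have x2 : cabs x <= 2.
  rewrite -(subKr z x); apply: le_trans (cabsD _ _) _.
  by rewrite cabsN -/t; lra.
apply: (@le_trans _ _ (c1%:E * (t `^ (- r))%:E)%E); last first.
  rewrite lee_wpmul2l ?lee_fin ?(ltW c0)//; apply: le_trans (sum_ge _ xrs).
  by apply: singular_ge => //; [lra|rewrite t0 ltW].
rewrite -EFinM lee_fin; apply: main => //; first by rewrite t0 ltW.
have [j j1 hj] := hroot x xrs x2.
(* x is the nearest root, so t + |x - y| <= 2 t + |z - y| <= 3 |z - y| for every root y. *)
have hn : nrm t (shiftp x q) <= 3 ^+ n * cabs q.[z].
  apply: (@le_trans _ _ (3 ^+ size rs * cabs q.[z])); last first.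
    by rewrite ler_wpM2r// ler_weXn2l// ler1n.
  apply: (nrm_shift_roots (c := c)) => //; first exact: ltW.
  move=> y yrs; have := hx y yrs.
  have : cabs (x - y) <= t + cabs (z - y).
    rewrite (_ : x - y = (x - z) + (z - y)); last by rewrite addrA subrK.
    by apply: le_trans (cabsD _ _) _; rewrite lerD2r cabsB.
  lra.
have K3 : 3 ^+ n <= K by apply: lerXn2r; rewrite ?nnegrE// ler_nat.
have [y1|y1] := leP (s * t) 1.
  apply: (le_trans y1); apply: (le_trans K1).
  by rewrite ler_peMr ?(ltW K0)// lerDl divr_ge0// ltW.
case: j j1 hj => [|[|j]]// _ hj.
(* The order is now j + 2. As s t > 1, s t is at most (s t)^(j+1), and s (s t)^(j+1) = s^(j+2)
   t^(j+1) is bounded by a term of the norm of q at x, hence by 3^n |q(z)|. *)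
apply: (@le_trans _ _ ((s * t) ^+ j.+1)).
  by rewrite exprS ler_peMr ?exprn_ege1 ?mulr_ge0// ltW.
apply: (@le_trans _ _ (K * (cabs q.[z] / s))); last first.
  by rewrite ler_wpM2l ?(ltW K0)// lerDr.
rewrite mulrA ler_pdivlMr// exprMn mulrAC -exprSr.
apply: (@le_trans _ _ (cabs (shiftp x q)`_j.+1 * t ^+ j.+1)).
  by rewrite ler_wpM2r ?exprn_ge0 ?(ltW t0)//; apply: (le_trans hj); exact: coef_shiftp_le.
apply: le_trans (nrm_term _ _ (ltW t0)) _; apply: (le_trans hn).
by rewrite ler_wpM2r.
Qed.

(* An oscillatory integral is governed by its worst critical point zeta: s is
   the inverse of the scale at which the phase is of size one around zeta. *)
Lemma kern_cases n (r : R) : 1 <= r < 2 -> exists2 C : R, 0 < C &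
  forall P, (size P <= n.+2)%N ->
  [\/ l1norm P^`() <= C,
      (\int[@lebesgueC R]_(p in disk (0%R : R[i]) 1%R) (kern 1 P p)%:E <=
        (C / l1norm P^`())%:E)%E |
      exists (zeta : R[i]) (s : R), [/\ cabs zeta <= 2, 1 <= s,
        (\int[@lebesgueC R]_(p in disk (0%R : R[i]) 1%R) (kern (s ^- 2) P p)%:E <=
          (C * s `^ (- r))%:E)%E &
        forall j, (0 < j)%N -> cabs (shiftp zeta P)`_j <= s ^+ j]].
Proof.
move=> /andP[r1 r2].
have [C0 C00 hC0] := @integral_singular R r ltac:(apply/andP; split; lra).
pose C1 : R := n.+2%:R ^+ 2 * 3 ^+ n.
pose C2 : R := n.+3%:R * (4 ^+ n) ^+ 2 * 4.
pose C3 : R := 6 * (12 ^+ n) ^+ 2 * (4 + n%:R * C0).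
have C10 : 0 <= C1 by rewrite /C1; nneg.
have C20 : 0 <= C2 by rewrite /C2; nneg.
have C30 : 0 <= C3 by rewrite /C3; nneg.
exists (1 + C1 + C2 + C3); first by rewrite -!addrA ltr_pwDl// !addr_ge0.
move=> P Pn; set C := (X in l1norm _ <= X); set q := P^`().
have qn : (size q <= n.+1)%N.
  by apply: leq_trans (size_poly _ _) _; rewrite -subn1 leq_subLR add1n.
set W := l1norm q.
have W0 : 0 <= W by exact: l1norm_ge0.
have [W1|W1] := leP W 1; first by constructor 1; rewrite /C; lra.
have Wgt0 : 0 < W by exact: lt_trans W1.
have q0 : q != 0.
  by apply: contraTneq W1 => q0; rewrite /W q0 /l1norm size_poly0 big_ord0 -leNgt.
have [c [rs [c0 qE qsize]]] := poly_roots_seq q0.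
have rsn : (size rs <= n)%N by rewrite -ltnS -qsize.
have mD : measurable (disk (0 : R[i]) 1) by exact: measurable_disk.
(* If all roots lie beyond radius 2, |q| is comparable on the unit disk to its coefficient norm W,
   and m = 1 gives a kernel of size 1 / W. *)
have [h1|] := boolP (all (fun x => 2 < cabs x) rs).
  constructor 2.
  apply: (@le_trans _ _ (\int[@lebesgueC R]_(p in disk (0%R : R[i]) 1%R) (cst (C2 / 4 / W)%:E p))%E).
    apply: ge0_le_integral => //.
    - by move=> p _; rewrite lee_fin kern_ge0.
    - by apply/measurable_EFinP; apply: measurable_funTS; exact: measurable_kern.
    - move=> p; rewrite disk0E => p1; rewrite /= lee_fin /kern !mul1r -/q.
      have hW : W <= 4 ^+ n * cabs q.[toC p].
        rewrite /W l1normE; apply: (nrm1_le_of_far _ _ qE rsn p1) => // x /(allP h1) x2.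
        by rewrite cabsB; apply: le_trans (lerB_cabs _ _); lra.
      have b1 : cabs q.[toC p] <= W by exact: horner_l1norm.
      have b2 : cabs q^`().[toC p] <= n%:R * W.
        apply: le_trans (horner_l1norm _ p1) _; rewrite l1normE /W l1normE.
        exact: nrm_deriv.
      set a := cabs q.[_] in hW b1 *; set b := cabs _ in b2 *.
      have a0 : 0 <= a by exact: cabs_ge0.
      have D0 : 0 < 1 + a ^+ 2 by rewrite ltr_pwDl// exprn_ge0.
      rewrite ler_pdivrMr// /C2 mulfK// mulrAC ler_pdivlMr//.
      apply: (@le_trans _ _ (n.+3%:R * (W * W))).
        rewrite mulrA ler_wpM2r//.
        apply: (@le_trans _ _ (W + W + n%:R * W)).
          by apply: lerD => //; apply: lerD => //; exact: ltW.
        by rewrite -[n.+3]addn3 natrD mulrDl; lra.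
      rewrite -mulrA ler_wpM2l// -expr2.
      apply: (@le_trans _ _ ((4 ^+ n * a) ^+ 2)).
        by apply: lerXn2r; rewrite ?nnegrE//; nneg.
      by rewrite exprMn ler_wpM2l ?exprn_ge0// lerDr.
  rewrite integral_cst//; apply: (@le_trans _ _ ((C2 / 4 / W)%:E * 4%:E)%E).
    rewrite lee_wpmul2l ?lee_fin ?divr_ge0//.
    apply: le_trans (lebesgueC_disk_le _ _) _ => //.
    by rewrite lee_fin expr1n mulr1.
  rewrite -EFinM lee_fin (_ : C2 / 4 / W * 4 = C2 / W); last by field; exact: lt0r_neq0.
  by rewrite ler_wpM2r ?invr_ge0// /C; lra.
move=> /allPn[x1 x1rs x12].
have coefge0 zeta (j : nat) : 0 <= cabs (shiftp zeta P)`_j by [].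
have /choice[sf hsf] : forall zeta, exists s : R, [/\ 1 <= s,
      forall j, (2 <= j <= n.+1)%N -> cabs (shiftp zeta P)`_j <= s ^+ j &
      s = 1 \/ exists2 j, (2 <= j <= n.+1)%N & s ^+ j <= cabs (shiftp zeta P)`_j].
  by move=> zeta; exact: root_scale.
pose rs2 := [seq x <- rs | cabs x <= 2].
have rs20 : rs2 != [::].
  by apply/eqP => h; have : x1 \in rs2; [rewrite mem_filter x1rs leNgt x12|rewrite h].
(* The least s belongs to the widest stationary region. By minimality the lower bound on a Taylor
   coefficient at any other root of modulus at most 2 holds with this same s; the remaining roots
   are more than 1 away from the unit disk. *)
have [z0 z0rs hz0] := seq_argmin sf rs20.
move: z0rs; rewrite mem_filter => /andP[z02 z0rs].
set s := sf z0 in hz0; have [s1 hs1 hs2] := hsf z0; rewrite -/s in s1 hs1 hs2.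
have qz0 : q.[z0] = 0 by apply/rootP; rewrite qE rootZ// root_prod_XsubC.
have hcoef j : (0 < j)%N -> cabs (shiftp z0 P)`_j <= s ^+ j.
  case: j => [//|[_|j _]].
    have := coef_shiftp_deriv z0 P 0; rewrite -/q coef0_shiftp mulr1n qz0 => <-.
    by rewrite cabs0 exprn_ge0// (le_trans _ s1).
  have [jn|jn] := leqP j.+2 n.+1; first by apply: hs1; rewrite jn.
  by rewrite nth_default ?cabs0 ?exprn_ge0 ?(le_trans _ s1)// size_shiftp (leq_trans Pn).
have z01 : 1 + cabs z0 <= 3 * 1 by lra.
have qshift (f : {poly R[i]}) : (size f <= n.+1)%N -> nrm (1 + cabs z0) f <= 3 ^+ n * nrm 1 f.
  move=> fn; apply: (@le_trans _ _ (nrm (3 * 1) f)).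
    apply: ler_sum => i _; rewrite ler_wpM2l// lerXn2r ?nnegrE//; nneg.
  by apply: nrm_scale => //; rewrite ler1n.
(* If s = 1, all Taylor coefficients of positive order at z0 are at most 1, and recentring at 0
   bounds W. If s > 1, the maximum in [root_scale] is reached at every root considered. *)
have [/eqP s_eq1|s_ne1] := boolP (s == 1).
  constructor 1; apply: (@le_trans _ _ C1); last by rewrite /C; lra.
  rewrite /W l1normE -(shiftpK z0 q); apply: le_trans (nrm_shift _ _ _) _ => //.
  rewrite cabsN; apply: le_trans (qshift _ _) _; first by rewrite size_shiftp.
  rewrite /C1 mulrC ler_wpM2r ?exprn_ge0// (@nrm_wide _ n.+1) ?size_shiftp//.
  apply: (@le_trans _ _ (\sum_(i < n.+1) n.+2%:R)).
    apply: ler_sum => i _; rewrite expr1n mulr1 coef_shiftp_deriv -[_ *+ i.+1]mulr_natl cabsM cabs_nat.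
    rewrite -[leRHS]mulr1 ler_pM//; first by rewrite ler_nat leqW.
    by apply: le_trans (hcoef _ _) _ => //; rewrite s_eq1 expr1n.
  by rewrite sumr_const card_ord expr2 -[_ *+ n.+1]mulr_natr ler_wpM2l// ler_nat.
have s_gt1 : 1 < s by rewrite lt_neqAle eq_sym s_ne1.
have s0 : 0 < s by exact: lt_trans s_gt1.
constructor 3; exists z0, s; split=> //.
apply: le_trans (integral_kern_singular (r := r) (C := C0) (rs := rs)
    (A := 6 * (12 ^+ n) ^+ 2 * s `^ (- r)) _ _ _ _ _) _ => //.
- by rewrite invr_gt0 exprn_gt0.
- by nneg.
- move=> p p1; apply: kern_root_bound qE rsn _ _ p1 => //.
  + by rewrite r1 ltW.
  + case: hs2 => [h|[j /andP[j2 jn] hj]]; first by rewrite h eqxx in s_ne1.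
    apply: (@le_trans _ _ (s ^+ j)); first by rewrite ler_weXn2l// ltW.
    case: j j2 jn hj => [//|j] j2 jn hj; apply: (le_trans hj).
    apply: le_trans (coef_shiftp_le _ _ _) _.
    have := nrm_term (shiftp z0 q) j ler01; rewrite expr1n mulr1 => /le_trans; apply.
    by apply: le_trans (nrm_shift _ _ _) _ => //; exact: qshift.
  + move=> x xrs x2.
    have sx : s <= sf x by apply: hz0; rewrite mem_filter x2.
    have [sx1 _ [h|[j /andP[j2 jn] hj]]] := hsf x.
      by move: (lt_le_trans s_gt1 sx); rewrite h ltxx.
    exists j => //; apply: le_trans hj.
    by apply: lerXn2r => //; rewrite nnegrE ltW// (lt_le_trans s0).
- rewrite lee_fin mulrAC ler_wpM2r ?powR_ge0//.
  apply: (@le_trans _ _ C3); last by rewrite /C; lra.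
  apply: ler_wpM2l; first by nneg.
  by rewrite lerD2l ler_wpM2r// ler_nat.
Qed.

End Geometry.

(** * From the kernel to the oscillatory integral *)

Section ExtensionBound.
Variable R : realType.
Notation plane := (measurableTypeR R * measurableTypeR R)%type.

Lemma bsupp_integral_le (M : R) (f : plane -> R) : bsupp M f ->
  (`|\int[@lebesgueC R]_p (f p)%:E| <= (4 * M)%:E)%E.
Proof.
move=> bf; have [mf fM f0] := bf.
have M0 : 0 <= M by exact: le_trans (fM (0, 0)).
have mD : measurable (disk (0 : R[i]) 1) by exact: measurable_disk.
apply: le_trans (le_abse_integral _ _ _) _ => //; first exact/measurable_EFinP.
apply: (@le_trans _ _ (\int[@lebesgueC R]_p (M%:E * (\1_(disk (0%R : R[i]) 1%R) p)%:E))%E).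
  apply: ge0_le_integral => //.
  - by apply: measurableT_comp => //; exact/measurable_EFinP.
  - by apply: measurable_funeM; apply/measurable_EFinP; exact: measurable_indic.
  - move=> p _; rewrite -EFinM lee_fin.
    have [p1|p1] := leP (cabs (toC p)) 1; last by rewrite f0// normr0 mulr_ge0.
    by rewrite indicE mem_set ?mulr1// disk0E.
rewrite ge0_integralZl_EFin//; last by apply/measurable_EFinP; exact: measurable_indic.
rewrite integral_indic// setIT mulrC EFinM lee_wpmul2l ?lee_fin//.
apply: le_trans (lebesgueC_disk_le _ _) _ => //.
by rewrite lee_fin expr1n mulr1.
Qed.

Lemma bsupp_cos (M c : R) (f : plane -> R) (th : plane -> R) : bsupp M f ->
  measurable_fun setT th -> bsupp M (fun p => f p * cos (th p + c)).
Proof.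
move=> [mf fM f0] mth; split.
- apply: measurable_funM => //; apply: (@measurableT_comp _ _ _ _ _ _ (@cos R)).
    by apply: continuous_measurable_fun; exact: continuous_cos.
  exact: measurable_funD.
- move=> p; rewrite normrM -[leRHS]mulr1; apply: ler_pM => //.
  by rewrite ler_norml cos_geN1 cos_le1.
- by move=> p p1; rewrite f0// mul0r.
Qed.

Lemma measurable_phase (P : {poly R[i]}) : measurable_fun setT (phase P).
Proof.
have [m1 m2] := @cmeas_horner R _ _ P _ (@cmeas_toC R).
by apply: measurable_funM => //; exact: measurable_funD.
Qed.

Definition osc_integral (phi : R[i] -> R[i]) (P : {poly R[i]}) : R[i] :=
  integralC (fun z => echar P.[z] * 1 * phi z).

Section Phi.
Variable phi : R[i] -> R[i].
Hypothesis hphi : Cc_oo_disk phi.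

Lemma Cc_oo_C1supp : exists M fx fy gx gy,
  C1supp M (fun p : R * R => complex.Re (phi (toC p))) fx fy /\
  C1supp M (fun p : R * R => complex.Im (phi (toC p))) gx gy.
Proof.
have [[sr si] cK K1] := hphi.
set K := closure _ in cK K1.
have f0 (p : R * R) : ~ K p -> phi (toC p) = 0.
  move=> nK; apply/eqP; apply: contrapT => /negP h; apply: nK.
  exact: subset_closure.
have [M1 h1] := smooth_C1supp sr cK K1 (fun p nK => congr1 (@complex.Re R) (f0 p nK)).
have [M2 h2] := smooth_C1supp si cK K1 (fun p nK => congr1 (@complex.Im R) (f0 p nK)).
have W M M' f fx fy : M <= M' -> C1supp M f fx fy -> C1supp M' f fx fy.
  by move=> MM [? ? ? ? ? ? ?]; split=> //; exact: bsuppW MM _.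
exists (Num.max M1 M2); do 4 eexists; split.
- by apply: W h1; rewrite le_max lexx.
- by apply: W h2; rewrite le_max lexx orbT.
Qed.

(** Sines are written as shifted cosines; this is the purpose of the constant [c] carried through
    the integration by parts. *)
Lemma Re_osc (P : {poly R[i]}) (p : plane) :
  complex.Re (echar P.[toC p] * 1 * phi (toC p)) =
  complex.Re (phi (toC p)) * cos (phase P p + 0) +
  complex.Im (phi (toC p)) * cos (phase P p + pi / 2).
Proof.
rewrite mulr1 ReCM echarE /expi /= -/(phase P p) addr0.
by rewrite cosD cos_pihalf sin_pihalf; ring.
Qed.

Lemma Im_osc (P : {poly R[i]}) (p : plane) :
  complex.Im (echar P.[toC p] * 1 * phi (toC p)) =
  complex.Im (phi (toC p)) * cos (phase P p + 0) +
  complex.Re (phi (toC p)) * cos (phase P p + - (pi / 2)).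
Proof.
rewrite mulr1 ImCM echarE /expi /= -/(phase P p) addr0.
by rewrite cosD cosN sinN cos_pihalf sin_pihalf; ring.
Qed.

Lemma osc_integral_le (B : \bar R) (P : {poly R[i]}) M fx fy gx gy :
  C1supp M (fun p : R * R => complex.Re (phi (toC p))) fx fy ->
  C1supp M (fun p : R * R => complex.Im (phi (toC p))) gx gy ->
  (forall f fx fy c, C1supp M f fx fy ->
     (`|\int[@lebesgueC R]_p (f p * cos (phase P p + c))%:E| <= B)%E) ->
  ((cabs (osc_integral phi P))%:E <= 4%:E * B)%E.
Proof.
move=> hr hi hB.
have i1 c := bsupp_integrable (bsupp_cos c (C1_f hr) (measurable_phase P)).
have i2 c := bsupp_integrable (bsupp_cos c (C1_f hi) (measurable_phase P)).
have fin (f : plane -> R) : (@lebesgueC R).-integrable setT (EFin \o f) ->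
    (`|\int[@lebesgueC R]_p (f p)%:E| <= B)%E ->
    ((`|(\int[@lebesgueC R]_p f p)%R|)%:E <= B)%E.
  move=> fi; rewrite /Rintegral -[X in (X <= B)%E -> _]fineK; last first.
    by rewrite abse_fin_num; exact: integrable_fin_num.
  by rewrite fine_abse//; exact: integrable_fin_num.
apply: (@le_trans _ _ ((`|(\int[@lebesgueC R]_p complex.Re (echar P.[toC p] * 1 * phi (toC p)))%R|
   + `|(\int[@lebesgueC R]_p complex.Im (echar P.[toC p] * 1 * phi (toC p)))%R|)%:E)%E).
  by rewrite lee_fin; apply: le_trans (cabs_ReIm _) _.
rewrite EFinD (_ : 4%:E * B = (B + B) + (B + B))%E; last first.
  have B0 : (0 <= B)%E by apply: le_trans (hB _ _ _ 0 hr); exact: abse_ge0.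
  rewrite (_ : 4 = 1 + 1 + (1 + 1)); last by ring.
  by rewrite !EFinD !ge0_muleDl ?mul1e ?adde_ge0 ?lee_fin.
apply: leeD.
  under eq_Rintegral do rewrite Re_osc.
  rewrite RintegralD//; apply: (@le_trans _ _ (`|_|%:E + `|_|%:E)%E).
    by rewrite -EFinD lee_fin; exact: ler_normD.
  by apply: leeD; apply: fin => //; [exact: hB hr|exact: hB hi].
under eq_Rintegral do rewrite Im_osc.
rewrite RintegralD//; apply: (@le_trans _ _ (`|_|%:E + `|_|%:E)%E).
  by rewrite -EFinD lee_fin; exact: ler_normD.
by apply: leeD; apply: fin => //; [exact: hB hi|exact: hB hr].
Qed.

Lemma osc_integral_bounds : exists2 M : R, 0 <= M & forall P : {poly R[i]},
  cabs (osc_integral phi P) <= M /\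
  forall m, 0 < m -> ((cabs (osc_integral phi P))%:E <=
    M%:E * \int[@lebesgueC R]_(p in disk (0%R : R[i]) 1%R) (kern m P p)%:E)%E.
Proof.
have [M [fx [fy [gx [gy [hr hi]]]]]] := Cc_oo_C1supp.
have M0 : 0 <= M by have [_ /(_ (0, 0)) h _] := C1_f hr; exact: le_trans h.
exists (32 * M); first by rewrite mulr_ge0.
move=> P; split=> [|m m0].
  rewrite -lee_fin; apply: le_trans (osc_integral_le (B := (4 * M)%:E) hr hi _) _.
    move=> f fx' fy' c hf; apply: bsupp_integral_le.
    exact: bsupp_cos (C1_f hf) (measurable_phase P).
  by rewrite -EFinM lee_fin; lra.
apply: le_trans (osc_integral_le (B := ((8 * M)%:E *
    \int[@lebesgueC R]_(p in disk (0%R : R[i]) 1%R) (kern m P p)%:E)%E) hr hi _) _.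
  by move=> f fx' fy' c hf; exact: oscillatory_ibp hf m0.
by rewrite muleA -EFinM (_ : 4 * (8 * M) = 32 * M)//; ring.
Qed.

(** The first two alternatives of [kern_cases] merge into decay in the coefficients: the trivial
    bound serves for bounded W, m = 1 for large W. The third is used with m = s^(-2). *)
Lemma osc_integral_cases n (r : R) : 1 <= r < 2 -> exists2 C : R, 0 < C &
  forall P : {poly R[i]}, (size P <= n.+2)%N ->
  cabs (osc_integral phi P) <= C / (1 + l1norm P^`()) \/
  exists (zeta : R[i]) (s : R), [/\ cabs zeta <= 2, 1 <= s,
    cabs (osc_integral phi P) <= C * s `^ (- r) &
    forall j, (0 < j)%N -> cabs (shiftp zeta P)`_j <= s ^+ j].
Proof.
move=> r12; have [C C0 hC] := kern_cases n r12.
have [M M0 hM] := osc_integral_bounds.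
exists (M * (2 + 2 * C) + 1).
  by rewrite ltr_wpDl// mulr_ge0//; lra.
move=> P Pn; have [h1 h2] := hM P; set W := l1norm _.
have W0 : 0 <= W by exact: l1norm_ge0.
have MC : 0 <= M * C by rewrite mulr_ge0// ltW.
have small D : W <= D -> M * (1 + D) <= M * (2 + 2 * C) + 1 ->
    cabs (osc_integral phi P) <= (M * (2 + 2 * C) + 1) / (1 + W).
  move=> WD MD; rewrite ler_pdivlMr; last by rewrite ltr_pwDl.
  apply: le_trans MD; apply: ler_pM => //; first by rewrite addr_ge0.
  by rewrite lerD2l.
case: (hC P Pn) => [hW|hW|[zeta [s [z2 s1 hs hj]]]].
- by left; apply: (small C hW); rewrite !mulrDr; lra.
- left; have [W1|W1] := leP W 1; first by apply: (small 1 W1); rewrite !mulrDr; lra.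
  have := h2 1 ltr01; rewrite -lee_fin => /le_trans; apply.
  apply: (@le_trans _ _ (M%:E * (C / W)%:E)%E); first by rewrite lee_wpmul2l ?lee_fin.
  rewrite -EFinM lee_fin mulrA ler_pdivlMr ?ltr_pwDl//.
  rewrite mulrAC ler_pdivrMr; last exact: lt_trans W1.
  rewrite mulrDr mulr1 mulrDl mulrDr; nra.
- right; exists zeta, s; split=> //.
  have s0 : 0 < s by exact: lt_le_trans s1.
  have := h2 (s ^- 2); rewrite invr_gt0 exprn_gt0// => /(_ isT).
  rewrite -lee_fin => /le_trans; apply.
  apply: (@le_trans _ _ (M%:E * (C * s `^ (- r))%:E)%E); first by rewrite lee_wpmul2l ?lee_fin.
  rewrite -EFinM lee_fin mulrA ler_wpM2r ?powR_ge0//.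
  by rewrite mulrDr; lra.
Qed.

End Phi.
End ExtensionBound.

(** * Taylor coefficients of the phase polynomial *)

Section PhasePolynomial.
Variable R : realType.
Notation plane := (measurableTypeR R * measurableTypeR R)%type.

Definition Pw d (k : nat -> nat) (w : d.-tuple plane) : {poly R[i]} :=
  \sum_(j < d) (toC (tnth w j))%:P * 'X^(k j.+1).

Lemma horner_Pw d k (w : d.-tuple plane) z :
  (Pw k w).[z] = \sum_(j < d) toC (tnth w j) * z ^+ k j.+1.
Proof.
by rewrite /Pw horner_sum; apply: eq_bigr => j _; rewrite hornerM hornerC hornerXn.
Qed.

Lemma extensionE d k phi (w : d.-tuple plane) :
  extension k phi (fun=> 1) w = osc_integral phi (Pw k w).
Proof.
by rewrite /extension /osc_integral; congr integralC; apply/funext => z; rewrite horner_Pw.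
Qed.

Lemma coef_XaddC_exp (z : R[i]) m i :
  (('X + z%:P) ^+ m)`_i = ('C(m, i))%:R * z ^+ (m - i).
Proof.
rewrite addrC exprDn coef_sum.
under eq_bigr => j _ do rewrite -polyC_exp coefMn coefCM coefXn.
have [im|im] := leqP i m.
  rewrite (bigD1 (inord i))//= big1 ?addr0; last first.
    move=> j; rewrite -val_eqE /= inordK ?ltnS// => ji.
    by rewrite eq_sym (negbTE ji) mulr0 mul0rn.
  by rewrite inordK ?ltnS// eqxx mulr1 mulr_natl.
rewrite bin_small// mul0r big1// => j _.
rewrite (_ : (i == j) = false) ?mulr0 ?mul0rn//.
by apply/negbTE; rewrite neq_ltn (leq_ltn_trans (leq_ord j))// orbT.
Qed.

Lemma coef_shiftp_Pw d k (w : d.-tuple plane) z i :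
  (shiftp z (Pw k w))`_i =
  \sum_(l < d) ('C(k l.+1, i))%:R * z ^+ (k l.+1 - i) * toC (tnth w l).
Proof.
rewrite /shiftp /Pw; rewrite raddf_sum /= coef_sum; apply: eq_bigr => l _.
by rewrite comp_polyM comp_polyC comp_Xn_poly coefCM coef_XaddC_exp mulrC.
Qed.

Lemma powRD_gt0 (x a b : R) : 0 < x -> x `^ (a + b) = x `^ a * x `^ b.
Proof. by move=> x0; apply: powRD; apply/implyP => _; rewrite gt_eqF. Qed.

Lemma powR_sum (s : R) d (f : nat -> R) : 0 < s ->
  \prod_(j < d) s `^ f j = s `^ (\sum_(j < d) f j).
Proof.
move=> s0; elim: d => [|d IH]; first by rewrite !big_ord0 powRr0.
by rewrite !big_ord_recr /= IH powRD_gt0.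
Qed.

Lemma singular_pinfty (r : R) a (p : plane) : 0 < r -> toC p = a -> singular r a p = +oo%E.
Proof.
move=> r0 pa; apply/eqyP => A A0.
set A' := Num.max A 1; have A'1 : 1 <= A' by rewrite le_max lexx orbT.
have A'0 : 0 < A' by exact: lt_le_trans A'1.
have h : 0 < A' `^ (- r^-1) <= 1.
  rewrite powR_gt0//= powRN invf_le1 ?powR_gt0//.
  by rewrite -[leLHS](powRr0 A') ler_powR// invr_ge0 ltW.
apply: le_trans (singular_ge (ltW r0) h _); last first.
  by rewrite pa subrr cabs0 powR_ge0.
rewrite lee_fin -powRrM mulrNN mulVf ?gt_eqF// powRr1 ?(ltW A'0)//.
by rewrite le_max lexx.
Qed.

Lemma geometric_mean_le (U V t : R) : 0 <= U -> 0 <= V -> 0 <= t <= 1 -> 0 < U + V ->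
  U `^ (1 - t) * V `^ t <= U + V.
Proof.
move=> U0 V0 /andP[t0 t1] S0.
have -> : U + V = (U + V) `^ (1 - t) * (U + V) `^ t.
  by rewrite -powRD_gt0// subrK powRr1// ltW.
apply: ler_pM; rewrite ?powR_ge0//; apply: ge0_ler_powR; rewrite ?nnegrE ?subr_ge0 ?addr_ge0//.
  by rewrite lerDl.
by rewrite lerDr.
Qed.

(* Recentring at distance 1/s only changes by constants the coefficients of a
   polynomial of size one at scale 1/s. *)
Lemma coef_recentre n (P : {poly R[i]}) zeta z (s : R) : 0 < s -> (size P <= n)%N ->
  (forall j, (0 < j)%N -> cabs (shiftp zeta P)`_j <= s ^+ j) -> cabs (z - zeta) <= s^-1 ->
  forall j, (0 < j)%N -> cabs (shiftp z P)`_j <= n.+1%:R * 2 ^+ n.+1 * s ^+ j.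
Proof.
move=> s0 Pn hP zs j j0.
(* The constant term is not controlled by the hypothesis, and removing it leaves all coefficients of
   positive order unchanged. *)
pose f := shiftp zeta P - ((shiftp zeta P)`_0)%:P.
have -> : (shiftp z P)`_j = (shiftp (z - zeta) f)`_j.
  rewrite /f /shiftp comp_polyB comp_polyC coefB coefC gtn_eqF// subr0.
  rewrite -comp_polyA comp_polyD comp_polyX comp_polyC.
  by rewrite -addrA -polyCD subrK.
have fn : (size f <= n.+1)%N.
  apply: leq_trans (size_polyD _ _) _; rewrite size_polyN size_shiftp geq_max.
  by rewrite (leq_trans Pn)//= (leq_trans (size_polyC_leq1 _)).
have sV0 : 0 <= s^-1 by rewrite invr_ge0 ltW.
have h1 := nrm_term (shiftp (z - zeta) f) j sV0.
rewrite -ler_pdivrMr ?exprn_gt0// -exprVn; apply: (le_trans h1).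
apply: le_trans (nrm_shift _ _ sV0) _; rewrite (nrm_wide _ fn).
apply: (@le_trans _ _ (\sum_(i < n.+1) 2 ^+ n.+1)); last first.
  by rewrite sumr_const card_ord -[_ *+ n.+1]mulr_natl.
apply: ler_sum => i _.
apply: (@le_trans _ _ (s ^+ i * (2 * s^-1) ^+ i)).
  apply: ler_pM => //; first by rewrite exprn_ge0// addr_ge0.
    rewrite /f coefB coefC; case: (nat_of_ord i) => [|i'] /=.
      by rewrite subrr cabs0 exprn_ge0// ltW.
    by rewrite subr0; exact: hP.
  by apply: lerXn2r; rewrite ?nnegrE ?addr_ge0 ?mulr_ge0// mulr_natl mulr2n lerD2l.
rewrite -exprMn mulrCA divff ?gt_eqF// mulr1 ler_weXn2l ?ler1n//.
exact: ltnW.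
Qed.

End PhasePolynomial.

(** * The product majorant and its integral in w *)

Section Majorant.
Variable R : realType.
Notation plane := (measurableTypeR R * measurableTypeR R)%type.
Variables (d : nat) (k : nat -> nat) (i0 : nat) (b tau : R).
Hypothesis hk0 : forall j, (j < d)%N -> (0 < k j.+1)%N.
Hypothesis hk : forall l j, (l < j)%N -> (j < d)%N -> (k l.+1 < k j.+1)%N.
Hypothesis hb : 2 < b.
Hypothesis htau : 0 < tau < 1.
(* i0 = d encodes that no exponent is lowered. *)
Hypothesis hi0 : (i0 < d)%N -> (1 < k i0.+1)%N /\
  forall l, (l < d)%N -> k l.+1 <> (k i0.+1).-1.

Definition expA (j : nat) : R := if j == i0 then b * (1 - tau) else b.
Definition expB (j : nat) : R := if j == i0 then b * tau else 0.

Definition majfac (j : nat) (u v : R[i]) : R :=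
  (1 + cabs u) `^ (- expA j) * (1 + cabs v) `^ (- expB j).

Definition matA (z : R[i]) (j l : nat) : R[i] :=
  if (l < j)%N then 0 else ('C(k l.+1, k j.+1))%:R * z ^+ (k l.+1 - k j.+1).

Definition matB (z : R[i]) (j l : nat) : R[i] :=
  if (l < j)%N || (j != i0) then 0
  else ('C(k l.+1, (k j.+1).-1))%:R * z ^+ (k l.+1 - (k j.+1).-1).

Definition majorant (z : R[i]) (w : d.-tuple plane) : R :=
  triprod majfac (matA z) (matB z) w.

Lemma expA_ge0 j : 0 <= expA j.
Proof.
have /andP[t0 t1] := htau; have b2 := hb; rewrite /expA; case: ifP => _; last by lra.
by rewrite mulr_ge0//; lra.
Qed.

Lemma expB_ge0 j : 0 <= expB j.
Proof.
have /andP[t0 t1] := htau; have b2 := hb; rewrite /expB; case: ifP => _ //.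
by rewrite mulr_ge0//; lra.
Qed.

Lemma majfac_ge0 j u v : 0 <= majfac j u v.
Proof. by rewrite mulr_ge0// powR_ge0. Qed.

Lemma bimeas_majfac j : bimeas (majfac j).
Proof.
move=> dX X u v mu mv; have m1 (f : X -> R[i]) (a : R) : cmeas f ->
    measurable_fun setT (fun x => (1 + cabs (f x)) `^ a).
  move=> mf; apply: (measurableT_comp (measurable_powR a)).
  by apply: measurable_funD => //; exact: measurable_cabs.
by apply: measurable_funM; exact: m1.
Qed.

Lemma majorant_ge0 z w : 0 <= majorant z w.
Proof. by apply: triprod_ge0; exact: majfac_ge0. Qed.

Lemma cmeas_natM dX (X : measurableType dX) (f g : X -> R[i]) (n m : nat) :
  cmeas f -> cmeas g -> cmeas (fun x => n%:R * f x ^+ m * g x).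
Proof.
move=> mf mg; apply: cmeasM => //; apply: cmeasM; first exact: cmeas_cst.
exact: cmeasX.
Qed.

Lemma measurable_majorant :
  measurable_fun setT (fun wp : d.-tuple plane * plane => majorant (toC wp.2) wp.1).
Proof.
have mt (l : 'I_d) : cmeas (fun wp : d.-tuple plane * plane => toC (tnth wp.1 l)).
  apply: (cmeas_comp (f := @toC R)); first exact: cmeas_toC.
  by apply: (measurableT_comp (measurable_tnth l)).
have mz : cmeas (fun wp : d.-tuple plane * plane => toC wp.2).
  by apply: (cmeas_comp (f := @toC R)); first exact: cmeas_toC.
apply: measurable_prodR => j; apply: bimeas_majfac.
- apply: cmeas_sum => l; rewrite /matA; case: (l < j)%N; last exact: cmeas_natM.
  by under eq_fun do rewrite mul0r; exact: cmeas_cst.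
- apply: cmeas_sum => l; rewrite /matB; case: (_ || _); last exact: cmeas_natM.
  by under eq_fun do rewrite mul0r; exact: cmeas_cst.
Qed.

Lemma linform_matA z (j : nat) (w : d.-tuple plane) : (j < d)%N ->
  linform (matA z) j w = (shiftp z (Pw k w))`_(k j.+1).
Proof.
move=> jd; rewrite coef_shiftp_Pw; apply: eq_bigr => l _; rewrite /matA.
by case: ifP => // lj; rewrite bin_small ?hk// !mul0r.
Qed.

(** Here the gap is used: an earlier exponent is below k_{i0} and different from k_{i0} - 1, hence
    below it, so the entries set to 0 in [matB] are vanishing binomials. The form for c_{k_{i0} - 1}
    is thus triangular as well, with diagonal entry k_{i0} z. *)
Lemma linform_matB z (w : d.-tuple plane) : (i0 < d)%N ->
  linform (matB z) i0 w = (shiftp z (Pw k w))`_((k i0.+1).-1).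
Proof.
move=> jd; rewrite coef_shiftp_Pw; apply: eq_bigr => l _; rewrite /matB eqxx orbF.
case: ifP => // lj; rewrite bin_small ?mul0r//.
have [k1 kn] := hi0 jd; have := hk lj jd; rewrite -{1}(prednK (ltnW k1)) ltnS.
by rewrite leq_eqVlt => /predU1P[/kn|//] => /(_ (ltn_ord l)).
Qed.

(** The power of 1/s lost by the majorant when each c_i is O(s^i): b K if no exponent is lowered, b
    (K - tau) otherwise. *)
Definition majexp : R := \sum_(j < d) ((k j.+1)%:R * expA j + (k j.+1).-1%:R * expB j).

Lemma majorant_ge (K : R) : 1 <= K -> exists2 c : R, 0 < c &
  forall z (w : d.-tuple plane) s, 1 <= s ->
  (forall i, (0 < i)%N -> cabs (shiftp z (Pw k w))`_i <= K * s ^+ i) ->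
  c * s `^ (- majexp) <= majorant z w.
Proof.
move=> K1; have K0 : 0 < 1 + K by lra.
exists (\prod_(j < d) ((1 + K) `^ (- expA j) * (1 + K) `^ (- expB j))).
  by apply: prodr_gt0 => j _; rewrite mulr_gt0// powR_gt0.
move=> z w s s1 hs; have s0 : 0 < s by exact: lt_le_trans s1.
rewrite /majexp -sumrN -(powR_sum d (fun j => - ((k j.+1)%:R * expA j + (k j.+1).-1%:R * expB j)))//.
rewrite -big_split /majorant /triprod.
apply: ler_prod => j _ /=; apply/andP; split.
  by rewrite !mulr_ge0// powR_ge0.
have fac (i : nat) (u : R[i]) (a : R) : 0 <= a -> cabs u <= K * s ^+ i ->
    (1 + K) `^ (- a) * s `^ (- (i%:R * a)) <= (1 + cabs u) `^ (- a).
  move=> a0 hu.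
  have -> : s `^ (- (i%:R * a)) = (s ^+ i) `^ (- a).
    by rewrite -powR_mulrn ?(ltW s0)// -powRrM mulrN.
  rewrite -powRM ?exprn_ge0 ?(ltW s0) ?(ltW K0)//.
  apply: powRN_le => //; first by rewrite ltr_pwDl.
  rewrite mulrDl mul1r; apply: lerD => //; exact: exprn_ege1.
rewrite opprD powRD_gt0//.
rewrite mulrACA /majfac; apply: ler_pM; rewrite ?mulr_ge0 ?powR_ge0//.
  apply: fac; first exact: expA_ge0.
  by rewrite linform_matA//; apply: hs; exact: hk0.
have [ji|ji] := eqVneq (j : nat) i0; last first.
  rewrite {1 2 3}/expB (negbTE ji) mulr0 !oppr0 !powRr0 mulr1//.
have jd : (i0 < d)%N by rewrite -ji.
apply: fac; first exact: expB_ge0.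
rewrite ji linform_matB//; apply: hs.
by have [k1 _] := hi0 jd; rewrite -ltnS prednK// ltnW.
Qed.

(** In the factor of index i0 the variable enters c_{k_{i0}} with coefficient 1 but c_{k_{i0} - 1}
    with coefficient k_{i0} z, which degenerates at z = 0; hence the power of |z|. *)
Lemma integral_majfac : exists2 C : R, 0 < C & forall (z : R[i]) (j : nat) (u v : R[i]),
  (j < d)%N -> (j == i0) ==> (z != 0) ->
  (\int[@lebesgueC R]_x (majfac j (matA z j j * toC x + u) (matB z j j * toC x + v))%:E
   <= (C * (if j == i0 then cabs z `^ (- (2 * tau)) else 1))%:E)%E.
Proof.
have [C0 C00 hC] := decay_integral hb; have /andP[t0 t1] := htau.
exists (1 + 2 * C0); first by lra.
move=> z j u v jd z0; have Ajj : matA z j j = 1.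
  by rewrite /matA ltnn binn subnn expr0 mulr1.
have ha (l : R) (a c : R[i]) : 0 < l -> cabs a = l -> (\int[@lebesgueC R]_x
    ((1 + cabs (a * toC x + c)) `^ (- b))%:E <= (C0 / l ^+ 2)%:E)%E.
  move=> l0 al; have a0 : a != 0 by rewrite -cabs_gt0 al.
  apply: le_trans (hC l (- (c / a)) l0); rewrite le_eqVlt; apply/orP; left.
  apply/eqP; apply: eq_integral => x _; congr (_%:E); congr (_ `^ _); congr (_ + _).
  by rewrite -al -cabsM opprK mulrDr mulrCA divff// mulr1.
have mdec (l : R) (a c : R[i]) : measurable_fun setT
    (fun x : plane => (l * (1 + cabs (a * toC x + c)) `^ (- b))%:E).
  apply/measurable_EFinP; apply: measurable_funM => //.
  apply: (measurableT_comp (measurable_powR _)).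
  apply: measurable_funD => //; apply: measurable_cabs; apply: cmeasD; last exact: cmeas_cst.
  by apply: cmeasM; [exact: cmeas_cst|exact: cmeas_toC].
have [ji|ji] := eqVneq j i0; last first.
  rewrite mulr1; under eq_integral do rewrite /majfac /expA /expB (negbTE ji) oppr0 powRr0 mulr1.
  rewrite Ajj; apply: le_trans (ha 1 _ _ _ _) _; rewrite ?cabs1//.
  by rewrite expr1n divr1 lee_fin; lra.
subst j; rewrite eqxx /= in z0; have [k1 _] := hi0 jd.
have Bjj : matB z i0 i0 = (k i0.+1)%:R * z.
  rewrite /matB ltnn eqxx /=.
  rewrite -{1 3}(prednK (ltnW k1)) subSnn expr1 binSn prednK//; exact: ltnW.
set rho := cabs z; have rho0 : 0 < rho by rewrite /rho cabs_gt0.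
set kk : R := (k i0.+1)%:R; have kk1 : 1 <= kk by rewrite ler1n ltnW.
have kk0 : 0 < kk by exact: lt_le_trans kk1.
(* Weighted geometric mean of two full powers -b. The weights rho^(-2 tau) and rho^(2 - 2 tau)
   cancel in the mean, and make both integrals of size rho^(-2 tau), the second because its scale
   contributes rho^(-2). *)
apply: (@le_trans _ _ (\int[@lebesgueC R]_x
   ((rho `^ (- (2 * tau)) * (1 + cabs (1 * toC x + u)) `^ (- b))%:E +
    (rho `^ (2 - 2 * tau) * (1 + cabs (kk%:C%C * z * toC x + v)) `^ (- b))%:E))%E).
  apply: ge0_le_integral => //.
  - by move=> x _; rewrite lee_fin majfac_ge0.
  - apply/measurable_EFinP; apply: bimeas_majfac; (apply: cmeasD; last exact: cmeas_cst);
      by apply: cmeasM; [exact: cmeas_cst|exact: cmeas_toC].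
  - by apply: emeasurable_funD; exact: mdec.
  move=> x _; rewrite -EFinD lee_fin Ajj Bjj /majfac /expA /expB eqxx.
  rewrite (_ : kk%:C%C = (k i0.+1)%:R :> R[i]); last by rewrite /kk rmorph_nat.
  set X := 1 + cabs (1 * _ + _); set Y := 1 + cabs ((k _)%:R * _ * _ + _).
  have X0 : 0 < X by rewrite ltr_pwDl.
  have Y0 : 0 < Y by rewrite ltr_pwDl.
  set U := rho `^ _ * _; set V := rho `^ _ * _.
  have U0 : 0 < U by rewrite mulr_gt0// powR_gt0.
  have V0 : 0 < V by rewrite mulr_gt0// powR_gt0.
  apply: le_trans (geometric_mean_le (ltW U0) (ltW V0) (t := tau) _ _); last 2 first.
    by rewrite !ltW.
    by rewrite addr_gt0.
  rewrite /U /V !powRM ?powR_ge0// -!powRrM.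
  rewrite mulrACA -powRD_gt0//.
  rewrite (_ : - (2 * tau) * (1 - tau) + (2 - 2 * tau) * tau = 0); last by ring.
  by rewrite powRr0 mul1r !mulNr.
rewrite ge0_integralD//; last 2 first.
- by move=> x _; rewrite lee_fin mulr_ge0// powR_ge0.
- by move=> x _; rewrite lee_fin mulr_ge0// powR_ge0.
under eq_integral do rewrite EFinM.
under [X in (_ + X <= _)%E]eq_integral do rewrite EFinM.
rewrite !ge0_integralZl_EFin ?powR_ge0//; last 4 first.
- by move=> x _; rewrite lee_fin powR_ge0.
- by have := mdec 1 (kk%:C%C * z) v; under eq_fun do rewrite mul1r.
- by move=> x _; rewrite lee_fin powR_ge0.
- by have := mdec 1 1 u; under eq_fun do rewrite mul1r.
apply: (@le_trans _ _ ((rho `^ (- (2 * tau)))%:E * (C0 / 1 ^+ 2)%:E +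
   (rho `^ (2 - 2 * tau))%:E * (C0 / (kk * rho) ^+ 2)%:E)%E).
  apply: leeD; rewrite lee_wpmul2l ?lee_fin ?powR_ge0//.
    by apply: ha; rewrite ?cabs1.
  by apply: ha; [rewrite mulr_gt0|rewrite cabsM cabs_real gtr0_norm].
rewrite -!EFinM -EFinD lee_fin expr1n divr1.
have -> : rho `^ (2 - 2 * tau) = rho ^+ 2 * rho `^ (- (2 * tau)).
  by rewrite powRD_gt0// powR_mulrn// ltW.
set r := rho `^ _; have r0 : 0 <= r by exact: powR_ge0.
have h : rho ^+ 2 * r * (C0 / (kk * rho) ^+ 2) <= r * C0.
  rewrite (_ : rho ^+ 2 * r * (C0 / (kk * rho) ^+ 2) = r * C0 / kk ^+ 2); last first.
    by field; rewrite !gt_eqF.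
  by rewrite ler_pdivrMr ?exprn_gt0// ler_peMr ?mulr_ge0// exprn_ege1.
apply: (le_trans (lerD (lexx _) h)); rewrite -subr_ge0 (_ : _ - _ = r)//.
by ring.
Qed.

Lemma integral_majorant : exists2 C : R, 0 < C & forall p : plane,
  (\int[lebesgueCn R d]_w (majorant (toC p) w)%:E <=
   C%:E * (1 + singular (2 * tau) 0%R p))%E.
Proof.
have [C C0 hC] := integral_majfac; have /andP[t0 t1] := htau.
exists (C ^+ d); first exact: exprn_gt0.
move=> p; set z := toC p.
(* At z = 0 the second form has lost its diagonal entry; there the right-hand side is +oo. *)
have [/andP[/eqP zz id]|nz] := boolP ((z == 0) && (i0 < d)%N).
  rewrite singular_pinfty//; last by lra.
  by rewrite addey// gt0_muley ?lte_fin ?exprn_gt0// leey.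
pose u := cabs z `^ (- (2 * tau)).
have u0 : 0 <= u by exact: powR_ge0.
apply: (@le_trans _ _ (\prod_(j < d) (C * (if nat_of_ord j == i0 then u else 1)))%:E).
  apply: (integral_triprod_le (c := fun j => C * (if j == i0 then u else 1))).
  - exact: majfac_ge0.
  - exact: bimeas_majfac.
  - by move=> j; rewrite mulr_ge0 ?(ltW C0)//; case: ifP.
  - by move=> j l lj; rewrite /matA lj.
  - by move=> j l lj; rewrite /matB lj.
  - move=> j x y jd; apply: hC => //; apply/implyP => /eqP ji.
    by move: nz; rewrite -ji jd andbT.
rewrite big_split /= prodr_const card_ord EFinM lee_wpmul2l ?lee_fin ?exprn_ge0 ?(ltW C0)//.
have sg0 := singular_ge0 (2 * tau) 0 p.
have [id|id] := ltnP i0 d; last first.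
  rewrite big1; first by rewrite leeDl.
  by move=> j _; rewrite ltn_eqF// (leq_trans _ id).
rewrite (bigD1 (Ordinal id))//= eqxx big1 ?mulr1; last first.
  by move=> j; rewrite -val_eqE /= => /negbTE ->.
have z0 : 0 < cabs z by rewrite cabs_gt0; move: nz; rewrite id andbT.
have [z1|z1] := leP (cabs z) 1.
  apply: (@le_trans _ _ (singular (2 * tau) 0%R p)); last by rewrite leeDr.
  apply: singular_ge; first by lra.
    by rewrite z0.
  by rewrite subr0.
apply: (@le_trans _ _ 1%E); last by rewrite leeDl.
rewrite lee_fin; have := powRN_le (_ : 0 <= 2 * tau) ltr01 (ltW z1).
by rewrite powR1; apply; lra.
Qed.

End Majorant.

(** * Integrability of |E1|^q *)

Section Sufficiency.
Variable R : realType.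
Notation plane := (measurableTypeR R * measurableTypeR R)%type.

Lemma measurable_Rintegral_param dX (X : measurableType dX) (F : X * plane -> R) :
  measurable_fun setT F -> measurable_fun setT (fun w => (\int[@lebesgueC R]_p F (w, p))%R).
Proof.
move=> mF; have mE : measurable_fun setT (EFin \o F) by exact/measurable_EFinP.
have mp := @measurable_fun_fubini_tonelli_F _ _ _ _ _ (@lebesgueC R) _
  (measurable_funepos mE) (fun x => funepos_ge0 _ x).
have mn := @measurable_fun_fubini_tonelli_F _ _ _ _ _ (@lebesgueC R) _
  (measurable_funeneg mE) (fun x => funeneg_ge0 _ x).
rewrite /Rintegral.
apply: (measurableT_comp (f := fine)) => //.
apply: (eq_measurable_fun (fun w => \int[@lebesgueC R]_p (EFin \o F)^\+ (w, p) -
    \int[@lebesgueC R]_p (EFin \o F)^\- (w, p))%E) => [w _|].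
  by rewrite [RHS]integralE; congr (_ - _)%E; apply: eq_integral => p _;
    rewrite ?funeposE ?funenegE.
by apply: emeasurable_funB; [exact: mp|exact: mn].
Qed.

Lemma cmeas_extension d k phi : cmeas (fun p : plane => phi (toC p)) ->
  cmeas (@extension R d k phi (fun=> 1)).
Proof.
move=> mphi; rewrite /extension /integralC.
have mF : cmeas (fun wp : d.-tuple plane * plane =>
   echar (\sum_(j < d) toC (tnth wp.1 j) * toC wp.2 ^+ k j.+1) * 1 * phi (toC wp.2)).
  apply: cmeasM; last exact: (cmeas_comp mphi).
  apply: cmeasM; last exact: cmeas_cst.
  apply: cmeas_echar; apply: cmeas_sum => l; apply: cmeasM.
    apply: (cmeas_comp (f := @toC R)); first exact: cmeas_toC.
    exact: (measurableT_comp (measurable_tnth l)).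
  by apply: cmeasX; apply: (cmeas_comp (f := @toC R)); first exact: cmeas_toC.
have [m1 m2] := mF; split.
- exact: (measurable_Rintegral_param m1).
- exact: (measurable_Rintegral_param m2).
Qed.

Lemma cmeas_Cc_oo phi : Cc_oo_disk phi -> cmeas (fun p : plane => phi (toC p)).
Proof.
move=> /Cc_oo_C1supp[M [fx [fy [gx [gy [hr hi]]]]]].
by split; [have [] := C1_f hr|have [] := C1_f hi].
Qed.

(** (1 + W)^(-q) shared evenly among d coordinates of modulus at most W. Each factor has exponent q
    / d, integrable over the plane when q > 2 d. *)
Definition decay d (q : R) (w : d.-tuple plane) : R :=
  \prod_(j < d) (1 + cabs (toC (tnth w j))) `^ (- (q / d%:R)).

Lemma decay_ge0 d q (w : d.-tuple plane) : 0 <= decay q w.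
Proof. by apply: prodr_ge0 => j _; exact: powR_ge0. Qed.

Lemma linform_delta d j (w : d.-tuple plane) (jd : (j < d)%N) :
  linform (fun j l => (j == l)%:R : R[i]) j w = toC (tnth w (Ordinal jd)).
Proof.
rewrite /linform (bigD1 (Ordinal jd))//= eqxx mul1r big1 ?addr0// => l.
by rewrite -val_eqE /= eq_sym => /negbTE ->; rewrite mul0r.
Qed.

Lemma decayE d q (w : d.-tuple plane) :
  decay q w = triprod (fun _ u _ => (1 + cabs u) `^ (- (q / d%:R)))
    (fun j l => (j == l)%:R) (fun j l => 0) w.
Proof.
by apply: eq_bigr => j _; rewrite (linform_delta _ (ltn_ord j)); do !f_equal; exact: val_inj.
Qed.

Lemma bimeas_decay (a : R) : bimeas (fun u _ : R[i] => (1 + cabs u) `^ a).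
Proof.
move=> dX X u v mu _; apply: (measurableT_comp (measurable_powR a)).
by apply: measurable_funD => //; exact: measurable_cabs.
Qed.

Lemma measurable_decay d q : measurable_fun setT (@decay d q).
Proof.
rewrite (_ : @decay d q = triprod (fun _ u _ => (1 + cabs u) `^ (- (q / d%:R)))
    (fun j l => (j == l)%:R) (fun j l => 0)); last by apply/funext => w; exact: decayE.
by apply: measurable_triprod => j; exact: bimeas_decay.
Qed.

Lemma integral_decay d q : (0 < d)%N -> 2 * d%:R < q ->
  (\int[lebesgueCn R d]_w (decay q w)%:E < +oo)%E.
Proof.
move=> d0 dq; have d0' : 0 < d%:R :> R by rewrite ltr0n.
have qd : 2 < q / d%:R by rewrite ltr_pdivlMr.
have [C C0 hC] := decay_integral qd.
under eq_integral do rewrite decayE.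
apply: (@le_lt_trans _ _ (\prod_(j < d) C)%:E); last exact: ltry.
apply: (integral_triprod_le (c := fun=> C)) => //.
- by move=> j u v; exact: powR_ge0.
- by move=> j; exact: bimeas_decay.
- by move=> j l lj; rewrite gtn_eqF.
move=> j u v jd; rewrite eqxx.
have := hC 1 (- u) ltr01; rewrite expr1n divr1; apply: le_trans.
rewrite le_eqVlt; apply/orP; left; apply/eqP; apply: eq_integral => x _.
by rewrite !mul1r opprK.
Qed.

Lemma decay_ge d q (w : d.-tuple plane) (W : R) : (0 < d)%N -> 0 <= q -> 0 <= W ->
  (forall j, cabs (toC (tnth w j)) <= W) -> (1 + W) `^ (- q) <= decay q w.
Proof.
move=> d0 q0 W0 hW; have W1 : 0 < 1 + W by rewrite ltr_pwDl.
have d0' : d%:R != 0 :> R by rewrite pnatr_eq0 -lt0n.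
have -> : (1 + W) `^ (- q) = \prod_(j < d) (1 + W) `^ (- (q / d%:R)).
  rewrite (powR_sum d (fun=> - (q / d%:R)) W1) sumr_const card_ord.
  by rewrite -[_ *+ d]mulr_natr mulNr divfK.
apply: ler_prod => j _; rewrite powR_ge0/=; apply: powRN_le.
- by rewrite divr_ge0.
- by rewrite ltr_pwDl.
- by apply: lerD => //; exact: hW.
Qed.

Lemma coef_Pw d k (w : d.-tuple plane) (j : 'I_d) :
  (forall l, (l < d)%N -> k l.+1 = k j.+1 -> l = j) ->
  (Pw k w)`_(k j.+1) = toC (tnth w j).
Proof.
move=> inj; rewrite /Pw coef_sum (bigD1 j)//= coefCM coefXn eqxx mulr1 big1 ?addr0//.
move=> l lj; rewrite coefCM coefXn; case: eqP => [e|]; last by rewrite mulr0.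
by move: lj; rewrite -val_eqE /= (inj l (ltn_ord l)) ?eqxx.
Qed.

Lemma size_Pw d k n (w : d.-tuple plane) :
  (forall j, (j < d)%N -> (k j.+1 <= n)%N) -> (size (Pw k w) <= n.+1)%N.
Proof.
move=> kn; apply: leq_trans (size_sum _ _ _) _; apply/bigmax_leqP => j _.
rewrite mul_polyC; apply: leq_trans (size_scale_leq _ _) _.
by rewrite size_polyXn ltnS kn.
Qed.

Lemma extension_powR_integrable d (k : nat -> nat) n (i0 : nat) (b tau r q : R) phi :
  Cc_oo_disk phi -> (0 < d)%N ->
  (forall j, (j < d)%N -> (0 < k j.+1)%N) ->
  (forall l j, (l < j)%N -> (j < d)%N -> (k l.+1 < k j.+1)%N) ->
  2 < b -> 0 < tau < 1 ->
  ((i0 < d)%N -> (1 < k i0.+1)%N /\ forall l, (l < d)%N -> k l.+1 <> (k i0.+1).-1) ->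
  (forall j, (j < d)%N -> (k j.+1 <= n.+1)%N) ->
  1 <= r < 2 -> 2 * d%:R < q -> 2 + majexp d k i0 b tau <= r * q ->
  (\int[lebesgueCn R d]_w (cabs (extension k phi (fun=> 1) w) `^ q)%:E < +oo)%E.
Proof.
move=> hphi d0 hk0 hk hb htau hi0 hn r12 dq hq.
have [C C0 hC] := osc_integral_cases hphi n r12.
have [Cm Cm0 hm] := integral_majorant hb htau hi0.
have q0 : 0 <= q by apply: le_trans (ltW dq); rewrite mulr_ge0.
(* The constant of [coef_recentre] for polynomials of size at most n + 2. *)
pose K : R := n.+3%:R * 2 ^+ n.+3.
have K1 : 1 <= K by rewrite mulr_ege1 ?ler1n// exprn_ege1// ler1n.
have [c c0 hc] := majorant_ge hk0 hk hb htau hi0 K1.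
have mE : measurable_fun setT (fun w : d.-tuple plane => cabs (extension k phi (fun=> 1) w)).
  by apply: measurable_cabs; apply: cmeas_extension; exact: cmeas_Cc_oo.
have mD3 : measurable (disk (0 : R[i]) 3) by exact: measurable_disk.
(* Radius 3 accommodates every disk of radius 1/s <= 1 around a point zeta with |zeta| <= 2. *)
pose F (wp : d.-tuple plane * plane) : \bar R :=
  (majorant k i0 b tau (toC wp.2) wp.1 * \1_(disk (0%R : R[i]) 3%R) wp.2)%:E.
have mF : measurable_fun setT F.
  apply/measurable_EFinP; apply: measurable_funM.
    exact: measurable_majorant.
  by apply: (@measurableT_comp _ _ _ _ _ _ (\1_(disk (0 : R[i]) 3) : plane -> R) _ snd).
have F0 wp : (0 <= F wp)%E by rewrite lee_fin mulr_ge0// majorant_ge0.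
pose I w : \bar R := (\int[@lebesgueC R]_p F (w, p))%E.
have mI : measurable_fun setT I by exact: measurable_fun_fubini_tonelli_F.
have I0 w : (0 <= I w)%E by exact: integral_ge0.
have Cq0 : 0 <= C `^ q by exact: powR_ge0.
have key w : ((cabs (extension k phi (fun=> 1) w) `^ q)%:E <=
    (C `^ q)%:E * (decay q w)%:E + (C `^ q / c)%:E * I w)%E.
  have inj (j : 'I_d) : forall l, (l < d)%N -> k l.+1 = k j.+1 -> l = j.
    move=> l ld e; case: (ltngtP l j) => // h.
      by have := hk _ _ h (ltn_ord j); rewrite e ltnn.
    by have := hk _ _ h ld; rewrite e ltnn.
  have sP : (size (Pw k w) <= n.+2)%N by exact: size_Pw.
  rewrite extensionE; case: (hC (Pw k w) sP) => [hE|[zeta [s [z2 s1 hE hcf]]]].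
    apply: (@le_trans _ _ ((C `^ q)%:E * (decay q w)%:E)%E); last first.
      by rewrite leeDl// mule_ge0// lee_fin divr_ge0// ltW.
    rewrite -EFinM lee_fin; set W := l1norm _ in hE.
    have W0 : 0 <= W by exact: l1norm_ge0.
    apply: (@le_trans _ _ ((C / (1 + W)) `^ q)).
      by apply: ge0_ler_powR; rewrite ?nnegrE// divr_ge0 ?addr_ge0// ltW.
    rewrite powRM ?invr_ge0 ?addr_ge0 ?(ltW C0)// ler_wpM2l//.
    rewrite -powR_inv1 ?addr_ge0// -powRrM mulN1r; apply: decay_ge => // j.
    rewrite -(coef_Pw w (inj j)) /W l1normE.
    have := nrm_term (Pw k w)^`() (k j.+1).-1 ler01; rewrite expr1n mulr1.
    apply: le_trans; rewrite coef_deriv prednK ?hk0//.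
    by rewrite -mulr_natl cabsM cabs_nat ler_peMl// ler1n hk0.
  apply: (@le_trans _ _ ((C `^ q / c)%:E * I w)%E); last first.
    by rewrite leeDr// mule_ge0// lee_fin decay_ge0.
  have s0 : 0 < s by exact: lt_le_trans s1.
  (* The last factor is a lower bound for the area of the disk of radius 1/s around zeta, on which
     the majorant is at least c s^(- majexp); the hypothesis on r q gives s^(- r q) <= s^(-2 -
     majexp). *)
  apply: (@le_trans _ _ ((C `^ q / c)%:E * (c * s `^ (- majexp d k i0 b tau) * (s^-1) ^+ 2)%:E)%E).
    rewrite -EFinM lee_fin.
    rewrite (_ : C `^ q / c * _ = C `^ q * (s `^ (- majexp d k i0 b tau) * s^-1 ^+ 2)); last first.
      by rewrite !mulrA divfK ?gt_eqF.
    apply: (@le_trans _ _ ((C * s `^ (- r)) `^ q)).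
      by apply: ge0_ler_powR; rewrite ?nnegrE// mulr_ge0 ?powR_ge0// ltW.
    rewrite powRM ?powR_ge0 ?(ltW C0)// ler_wpM2l//.
    rewrite -powRrM exprVn -powR_invn ?(ltW s0)// -powRD_gt0//.
    by apply: ler_powR => //; lra.
  rewrite lee_wpmul2l ?lee_fin ?divr_ge0 ?(ltW c0)//.
  have sV0 : 0 <= s^-1 by rewrite invr_ge0 ltW.
  have sV1 : s^-1 <= 1 by rewrite invf_le1.
  apply: (@le_trans _ _ (\int[@lebesgueC R]_p
      ((c * s `^ (- majexp d k i0 b tau))%:E * (\1_(disk zeta s^-1) p)%:E))%E).
    rewrite ge0_integralZl_EFin//; last 2 first.
    - by apply/measurable_EFinP; apply: measurable_indic; exact: measurable_disk.
    - by rewrite mulr_ge0 ?powR_ge0// ltW.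
    rewrite integral_indic//; last exact: measurable_disk.
    rewrite setIT EFinM lee_wpmul2l ?lee_fin ?mulr_ge0 ?powR_ge0 ?(ltW c0)//.
    exact: lebesgueC_disk_ge.
  apply: ge0_le_integral => //.
  - by move=> p _; rewrite -EFinM lee_fin !mulr_ge0 ?powR_ge0// ltW.
  - apply: measurable_funeM; apply/measurable_EFinP; apply: measurable_indic.
    exact: measurable_disk.
  - exact: (measurableT_comp mF).
  move=> p _; rewrite -EFinM lee_fin indicE.
  have [hp|hp] := pselect (disk zeta s^-1 p); last first.
    by rewrite memNset// mulr0 mulr_ge0// majorant_ge0.
  rewrite mem_set// mulr1 indicE mem_set ?mulr1; last first.
    rewrite disk0E -[X in cabs X](subrK zeta (toC p)).
    by apply: le_trans (cabsD _ _) _; apply: le_trans (lerD hp z2) _; lra.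
  apply: hc => // i i0'; apply: (coef_recentre s0 sP hcf) => //.
apply: (@le_lt_trans _ _ (\int[lebesgueCn R d]_w
   ((C `^ q)%:E * (decay q w)%:E + (C `^ q / c)%:E * I w))%E).
  apply: ge0_le_integral => //.
  - by move=> w _; rewrite lee_fin powR_ge0.
  - apply/measurable_EFinP; apply: (measurableT_comp (measurable_powR q)).
    exact: mE.
  - apply: emeasurable_funD; apply: measurable_funeM => //.
    by apply/measurable_EFinP; exact: measurable_decay.
rewrite ge0_integralD//; last 4 first.
- by move=> w _; rewrite -EFinM lee_fin mulr_ge0// decay_ge0.
- by apply: measurable_funeM; apply/measurable_EFinP; exact: measurable_decay.
- by move=> w _; rewrite mule_ge0// lee_fin divr_ge0// ltW.
- exact: measurable_funeM.
apply: lte_add_pinfty.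
  rewrite ge0_integralZl_EFin//; last 2 first.
  - by move=> w _; rewrite lee_fin decay_ge0.
  - by apply/measurable_EFinP; exact: measurable_decay.
  apply: lte_mul_pinfty => //; exact: integral_decay.
rewrite ge0_integralZl_EFin//; last by rewrite divr_ge0// ltW.
apply: lte_mul_pinfty; rewrite ?lee_fin ?divr_ge0 ?(ltW c0)//.
rewrite /I tonelli_lebesgueCn//.
have [Cs Cs0 hs] := @integral_singular R (2 * tau) ltac:(case/andP: htau => ? ?; apply/andP; split; lra).
have sg0 p := singular_ge0 (2 * tau) (0 : R[i]) p.
have msg := measurable_singular (2 * tau) (0 : R[i]).
apply: (@le_lt_trans _ _ (\int[@lebesgueC R]_p
   (Cm%:E * ((\1_(disk (0%R : R[i]) 3%R) p)%:E + singular (2 * tau) 0%R p)))%E).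
  apply: ge0_le_integral => //.
  - by move=> p _; apply: integral_ge0.
  - exact: (measurable_fun_fubini_tonelli_G (m1 := @lebCn R d)).
  - apply: measurable_funeM; apply: emeasurable_funD => //.
    by apply/measurable_EFinP; exact: measurable_indic.
  move=> p _; rewrite /F /= indicE; case: (p \in _).
    under eq_integral do rewrite mulr1.
    exact: hm.
  under eq_integral do rewrite mulr0.
  by rewrite integral0 mule_ge0 ?adde_ge0// lee_fin ltW.
rewrite ge0_integralZl_EFin//; last 3 first.
- by move=> p _; rewrite adde_ge0// lee_fin.
- apply: emeasurable_funD => //; by apply/measurable_EFinP; exact: measurable_indic.
- exact: ltW.
apply: lte_mul_pinfty; rewrite ?lee_fin ?(ltW Cm0)//.
rewrite ge0_integralD//; last first.
  by apply/measurable_EFinP; exact: measurable_indic.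
apply: lte_add_pinfty; last by apply: le_lt_trans (hs 0) _; exact: ltry.
by rewrite integral_indic// setIT; exact: lebesgueC_disk_lty.
Qed.

End Sufficiency.

(** * Membership in L^q as finiteness of an integral *)

Section Lq.
Context {R : realType} {dT} {T : measurableType dT}.
Variable mu : {measure set T -> \bar R}.
Implicit Types f : T -> R[i].

Lemma inLq_fin (q : R) f : 0 < q -> cmeas f ->
  inLq mu q%:E f <-> (\int[mu]_x (cabs (f x) `^ q)%:E < +oo)%E.
Proof.
move=> q0 [mr mi].
have e : 'N[mu]_q%:E[EFin \o (fun x => cabs (f x))]%E =
    ((\int[mu]_x (cabs (f x) `^ q)%:E) `^ q^-1)%E.
  rewrite unlock; congr (_ `^ _)%E; apply: eq_integral => x _ /=.
  by rewrite ger0_norm ?cabs_ge0.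
have I0 : (0 <= \int[mu]_x (cabs (f x) `^ q)%:E)%E.
  by apply: integral_ge0 => x _; rewrite lee_fin powR_ge0.
split=> [[_ _]|h]; last first.
  by split => //; rewrite /finite_norm e poweR_lty.
rewrite /finite_norm e => h; rewrite ltey; apply: contraTN h => /eqP ->.
by rewrite poweRyr ?ltxx// gt_eqF// invr_gt0.
Qed.

Lemma inLq_pinfty f (M : R) : cmeas f -> (forall x, cabs (f x) <= M) -> inLq mu +oo%E f.
Proof.
move=> [mr mi] hM; split => //; rewrite /finite_norm unlock.
case: ifP => _; last exact: ltry.
apply: le_lt_trans (ltry M); apply/ess_sup_inf.ess_supP; apply: aeW => x /=.
by rewrite lee_fin ger0_norm ?cabs_ge0.
Qed.

End Lq.

Lemma sum_double_succ d : ((\sum_(j < d) j.+1).*2 = d * d.+1)%N.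
Proof.
by elim: d => [|d IH]; rewrite ?big_ord0// big_ord_recr/= doubleD IH; lia.
Qed.

(** * Combinatorics of sparse exponents *)

Section SparseExponents.
Variables (d : nat) (k : nat -> nat).
Hypothesis d0 : (0 < d)%N.
Hypothesis hk0 : forall j, (1 <= j <= d)%N -> (0 < k j)%N.
Hypothesis hk : forall j, (1 <= j < d)%N -> (k j < k j.+1)%N.

Lemma exponents_gt0 j : (j < d)%N -> (0 < k j.+1)%N.
Proof. by move=> jd; apply: hk0. Qed.

Lemma exponents_ltn l j : (l < j)%N -> (j < d)%N -> (k l.+1 < k j.+1)%N.
Proof.
elim: j => // j IH; rewrite ltnS leq_eqVlt => /predU1P[->|lj] jd; first exact: hk.
by apply: (ltn_trans (IH lj (ltnW jd))); exact: hk.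
Qed.

Lemma exponents_ge j : (j < d)%N -> (j.+1 <= k j.+1)%N.
Proof.
elim: j => [|j IH] jd; first exact: exponents_gt0.
by apply: leq_ltn_trans (IH (ltnW jd)) _; exact: hk.
Qed.

Hypothesis hK : ((\sum_(j < d) k j.+1).*2 < k d * (k d).+1)%N.

(** If every exponent above 1 had its predecessor among the exponents, they would be 1, ..., d, and
    K would equal k_d (k_d + 1) / 2. *)
Lemma exponents_gap : exists2 i0, (i0 < d)%N &
  (1 < k i0.+1)%N /\ forall l, (l < d)%N -> k l.+1 <> (k i0.+1).-1.
Proof.
apply: contrapT => H.
have H' i : (i < d)%N -> k i.+1 = 1%N \/ exists2 l, (l < d)%N & k l.+1 = (k i.+1).-1.
  move=> id; have [k1|k1] := ltnP 1 (k i.+1); last first.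
    by left; apply/eqP; rewrite eqn_leq k1 exponents_gt0.
  right; apply: contrapT => h; apply: H; exists i => //; split => // l ld e.
  by apply: h; exists l.
have kE j : (j < d)%N -> k j.+1 = j.+1.
  elim: j => [|j IH] jd.
    have [//|[[|l] ld e]] := H' 0%N jd; have := exponents_gt0 jd; first by lia.
    by have := exponents_ltn (ltn0Sn l) ld; lia.
  have jd' := ltnW jd; have [e|[l ld e]] := H' _ jd.
    by have := exponents_ge jd; lia.
  have kj0 := exponents_gt0 jd; have h2 : (k j.+1 < k j.+2)%N by exact: hk.
  have [lj|jl|el] := ltngtP l j.
  - by have := exponents_ltn lj jd'; lia.
  - case: (ltngtP l j.+1) => [|jl'|el]; first by lia.
      by have := exponents_ltn jl' ld; lia.
    by move: e; rewrite el; lia.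
  - by move: e; rewrite el IH//; lia.
have := sum_double_succ d; have e1 : (\sum_(j < d) k j.+1 = \sum_(j < d) j.+1)%N.
  by apply: eq_bigr => j _; exact: kE.
have kd : k d = d by rewrite -(prednK d0) kE// prednK.
by move: hK; rewrite e1 kd; lia.
Qed.

(** Makes the condition q > 2 d of [decay] follow from q > K. The hypothesis on K excludes k_d = d,
    so K >= d (d + 1) / 2 + 1, and this exceeds 2 d by (d - 1) (d - 2) / 2. *)
Lemma double_dim_le_sum : (d.*2 <= \sum_(j < d) k j.+1)%N.
Proof.
have kd : (d <= k d)%N by rewrite -{1 2}(prednK d0) exponents_ge// prednK.
have h : (\sum_(j < d) j.+1 <= \sum_(j < d) k j.+1)%N.
  by apply: leq_sum => j _; exact: exponents_ge.
have := sum_double_succ d; have : (k d = d \/ d < k d)%N by lia.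
case=> [e|kdd]; first by move: hK; rewrite e; lia.
have : (\sum_(j < d) j.+1 < \sum_(j < d) k j.+1)%N.
  move: d0 kdd exponents_ge; case: d => // n _ kn kge.
  rewrite !big_ord_recr/= -addnS leq_add//; apply: leq_sum => j _; apply: kge.
  by rewrite ltnS ltnW.
by move: d0; nia.
Qed.

End SparseExponents.

(** * Choice of the parameters b and r *)

Section SufficiencyThreshold.
Variable R : realType.
Notation plane := (measurableTypeR R * measurableTypeR R)%type.

Lemma majexpE d k i0 (b tau : R) : (i0 < d -> 0 < k i0.+1)%N ->
  majexp d k i0 b tau = b * ((\sum_(j < d) k j.+1)%N%:R - (if (i0 < d)%N then tau else 0)).
Proof.
move=> hk; rewrite /majexp natr_sum.
case: ifPn => [id|id]; last first.
  rewrite subr0 mulr_sumr; apply: eq_bigr => j _; rewrite /expA /expB.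
  have /negbTE -> : (j : nat) != i0 by apply: contra id => /eqP <-.
  by rewrite mulr0 addr0 mulrC.
rewrite (bigD1 (Ordinal id))//= [in RHS](bigD1 (Ordinal id))//= /expA /expB eqxx.
rewrite (eq_bigr (fun j : 'I_d => b * (k j.+1)%:R)); last first.
  move=> j ji; have /negbTE -> : (j : nat) != i0.
    by apply: contra ji => /eqP e; apply/eqP; exact: val_inj.
  by rewrite mulr0 addr0 mulrC.
rewrite -mulr_sumr; have -> : (k i0.+1).-1%:R = (k i0.+1)%:R - 1 :> R.
  by rewrite -subn1 natrB// hk.
ring.
Qed.

Lemma extension_integrable d (k : nat -> nat) (i0 : nat) (tau q : R) phi :
  Cc_oo_disk phi -> (0 < d)%N ->
  (forall j, (j < d)%N -> (0 < k j.+1)%N) ->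
  (forall l j, (l < j)%N -> (j < d)%N -> (k l.+1 < k j.+1)%N) ->
  0 < tau < 1 ->
  ((i0 < d)%N -> (1 < k i0.+1)%N /\ forall l, (l < d)%N -> k l.+1 <> (k i0.+1).-1) ->
  2 * d%:R < q ->
  1 + (\sum_(j < d) k j.+1)%N%:R - (if (i0 < d)%N then tau else 0) < q ->
  (\int[lebesgueCn R d]_w (cabs (extension k phi (fun=> 1) w) `^ q)%:E < +oo)%E.
Proof.
move=> hphi d0 hk0 hk htau hi0 dq hq.
set S : R := (\sum_(j < d) k j.+1)%N%:R in hq; set s := (if _ then _ else _) in hq.
have S0 : 1 <= S.
  by rewrite ler1n (bigD1 (Ordinal d0))//= addn_gt0 hk0.
have s01 : 0 <= s < 1 by rewrite /s; case: ifP; lra.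
pose g : R := q - (1 + S - s); have g0 : 0 < g by rewrite /g; lra.
have q0 : 0 < q by apply: le_lt_trans dq; rewrite mulr_ge0.
have n0 j : (j < d)%N -> (k j.+1 <= (k d).+1)%N.
  move=> jd; have -> : k d = k d.-1.+1 by rewrite prednK.
  case: (ltngtP j d.-1) => [h|h|->]; last exact: leqnSn.
  - by have := hk _ _ h; rewrite prednK// => /(_ (leqnn _)); lia.
  - by move: jd; rewrite -(prednK d0) ltnS leqNgt h.
have gq : g / q * q = g by rewrite divfK// gt_eqF.
have gq1 : g / q <= 1 by rewrite ler_pdivrMr// /g; lra.
have gq0 : 0 < g / q by rewrite divr_gt0.
have gS : g / (S + 1) * (S + 1) = g by rewrite divfK// gt_eqF//; lra.
have gS0 : 0 < g / (S + 1) by rewrite divr_gt0//; lra.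
(* The slack g enters 2 q as 2 g: the excess of b over 2 spends at most g, and the deficit of r
   below 2 spends g. *)
apply: (extension_powR_integrable (n := k d) (i0 := i0) (b := 2 + g / (S + 1)) (tau := tau)
   (r := 2 - g / q)) => //; try lra.
rewrite majexpE; last by move=> /hi0[/ltnW].
rewrite -/S -/s; have : g / (S + 1) * (S - s) <= g / (S + 1) * (S + 1).
  by rewrite ler_wpM2l//; lra.
rewrite gS mulrDl mulrBl gq /g; lra.
Qed.

Lemma extension_inLq d (k : nat -> nat) (i0 : nat) (tau : R) (q : \bar R) phi :
  Cc_oo_disk phi -> (0 < d)%N ->
  (forall j, (j < d)%N -> (0 < k j.+1)%N) ->
  (forall l j, (l < j)%N -> (j < d)%N -> (k l.+1 < k j.+1)%N) ->
  0 < tau < 1 ->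
  ((i0 < d)%N -> (1 < k i0.+1)%N /\ forall l, (l < d)%N -> k l.+1 <> (k i0.+1).-1) ->
  ((2 * d%:R)%:E < q)%E ->
  ((1 + (\sum_(j < d) k j.+1)%N%:R - (if (i0 < d)%N then tau else 0))%:E < q)%E ->
  inLq (lebesgueCn R d) q (@extension R d k phi (fun=> 1)).
Proof.
move=> hphi d0 hk0 hk htau hi0; 
have mE : cmeas (@extension R d k phi (fun=> 1)) by apply: cmeas_extension; exact: cmeas_Cc_oo.
case: q => [q h1 h2|_ _|]; last by rewrite ltNge leNye.
  rewrite !lte_fin in h1 h2; apply/inLq_fin => //.
    by apply: le_lt_trans h1; rewrite mulr_ge0.
  exact: (extension_integrable hphi d0 hk0 hk htau hi0).
have [M M0 hM] := osc_integral_bounds hphi.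
by apply: (@inLq_pinfty _ _ _ _ _ M) => // w; rewrite extensionE; have [] := hM (Pw k w).
Qed.

End SufficiencyThreshold.

(** * Translation invariance in the plane *)

Section Translation.
Variable R : realType.
Notation plane := (measurableTypeR R * measurableTypeR R)%type.

Lemma ge0_integral_addr (b : R) (f : measurableTypeR R -> \bar R) :
  measurable_fun setT f -> (forall x, 0 <= f x)%E ->
  (\int[@lebesgue_measure R]_x f (x + b)%R = \int[@lebesgue_measure R]_x f x)%E.
Proof.
move=> mf f0.
have ms : measurable_fun setT (fun x : measurableTypeR R => x + b : measurableTypeR R).
  exact: measurable_funD.
rewrite (_ : (\int[@lebesgue_measure R]_x f (x + b)%R = \int[pushforward (@lebesgue_measure R) (fun x : measurableTypeR R => x + b : measurableTypeR R)%R]_x f x)%E); last first.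
  by rewrite ge0_integral_pushforward.
apply: eq_measure_integral => A mA _; apply/esym.
pose nu := measure_function_pushforward__canonical__measure_function_Measure (@lebesgue_measure R) ms.
have := @lebesgue_measure_unique R nu; apply => // _ [[u v]] _ <-.
rewrite /nu/= /pushforward.
have -> : (fun x : measurableTypeR R => x + b) @^-1` `]u, v] = `]u - b, v - b]%classic.
  by apply/seteqP; split => x /=; rewrite !in_itv/= ltrBlDr lerBrDr.
rewrite !lebesgue_measure_itv/= !lte_fin ltrBlDr subrK.
by case: ifP => // _; rewrite -!EFinD; congr EFin; ring.
Qed.

Lemma ge0_integral_plane_add (b : plane) (f : plane -> \bar R) :
  measurable_fun setT f -> (forall p, 0 <= f p)%E ->
  (\int[@lebesgueC R]_p f (p.1 + b.1, p.2 + b.2)%R = \int[@lebesgueC R]_p f p)%E.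
Proof.
move=> mf f0.
have mfb : measurable_fun setT (fun p : plane => f (p.1 + b.1, p.2 + b.2)).
  apply: (measurableT_comp mf); apply/measurable_fun_pairP; split => /=.
    by apply: measurable_funD => //; exact: measurable_fst.
  by apply: measurable_funD => //; exact: measurable_snd.
rewrite /lebesgueC fubini_tonelli1// fubini_tonelli1//.
rewrite /fubini_F /=.
under eq_integral => x _.
  rewrite (@ge0_integral_addr b.2 (fun y => f (x + b.1, y)))//; last first.
    by apply: measurableT_comp => //; exact: measurable_pair1.
  over.
rewrite (@ge0_integral_addr b.1 (fun x => \int[@lebesgue_measure R]_y f (x, y))%E)//.
  exact: (@measurable_fun_fubini_tonelli_F _ _ _ _ _ (@lebesgue_measure R) _ mf f0).
by move=> x; exact: integral_ge0.
Qed.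

End Translation.

(** * Integrals of characters over squares *)

Section SquareKernel.
Variable R : realType.
Notation plane := (measurableTypeR R * measurableTypeR R)%type.

(** From 0 < cos 1 = 2 cos(1/2)^2 - 1 and monotonicity of the cosine. *)
Lemma cos_ge_half (y : R) : `|y| <= 2^-1 -> 2^-1 <= cos y.
Proof.
move=> hy; have c1 := @cos1_gt0 R.
have pi1 : 2 <= pi :> R by rewrite pi_ge2.
have e : cos (2^-1 *+ 2) = cos 1 :> R by congr cos; lra.
have h0 : 0 < cos (2^-1 : R) by apply: cos_gt0_pihalf; lra.
have : 2^-1 <= cos (2^-1 : R).
  rewrite cos_mulr2n in e; rewrite leNgt; apply/negP => h; move: e c1 => <-.
  rewrite expr2 -mulr_natr; nra.
move=> /le_trans; apply; rewrite -(cos_norm y).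
by rewrite leNgt ltr_cos ?in_itv/= -?leNgt//; apply/andP; split; have := normr_ge0 y; lra.
Qed.

(* The value at [s = 0] is the continuous one. *)
Definition sinck (A s : R) : R := if s == 0 then 2 * A else 2 * sin (s * A) / s.

Lemma integral_cos_sym (A s th : R) : 0 < A ->
  (\int[@lebesgue_measure R]_(x in `[(- A)%R, A]) (cos (s * x + th))%:E =
   (sinck A s * cos th)%:E)%E.
Proof.
move=> A0; rewrite /sinck; case: eqP => [->|/eqP s0].
  under eq_integral do rewrite mul0r add0r.
  rewrite integral_cst//= lebesgue_measure_itv/= lte_fin gtrN// -EFinD -EFinM.
  by congr EFin; ring.
have dF (x : R) : is_derive x (1 : R) (fun x : R => sin (s * x + th) / s) (cos (s * x + th)).
  have dl : is_derive x (1 : R) (fun x : R => s * x + th) s.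
    by apply: is_derive_eq; rewrite /GRing.scale/=; ring.
  have ds := @is_derive1_comp _ sin (fun x : R => s * x + th) _ _ _ (is_derive_sin (s * x + th)) dl.
  apply: is_derive_eq; rewrite /GRing.scale /=; by field.
have cF := derive_continuous dF.
have cc : continuous ((fun x => cos (s * x + th)) : R^o -> R^o).
  move=> x; apply: (@continuous_comp _ _ _ (fun x : R^o => s * x + th : R^o) (@cos R)).
    apply: cvgD; [apply: cvgM; [exact: cvg_cst|exact: cvg_id]|exact: cvg_cst].
  exact: continuous_cos.
rewrite (@continuous_FTC2 _ _ (fun x => sin (s * x + th) / s))//.
- by rewrite -EFinD; congr EFin; rewrite mulrN !sinD sinN cosN; field.
- by rewrite gtrN.
- exact: continuous_subspaceT.
- split; [by move=> x _; have [] := dF x|by apply: cvg_at_right_filter; exact: cF|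
    by apply: cvg_at_left_filter; exact: cF].
- by move=> x _; rewrite derive1E; apply: derive_val.
Qed.

Lemma continuous_cos_affine (s th : R) :
  continuous ((fun x => cos (s * x + th)) : R^o -> R^o).
Proof.
move=> x; apply: (@continuous_comp _ _ _ (fun x : R^o => s * x + th : R^o) (@cos R)).
  apply: cvgD; [apply: cvgM; [exact: cvg_cst|exact: cvg_id]|exact: cvg_cst].
exact: continuous_cos.
Qed.

Lemma measurable_cos_affine (s th : R) D :
  measurable_fun D ((fun x => cos (s * x + th)) : measurableTypeR R -> R).
Proof.
apply: measurable_funTS; apply: continuous_measurable_fun.
exact: continuous_cos_affine.
Qed.

Lemma sinck_ge (A s : R) : 0 < A -> `|s| * A <= 2^-1 -> A <= sinck A s.
Proof.
move=> A0 sA; rewrite -[sinck A s]mulr1 -[X in _ * X](cos0) -lee_fin -integral_cos_sym//.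
apply: (@le_trans _ _ (\int[@lebesgue_measure R]_(x in `[(- A)%R, A]) (2^-1)%:E)%E).
  rewrite integral_cst//= lebesgue_measure_itv/= lte_fin gtrN// -EFinD -EFinM lee_fin.
  lra.
apply: ge0_le_integral => //.
- by apply/measurable_EFinP; exact: measurable_cos_affine.
move=> x /=; rewrite in_itv/= -ler_norml => xA; rewrite lee_fin cos_ge_half// addr0 normrM.
by apply: le_trans sA; rewrite ler_wpM2l.
Qed.

Lemma sinck_le (A s : R) : 0 < A -> `|sinck A s| <= 2 * A.
Proof.
move=> A0; rewrite -[sinck A s]mulr1 -[X in _ * X](cos0) -lee_fin.
rewrite -[(`|_|%:E)%E]/(`| (sinck A s * cos 0)%:E|)%E -integral_cos_sym//.
apply: le_trans (le_abse_integral _ _ _) _ => //.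
  by apply/measurable_EFinP; exact: measurable_cos_affine.
apply: (@le_trans _ _ (\int[@lebesgue_measure R]_(x in `[(- A)%R, A]) (1%R)%:E)%E).
  apply: ge0_le_integral => //.
  - by apply: measurableT_comp => //; apply/measurable_EFinP; exact: measurable_cos_affine.
  - by move=> x _; rewrite lee_fin ler_norml cos_geN1 cos_le1.
rewrite integral_cst//= lebesgue_measure_itv/= lte_fin gtrN// -EFinD -EFinM lee_fin.
lra.
Qed.

Lemma sinck_decay (A s : R) : `|sinck A s| * `|s| <= 2.
Proof.
rewrite /sinck; case: eqP => [->|/eqP s0]; first by rewrite normr0 mulr0.
rewrite -normrM divfK// normrM ger0_norm// -[leRHS]mulr1 ler_wpM2l//.
exact: sin_max.
Qed.

Definition square (A : R) : set plane := `[(- A)%R, A] `*` `[(- A)%R, A].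

Lemma measurable_square A : measurable (square A).
Proof. exact: measurable_plane_itv. Qed.

Lemma lebesgueC_squareE A : 0 < A -> lebesgueC (square A) = (4 * A ^+ 2)%:E.
Proof.
move=> A0; rewrite /lebesgueC /square product_measure1E//= lebesgue_measure_itv/=.
by rewrite lte_fin gtrN// -EFinD -EFinM; congr EFin; ring.
Qed.

Lemma integral_cos_square (A s t th : R) : 0 < A ->
  (\int[@lebesgueC R]_(p in square A) (cos (s * p.1 + t * p.2 + th))%:E =
   (sinck A s * sinck A t * cos th)%:E)%E.
Proof.
move=> A0; pose f (p : plane) := cos (s * p.1 + t * p.2 + th).
have mf : measurable_fun setT f.
  have mc : measurable_fun setT (@cos R) by apply: continuous_measurable_fun; exact: continuous_cos.
  apply: (measurableT_comp mc).
  apply: measurable_funD => //; apply: measurable_funD.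
    by apply: measurable_funM => //; exact: measurable_fst.
  by apply: measurable_funM => //; exact: measurable_snd.
have mQ := measurable_square A.
have fi : (@lebesgueC R).-integrable setT ((EFin \o f) \_ (square A)).
  rewrite -integrable_mkcond//; apply: measurable_bounded_integrable => //.
  - by have := ltry (4 * A ^+ 2); rewrite -lebesgueC_squareE.
  - exact: measurable_funTS.
  - exists 1; split; first exact: num_real.
    by move=> y y1 p _; apply: le_trans (ltW y1); rewrite ler_norml cos_geN1 cos_le1.
rewrite integral_mkcond /lebesgueC -(integral12_prod_meas1 fi) /=.
transitivity (\int[@lebesgue_measure R]_(x in `[(- A)%R, A])
    ((sinck A t)%:E * (cos (s * x + th))%:E))%E.
  rewrite [RHS]integral_mkcond; apply: eq_integral => x _.
  rewrite [RHS]patchE; case: ifPn => [xA|xA].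
    rewrite -EFinM -integral_cos_sym// [RHS]integral_mkcond.
    apply: eq_integral => y _; rewrite !patchE.
    have -> : ((x, y) \in square A) = (y \in `[(- A)%R, A]%classic).
      apply/idP/idP; rewrite !inE /square/=; first by case.
      by move=> ?; split => //; rewrite inE in xA.
    by case: ifP => // _; congr (_ %:E); rewrite /f/=; congr cos; ring.
  apply: integral0_eq => y _; rewrite patchE ifF//; apply: contraNF xA.
  by rewrite !inE => -[].
rewrite integralZl//; first by rewrite integral_cos_sym// -EFinM; congr EFin; ring.
apply: measurable_bounded_integrable => //.
- have : (@lebesgue_measure R `[(- A)%R, A] < +oo)%E.
    by rewrite lebesgue_measure_itv/=; case: ifP => _; rewrite ?ltry.
  exact.
- exact: measurable_cos_affine.
- exists 1; split; first exact: num_real.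
  by move=> y y1 p _; apply: le_trans (ltW y1); rewrite ler_norml cos_geN1 cos_le1.
Qed.

End SquareKernel.

(** * Averaging an oscillatory integral over one coefficient *)

Section Averaging.
Variable R : realType.
Notation plane := (measurableTypeR R * measurableTypeR R)%type.
Variables (H v : plane -> R[i]) (M A : R).
Implicit Types (W : plane -> R) (N : R).
Hypotheses (mH : cmeas H) (mv : cmeas v).
Hypothesis HM : forall p, cabs (H p) <= M.
Hypothesis H0 : forall p, 1 < cabs (toC p) -> H p = 0.
Hypothesis A0 : 0 < A.

Definition amp (c : R[i]) (z : plane) : R := complex.Re (H z * echar (c * v z)).

(** The real part of the oscillatory integral with amplitude [H], as a function of the coefficient c
    of [v]; the weight [W] collects the kernels created by successive averages. *)
Definition wavg (W : plane -> R) (c : R[i]) : R :=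
  (\int[@lebesgueC R]_z (amp c z * W z))%R.

(** The integral of the character of p v(z) over p in the square: p.1 and p.2 are paired with Re v +
    Im v and Re v - Im v. It is real because the square is symmetric. *)
Definition sqker (z : plane) : R :=
  sinck A (2 * pi * (complex.Re (v z) + complex.Im (v z))) *
  sinck A (2 * pi * (complex.Re (v z) - complex.Im (v z))).

Lemma amp_le c z : `|amp c z| <= M.
Proof.
by apply: le_trans (Re_cabs _) _; rewrite cabsM cabs_echar mulr1.
Qed.

Lemma measurable_sinck : measurable_fun setT (sinck A : measurableTypeR R -> R).
Proof.
rewrite /sinck; apply: measurable_fun_ifT => //.
- by apply: measurable_fun_eqr => //.
- have -> : (fun t => 2 * sin (t * A) / t) = (fun t => 2 * sin (t * A) * (t * (t ^+ 2)^-1)).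
    apply/funext => t; have [->|t0] := eqVneq t 0; last by field.
    by rewrite !mul0r invr0.
  apply: measurable_funM; last first.
    apply: measurable_funM => //; apply: measurable_inv_ge0 => [t|]; first exact: sqr_ge0.
    exact: measurable_funX.
  apply: measurable_funM => //.
  have ms : measurable_fun setT (@sin R) by apply: continuous_measurable_fun; exact: continuous_sin.
  by apply: (measurableT_comp ms); exact: measurable_funM.
Qed.

Lemma measurable_sqker : measurable_fun setT sqker.
Proof.
have [m1 m2] := mv.
by apply: measurable_funM; apply: (measurableT_comp measurable_sinck);
  apply: measurable_funM => //; [exact: measurable_funD|exact: measurable_funB].
Qed.

Lemma sqker_le z : `|sqker z| <= 4 * A ^+ 2.
Proof.
rewrite normrM (_ : 4 * A ^+ 2 = (2 * A) * (2 * A)); last by ring.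
by apply: ler_pM => //; exact: sinck_le.
Qed.

Lemma bsupp_amp W N c : measurable_fun setT W -> (forall p, `|W p| <= N) ->
  bsupp (M * N) (fun z => amp c z * W z).
Proof.
move=> mW WN; split.
- apply: measurable_funM => //.
  by have [] := cmeasM mH (cmeas_echar (cmeasM (cmeas_cst c) mv)).
- by move=> p; rewrite normrM; apply: ler_pM => //; exact: amp_le.
- by move=> p p1; rewrite /amp H0// mul0r mul0r.
Qed.

Lemma wavgE W N c : measurable_fun setT W -> (forall p, `|W p| <= N) ->
  ((wavg W c)%:E = \int[@lebesgueC R]_z (amp c z * W z)%:E)%E.
Proof.
move=> mW WN; rewrite /wavg /Rintegral fineK//.
by apply: integrable_fin_num => //; exact: (bsupp_integrable (bsupp_amp c mW WN)).
Qed.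

Lemma ampD c (p z : plane) : amp (c + toC p) z =
  complex.Re (H z * echar (c * v z)) *
    cos (2 * pi * (complex.Re (v z) + complex.Im (v z)) * p.1 +
         2 * pi * (complex.Re (v z) - complex.Im (v z)) * p.2 + 0) +
  complex.Im (H z * echar (c * v z)) *
    cos (2 * pi * (complex.Re (v z) + complex.Im (v z)) * p.1 +
         2 * pi * (complex.Re (v z) - complex.Im (v z)) * p.2 + pi / 2).
Proof.
rewrite /amp mulrDl echarD mulrA ReCM cosDpihalf addr0 mulrN; congr (_ * _ - _ * _).
  rewrite echarE /=; congr cos; rewrite ReCM ImCM /=; ring.
rewrite echarE /=; congr sin; rewrite ReCM ImCM /=; ring.
Qed.

Lemma measurable_amp2 dX (X : measurableType dX) (c : X -> R[i]) (z : X -> plane) :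
  cmeas c -> measurable_fun setT z -> measurable_fun setT (fun x => amp (c x) (z x)).
Proof.
move=> mc mz.
by have [] := cmeasM (cmeas_comp mH mz) (cmeas_echar (cmeasM mc (cmeas_comp mv mz))).
Qed.

Lemma integral_amp_square c z :
  (\int[@lebesgueC R]_(p in square A) (amp (c + toC p) z)%:E = (amp c z * sqker z)%:E)%E.
Proof.
under eq_integral do rewrite ampD EFinD EFinM [X in (_ + X)%E]EFinM.
have mQ := measurable_square A.
have ic th : (@lebesgueC R).-integrable (square A) (fun p : plane =>
    (cos (2 * pi * (complex.Re (v z) + complex.Im (v z)) * p.1 +
         2 * pi * (complex.Re (v z) - complex.Im (v z)) * p.2 + th))%:E).
  apply: measurable_bounded_integrable => //.
  - by have := ltry (4 * A ^+ 2); rewrite -lebesgueC_squareE.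
  - apply: measurable_funTS.
    have mc : measurable_fun setT (@cos R) by apply: continuous_measurable_fun; exact: continuous_cos.
    apply: (measurableT_comp mc).
    apply: measurable_funD => //; apply: measurable_funD.
      by apply: measurable_funM => //; exact: measurable_fst.
    by apply: measurable_funM => //; exact: measurable_snd.
  - exists 1; split; first exact: num_real.
    by move=> y y1 p _; apply: le_trans (ltW y1); rewrite ler_norml cos_geN1 cos_le1.
rewrite integralD//; [|exact: integrableZl|exact: integrableZl].
rewrite !integralZl// !integral_cos_square// cos0 cos_pihalf -!EFinM -EFinD; congr EFin.
rewrite /amp /sqker; ring.
Qed.

(** By Fubini the character is integrated over the coefficient first, so integrating over one square
    inserts one more factor [sqker]. *)
Lemma wavg_step W N c : measurable_fun setT W -> (forall p, `|W p| <= N) ->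
  (\int[@lebesgueC R]_(p in square A) (wavg W (c + toC p))%:E =
   (wavg (fun z => W z * sqker z) c)%:E)%E.
Proof.
move=> mW WN.
have N0 : 0 <= N by apply: le_trans (WN (0, 0)).
have M0 : 0 <= M by apply: le_trans (HM (0, 0)); exact: cabs_ge0.
have mQ := measurable_square A.
have mD := measurable_disk (0 : R[i]) 1.
pose f (pz : plane * plane) := amp (c + toC pz.1) pz.2 * W pz.2.
have mf : measurable_fun setT f.
  apply: measurable_funM; last by apply: (measurableT_comp mW); exact: measurable_snd.
  apply: measurable_amp2; last exact: measurable_snd.
  apply: cmeasD; first exact: cmeas_cst.
  by apply: cmeas_comp; [exact: cmeas_toC|exact: measurable_fst].
have mQD : measurable (square A `*` disk (0 : R[i]) 1) by exact: measurableX.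
have fi : ((@lebesgueC R) \x (@lebesgueC R))%E.-integrable setT
    ((EFin \o f) \_ (square A `*` disk (0 : R[i]) 1)).
  rewrite -integrable_mkcond//; apply: measurable_bounded_integrable => //.
  - have : ((@lebesgueC R \x @lebesgueC R) (square A `*` disk (0%R : R[i]) 1%R) < +oo)%E.
      rewrite product_measure1E//= lebesgueC_squareE//.
      apply: lte_mul_pinfty => //; last exact: lebesgueC_disk_lty.
      by rewrite lee_fin mulr_ge0// sqr_ge0.
    exact.
  - exact: measurable_funTS.
  - exists (M * N); split; first exact: num_real.
    move=> y y1 p _; apply: le_trans (ltW y1).
    by rewrite normrM; apply: ler_pM => //; exact: amp_le.
rewrite integral_mkcond.
transitivity (\int[@lebesgueC R]_p \int[@lebesgueC R]_z
    ((EFin \o f) \_ (square A `*` disk (0%R : R[i]) 1%R)) (p, z))%E.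
  apply: eq_integral => p _; rewrite patchE; case: ifPn => pA.
    rewrite (wavgE _ mW WN); apply: eq_integral => z _; rewrite patchE; case: ifPn => // h.
    have [z1|z1] := leP (cabs (toC z)) 1.
      case/negP: h; rewrite inE /square/=; split; first by rewrite inE in pA.
      by rewrite disk0E.
    by rewrite /amp H0// mul0r mul0r.
  rewrite integral0_eq// => z _; rewrite patchE ifF//; apply: contraNF pA.
  by rewrite !inE => -[].
have /= -> := Fubini fi.
rewrite (@wavgE _ (N * (4 * A ^+ 2))); last 2 first.
- exact: measurable_funM mW measurable_sqker.
- by move=> p; rewrite normrM; apply: ler_pM => //; exact: sqker_le.
apply: eq_integral => z _.
have [z1|z1] := leP (cabs (toC z)) 1; last first.
  rewrite /amp H0// !mul0r integral0_eq// => p _; rewrite patchE; case: ifPn => //.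
  by rewrite inE => -[_] /=; rewrite disk0E leNgt z1.
rewrite (mulrC (W z)) mulrA EFinM -integral_amp_square muleC -integralZl//; last first.
  apply: measurable_bounded_integrable => //.
  - by have := ltry (4 * A ^+ 2); rewrite -lebesgueC_squareE.
  - apply: measurable_funTS; apply: measurable_amp2 => //.
    by apply: cmeasD; [exact: cmeas_cst|exact: cmeas_toC].
  - exists M; split; first exact: num_real.
    by move=> y y1 p _; apply: le_trans (ltW y1); exact: amp_le.
rewrite [RHS]integral_mkcond; apply: eq_integral => p _; rewrite !patchE.
have -> : ((p, z) \in square A `*` disk (0 : R[i]) 1) = (p \in square A).
  apply/idP/idP; rewrite !inE /=; first by case.
  by move=> ?; split => //; rewrite disk0E.
by case: ifP => // _; rewrite -EFinM /= /f/= mulrC.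
Qed.

Lemma measurable_wavg W : measurable_fun setT W ->
  forall c, measurable_fun setT (fun p : plane => wavg W (c + toC p)).
Proof.
move=> mW c.
apply: (@measurable_Rintegral_param _ _ _ (fun pz : plane * plane =>
  amp (c + toC pz.1) pz.2 * W pz.2)).
apply: measurable_funM; last by apply: (measurableT_comp mW); exact: measurable_snd.
apply: measurable_amp2; last exact: measurable_snd.
apply: cmeasD; first exact: cmeas_cst.
by apply: cmeas_comp; [exact: cmeas_toC|exact: measurable_fst].
Qed.

Definition incube (B : R) (c : R[i]) := `|complex.Re c| <= B /\ `|complex.Im c| <= B.

Lemma wavg_step_le W N (B J : R) : measurable_fun setT W -> (forall p, `|W p| <= N) ->
  (forall c, incube (B + A) c -> `|wavg W c| <= J) ->
  forall c, incube B c -> `|wavg (fun z => W z * sqker z) c| <= 4 * A ^+ 2 * J.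
Proof.
move=> mW WN hJ c [cr ci]; have mQ := measurable_square A.
rewrite -lee_fin -[(`|_|%:E)%E]/(`|(wavg (fun z => W z * sqker z) c)%:E|)%E -(wavg_step c mW WN).
have mw := measurable_wavg mW c.
apply: le_trans (le_abse_integral _ _ _) _ => //.
  by apply/measurable_EFinP; exact: measurable_funTS.
apply: (@le_trans _ _ (\int[@lebesgueC R]_(p in square A) J%:E)%E).
  apply: ge0_le_integral => //.
  - by apply: measurableT_comp => //; apply/measurable_EFinP; exact: measurable_funTS.
  - move=> p [] /=; rewrite !in_itv/= -!ler_norml => p1 p2; rewrite lee_fin; apply: hJ.
    by split; rewrite ?ReCD ?ImCD; apply: le_trans (ler_normD _ _) _; exact: lerD.
by rewrite integral_cst//= lebesgueC_squareE// -EFinM mulrC.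
Qed.

End Averaging.

(** * Upper bound for the fourfold average, and size of the kernel *)

Section AveragingUpper.
Variable R : realType.
Notation plane := (measurableTypeR R * measurableTypeR R)%type.
Variables (H v : plane -> R[i]) (M A : R).
Hypotheses (mH : cmeas H) (mv : cmeas v).
Hypothesis HM : forall p, cabs (H p) <= M.
Hypothesis H0 : forall p, 1 < cabs (toC p) -> H p = 0.
Hypothesis A0 : 0 < A.

Local Notation avg1 := (wavg H v (fun=> 1)).

(** Turns an L^1 bound into a pointwise one: a square of half-side A centred in the cube of
    half-side 3 A lies in the cube of half-side 4 A, hence in the disk of radius 8 A. *)
Lemma wavg_first (J : R) :
  (\int[@lebesgueC R]_p (\1_(disk (0%R : R[i]) (8 * A)) p * `|avg1 (toC p)|)%:E <= J%:E)%E ->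
  forall c, incube (3 * A) c -> `|wavg H v (fun z => 1 * sqker v A z) c| <= J.
Proof.
move=> hJ c [cr ci].
have m1 : measurable_fun setT ((fun=> 1) : plane -> R) by exact: measurable_cst.
have b1 (p : plane) : `|(fun=> 1 : R) p| <= 1 by rewrite normr1.
have mw := measurable_wavg mH mv m1.
have mQ := @measurable_square R A.
have m0 : measurable_fun setT (fun p : plane => avg1 (toC p)).
  by have := mw 0; under eq_fun do rewrite add0r.
rewrite -lee_fin -[(`|_|%:E)%E]/(`|(wavg H v (fun z => 1 * sqker v A z) c)%:E|)%E.
rewrite -(wavg_step mH mv HM H0 A0 c m1 b1).
apply: le_trans (le_abse_integral _ _ _) _ => //.
  by apply/measurable_EFinP; exact: measurable_funTS.
apply: le_trans hJ.
have [b hb] := toC_surj c.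
pose f (p : plane) : \bar R := (\1_(disk (0%R : R[i]) (8 * A)) p * `|avg1 (toC p)|)%:E.
have mf : measurable_fun setT f.
  apply/measurable_EFinP; apply: measurable_funM; last exact: measurableT_comp.
  by apply: measurable_indic; exact: measurable_disk.
rewrite -/f -(ge0_integral_plane_add b mf); last by move=> p; rewrite lee_fin mulr_ge0.
rewrite integral_mkcond; apply: ge0_le_integral => //.
- by move=> p _; rewrite patchE; case: ifP.
- apply/(measurable_restrictT _ _).1 => //.
  by apply: measurableT_comp => //; apply/measurable_EFinP; exact: measurable_funTS.
- apply: (measurableT_comp mf); apply/measurable_fun_pairP; split => /=.
    by apply: measurable_funD => //; exact: measurable_fst.
  by apply: measurable_funD => //; exact: measurable_snd.
move=> p _; rewrite patchE; case: ifPn => [|_]; last by rewrite lee_fin mulr_ge0.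
have e : toC (p.1 + b.1, p.2 + b.2) = c + toC p :> R[i].
  by rewrite -hb /toC; simpc; rewrite (addrC p.1) (addrC p.2).
rewrite inE => -[] /=; rewrite !in_itv/= -!ler_norml => p1 p2.
rewrite /f indicE mem_set ?mul1r ?e// disk0E e.
apply: le_trans (cabs_ReIm _) _; rewrite ReCD ImCD /=.
rewrite (_ : 8 * A = (3 * A + A) + (3 * A + A)); last by ring.
by apply: lerD; apply: le_trans (ler_normD _ _) _; exact: lerD.
Qed.

(** The first average gives a pointwise bound on the cube of half-side 3 A. Each of three further
    averages shrinks the half-side by A and costs the area 4 A^2, hence 64 A^6. *)
Lemma wavg_fourth_le (J : R) :
  (\int[@lebesgueC R]_p (\1_(disk (0%R : R[i]) (8 * A)) p * `|avg1 (toC p)|)%:E <= J%:E)%E ->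
  `|wavg H v (fun z => sqker v A z ^+ 4) 0| <= 64 * A ^+ 6 * J.
Proof.
move=> /wavg_first h1.
have mq := measurable_sqker A mv.
have step (W : plane -> R) N B J' := @wavg_step_le _ H v M A mH mv HM H0 A0 W N B J'.
pose q z := sqker v A z.
have qN z : `|q z| <= 4 * A ^+ 2 by exact: sqker_le.
have m1 : measurable_fun setT (fun z => 1 * q z) by apply: measurable_funM.
have N1 z : `|1 * q z| <= 1 * (4 * A ^+ 2) by rewrite normrM normr1 !mul1r.
have m2 : measurable_fun setT (fun z => 1 * q z * q z) by apply: measurable_funM.
have N2 z : `|1 * q z * q z| <= 1 * (4 * A ^+ 2) * (4 * A ^+ 2) by rewrite normrM; apply: ler_pM.
have m3 : measurable_fun setT (fun z => 1 * q z * q z * q z) by apply: measurable_funM.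
have N3 z : `|1 * q z * q z * q z| <= 1 * (4 * A ^+ 2) * (4 * A ^+ 2) * (4 * A ^+ 2).
  by rewrite normrM; apply: ler_pM.
have h2 := step _ _ (2 * A) J m1 N1.
have h3 := step _ _ A (4 * A ^+ 2 * J) m2 N2.
have h4 := step _ _ 0 (4 * A ^+ 2 * (4 * A ^+ 2 * J)) m3 N3.
have -> : (fun z => sqker v A z ^+ 4) = (fun z => 1 * q z * q z * q z * q z).
  by apply/funext => z; rewrite /q; ring.
have -> : 64 * A ^+ 6 * J = 4 * A ^+ 2 * (4 * A ^+ 2 * (4 * A ^+ 2 * J)) by ring.
apply: h4; last by split; rewrite normr0.
rewrite add0r; apply: h3; rewrite (_ : A + A = 2 * A); last by ring.
by apply: h2; rewrite (_ : 2 * A + A = 3 * A); last by ring.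
Qed.

(** The larger of |x + y| and |x - y| is |x| + |y|, at least |v|, so one of the two sinc factors
    decays in |v|; the other is at most 2 A. *)
Lemma sqker_decay z : `|sqker v A z| * cabs (v z) <= 4 * A.
Proof.
rewrite /sqker normrM; set s := 2 * pi * _; set t := 2 * pi * _.
have pi2 := @pi_ge2 R.
have [hs|ht] : cabs (v z) <= `|s| \/ cabs (v z) <= `|t|.
  have h := cabs_ReIm (v z); set x := complex.Re _ in s t h *; set y := complex.Im _ in s t h *.
  have hv : cabs (v z) <= `|x + y| \/ cabs (v z) <= `|x - y|.
    have nn (u : R) : u <= `|u| /\ - u <= `|u| by split; rewrite ?ler_norm// -normrN ler_norm.
    have [h1 h2] := nn (x + y); have [h3 h4] := nn (x - y).
    have [x0|x0] := leP 0 x; have [y0|y0] := leP 0 y.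
    - by left; apply: le_trans h _; rewrite !ger0_norm//; lra.
    - by right; apply: le_trans h _; rewrite (ger0_norm x0) (ltr0_norm y0); lra.
    - by right; apply: le_trans h _; rewrite (ltr0_norm x0) (ger0_norm y0); lra.
    - by left; apply: le_trans h _; rewrite (ltr0_norm x0) (ltr0_norm y0); lra.
  have w (u : R) : `|u| <= `|2 * pi * u|.
    by rewrite [leRHS]normrM ler_peMl// ger0_norm ?mulr_ge0//; lra.
  by case: hv => h'; [left|right]; apply: le_trans h' (w _).
- apply: (@le_trans _ _ ((`|sinck A s| * `|s|) * `|sinck A t|)).
    by rewrite mulrAC ler_wpM2r// ler_wpM2l.
  rewrite (_ : 4 * A = 2 * (2 * A)); last by ring.
  by apply: ler_pM => //; [exact: sinck_decay|exact: sinck_le].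
- apply: (@le_trans _ _ (`|sinck A s| * (`|sinck A t| * `|t|))).
    by rewrite -mulrA !ler_wpM2l.
  rewrite (_ : 4 * A = (2 * A) * 2); last by ring.
  by apply: ler_pM => //; [exact: sinck_le|exact: sinck_decay].
Qed.

(** The constant 32 comes from 2 pi * 2 |v| A <= 16 |v| A <= 1/2, the range where each sinc factor
    is at least A. *)
Lemma sqker_ge z : cabs (v z) * A <= 32^-1 -> A ^+ 2 <= sqker v A z.
Proof.
move=> hv; have [/andP[_ pi4] _] := @pihalf_02_cos_pihalf R.
have pi4' : pi <= 4 :> R by lra.
have pi0 := @pi_gt0 R.
have b (u : R) : `|u| <= 2 * cabs (v z) -> `|2 * pi * u| * A <= 2^-1.
  move=> hu; rewrite normrM ger0_norm ?mulr_ge0 ?(ltW pi0)//.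
  have h1 : `|u| * A <= 2 * 32^-1.
    apply: (@le_trans _ _ (2 * (cabs (v z) * A))); last by rewrite ler_wpM2l.
    by rewrite mulrA ler_wpM2r// ltW.
  have h0 : 0 <= `|u| * A by rewrite mulr_ge0// ltW.
  rewrite -mulrA; nra.
rewrite expr2; apply: ler_pM; rewrite ?(ltW A0)//; apply: sinck_ge => //; apply: b.
  by apply: le_trans (ler_normD _ _) _; have := Re_cabs (v z); have := Im_cabs (v z); lra.
by apply: le_trans (ler_normB _ _) _; have := Re_cabs (v z); have := Im_cabs (v z); lra.
Qed.

End AveragingUpper.

(** * Lower bound for the averaged oscillatory integral *)

Section AveragingLower.
Variable R : realType.
Notation plane := (measurableTypeR R * measurableTypeR R)%type.

(** An L^1 bound J would bound the integral of Re H against the fourth power of the kernel by 64 A^6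
    J. That integral is bounded below by the contribution near z0, where Re H >= 1/2, once B makes
    the kernel narrow compared with rho. *)
Lemma averaging_lower (M : R) k : 0 <= M -> (0 < k)%N -> exists2 B : R, 1 <= B &
  forall (H : plane -> R[i]) (z0 : R[i]) (rho : R), cmeas H ->
  (forall p, cabs (H p) <= M) -> (forall p, 1 < cabs (toC p) -> H p = 0) ->
  0 < rho -> (forall p, cabs (toC p - z0) <= rho -> 2^-1 <= complex.Re (H p)) ->
  (((B / rho) ^+ k.-1.*2 / 2 ^+ 18)%:E <=
   \int[@lebesgueC R]_p (\1_(disk (0%R : R[i]) (8 * (B / rho) ^+ k)) p *
     `|wavg H (fun z => (toC z - z0) ^+ k) (fun=> 1%R) (toC p)|)%:E)%E.
Proof.
move=> M0 k0; have k3 : (3 <= 4 * k)%N by lia.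
pose b : R := (4 * k)%:R.
have b2 : 2 < b by rewrite /b ltr_nat.
have [C C0 hC] := decay_integral b2.
(* Large enough for the tail beyond rho, proportional to B^2 / B^(4 k), to take at most X / 4096,
   half of the main term X / 2048, where X = A^8 / a^2. *)
pose B := 2 ^+ 20 * M * 16 ^+ k * C + 1.
have B1 : 1 <= B by rewrite /B lerDr !mulr_ge0 ?exprn_ge0.
have B0 : 0 < B by lra.
exists B => // H z0 rho mH HM H0 rho0 hH.
set a := B / rho; pose A := a ^+ k.
have a0 : 0 < a by rewrite divr_gt0.
have A0 : 0 < A by rewrite exprn_gt0.
set v := fun z : plane => (toC z - z0) ^+ k.
have mv : cmeas v.
  by apply: cmeasX; apply: cmeasD; [exact: cmeas_toC|exact: cmeas_cst].
set I := (\int[_]_p _)%E.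
have I0 : (0 <= I)%E by apply: integral_ge0 => p _; rewrite lee_fin mulr_ge0.
rewrite leNgt; apply/negP => hI.
have [J hJ] : exists J : R, I = J%:E.
  by exists (fine I); rewrite fineK// ge0_fin_numE// (lt_trans hI) ?ltry.
have := @wavg_fourth_le _ H v M A mH mv HM H0 A0 J.
rewrite -/I hJ lexx => /(_ isT) hup.
rewrite hJ lte_fin in hI.
have mq := measurable_sqker A mv.
pose W z := sqker v A z ^+ 4.
have mW : measurable_fun setT W by exact: measurable_funX.
have W0 z : 0 <= W z by rewrite /W (_ : 4%N = (2 * 2)%N)// exprM sqr_ge0.
have WN z : `|W z| <= (4 * A ^+ 2) ^+ 4.
  have qz : `|sqker v A z| <= 4 * A ^+ 2 by exact: sqker_le.
  rewrite /W normrX; apply: lerXn2r => //; rewrite nnegrE//.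
  by rewrite mulr_ge0// sqr_ge0.
pose K := 256 * M * A ^+ 4 * 16 ^+ k * rho^-1 ^+ (4 * k).
have K0 : 0 <= K.
  rewrite /K; nneg.
pose dec (p : plane) : R := (1 + rho^-1 * cabs (toC p - z0)) `^ (- b).
(* Within this radius |v| A = (a |z - z0|)^k <= 1/32, the range of [sqker_ge]. *)
pose r0 := (32 * a)^-1.
have a_rho : a * rho = B by rewrite divfK// gt_eqF.
have r00 : 0 < r0 by rewrite invr_gt0 mulr_gt0.
have rhoE : rho = B * a^-1 by rewrite /a invf_div mulrC divfK// gt_eqF.
have r0rho : r0 <= rho.
  rewrite /r0 rhoE invfM ler_wpM2r ?invr_ge0 ?(ltW a0)//.
  by lra.
have ampE p : amp H v 0 p = complex.Re (H p).
  by rewrite /amp mul0r echarE /= addr0 mulr0 /expi cos0 sin0 ReCM /= mulr1 mulr0 subr0.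
(* Three zones: within r0 the weight is at least A^8 and Re H >= 1/2; between r0 and rho the product
   is nonnegative; beyond rho only Re H >= - M is known, and M W is absorbed by K dec. *)
have pw p : 2^-1 * A ^+ 8 * \1_(disk z0 r0) p <= amp H v 0 p * W p + K * dec p.
  have Kd0 : 0 <= K * dec p by rewrite mulr_ge0 ?powR_ge0.
  rewrite ampE; have [pr|pr] := leP (cabs (toC p - z0)) rho.
    have h := hH p pr; rewrite indicE.
    have [pd|pd] := pselect (disk z0 r0 p); last first.
      by rewrite memNset// mulr0 addr_ge0// mulr_ge0//; lra.
    have vA : cabs (v p) * A <= 32^-1.
      have h1 : cabs (toC p - z0) * a <= 32^-1.
        apply: (@le_trans _ _ (r0 * a)); first by apply: ler_wpM2r => //; exact: ltW.
        by rewrite /r0 invfM divfK// gt_eqF.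
      have h2 : 0 <= cabs (toC p - z0) * a by apply: mulr_ge0 => //; exact: ltW.
      rewrite /v cabsX -exprMn -(prednK k0) exprS; apply: (le_trans _ h1).
      by rewrite ler_piMr//; apply: exprn_ile1 => //; lra.
    have hq := sqker_ge A0 vA.
    rewrite mem_set// mulr1 -[leLHS]addr0 lerD//; apply: ler_pM => //.
      by apply: exprn_ge0; exact: ltW.
    rewrite /W (_ : A ^+ 8 = (A ^+ 2) ^+ 4); last by rewrite -exprM.
    by apply: lerXn2r => //; rewrite nnegrE ?sqr_ge0// (le_trans _ hq)// sqr_ge0.
  rewrite indicE memNset ?mulr0; last first.
    by rewrite /disk /= => h; move: pr; rewrite ltNge (le_trans h r0rho).
  set u := cabs (toC p - z0) in pr *.
  have u0 : 0 < u by apply: lt_trans pr.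
  have X0 : 0 < u ^+ (4 * k) by rewrite exprn_gt0.
  have hWX : W p * u ^+ (4 * k) <= 256 * A ^+ 4.
    rewrite mulnC exprM /W -exprMn (_ : 256 * A ^+ 4 = (4 * A) ^+ 4); last by ring.
    have -> : (sqker v A p * u ^+ k) ^+ 4 = (`|sqker v A p| * u ^+ k) ^+ 4.
      have := W0 p; rewrite /W; move: (sqker v A p) => x x0.
      by rewrite !exprMn -normrX ger0_norm.
    have hd := sqker_decay v A0 p; have vE : cabs (v p) = u ^+ k by rewrite /v cabsX.
    rewrite vE in hd; apply: lerXn2r => //; rewrite nnegrE; apply: mulr_ge0 => //.
      by apply: exprn_ge0; exact: ltW.
    exact: ltW.
  have hdec : dec p = ((1 + rho^-1 * u) ^+ (4 * k))^-1.
    by rewrite /dec -/u /b -powR_invn ?addr_ge0 ?mulr_ge0 ?invr_ge0 ?(ltW rho0) ?(ltW u0).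
  set Y := 16 ^+ k * rho^-1 ^+ (4 * k).
  have Z0 : 0 < (1 + rho^-1 * u) ^+ (4 * k).
    by rewrite exprn_gt0// addr_gt0// mulr_gt0// invr_gt0.
  have hZ : (1 + rho^-1 * u) ^+ (4 * k) <= Y * u ^+ (4 * k).
    have -> : Y * u ^+ (4 * k) = (2 * (rho^-1 * u)) ^+ (4 * k).
      by rewrite !exprMn /Y mulrA; congr (_ * _ * _); rewrite exprM; congr (_ ^+ _); ring.
    rewrite lerXn2r ?nnegrE ?addr_ge0 ?mulr_ge0 ?invr_ge0 ?(ltW rho0) ?(ltW u0)//.
    have : 1 <= rho^-1 * u by rewrite mulrC ler_pdivlMr// mul1r ltW.
    lra.
  have hM : - M <= complex.Re (H p).
    by have := le_trans (Re_cabs (H p)) (HM p); rewrite ler_norml => /andP[].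
  have : M * W p <= K * dec p.
    have -> : K * dec p = M * (256 * A ^+ 4 * Y * dec p) by rewrite /K /Y; ring.
    rewrite ler_wpM2l// hdec ler_pdivlMr//.
    apply: (@le_trans _ _ (W p * (Y * u ^+ (4 * k)))); first by rewrite ler_wpM2l.
    rewrite mulrCA mulrC ler_wpM2r// /Y mulr_ge0 ?exprn_ge0 ?invr_ge0 ?(ltW rho0)//.
  have : - M * W p <= complex.Re (H p) * W p by rewrite ler_wpM2r.
  by rewrite mulNr; lra.
have mdec : measurable_fun setT dec.
  apply: (measurableT_comp (measurable_powR _)).
  apply: measurable_funD => //; apply: measurable_funM => //; apply: measurable_cabs.
  by apply: cmeasD; [exact: cmeas_toC|exact: cmeas_cst].
have idec : (@lebesgueC R).-integrable setT (EFin \o dec).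
  apply/integrableP; split; first exact/measurable_EFinP.
  under eq_integral do rewrite /= ger0_norm ?powR_ge0//.
  by apply: le_lt_trans (hC _ z0 _) (ltry _); rewrite invr_gt0.
have iamp := bsupp_integrable (bsupp_amp mH mv HM H0 0 mW WN).
have A8 : 0 <= 2^-1 * A ^+ 8 by apply: mulr_ge0 => //; apply: exprn_ge0; exact: ltW.
have main : 2^-1 * A ^+ 8 * r0 ^+ 2 <= wavg H v W 0 + K * (C * rho ^+ 2).
  rewrite -lee_fin EFinD (wavgE mH mv HM H0 0 mW WN).
  apply: (@le_trans _ _ (\int[@lebesgueC R]_p ((amp H v 0 p * W p)%:E + (K * dec p)%:E))%E).
    apply: (@le_trans _ _ (\int[@lebesgueC R]_p ((2^-1 * A ^+ 8)%:E * (\1_(disk z0 r0) p)%:E))%E).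
      rewrite ge0_integralZl_EFin//; last first.
        by apply/measurable_EFinP; apply: measurable_indic; exact: measurable_disk.
      rewrite integral_indic//; last exact: measurable_disk.
      rewrite setIT EFinM lee_wpmul2l ?lee_fin//.
      by apply: lebesgueC_disk_ge; exact: ltW.
    apply: ge0_le_integral => //.
    - by move=> p _; rewrite -EFinM lee_fin mulr_ge0.
    - apply: measurable_funeM; apply/measurable_EFinP; apply: measurable_indic.
      exact: measurable_disk.
    - apply: emeasurable_funD; first by have /measurable_int := iamp.
      by apply/measurable_EFinP; exact: measurable_funM.
    - by move=> p _; rewrite -EFinM -EFinD lee_fin.
  rewrite integralD//; last by under eq_fun do rewrite EFinM; exact: integrableZl.
  rewrite leeD2l//; under eq_integral do rewrite EFinM.
  rewrite ge0_integralZl_EFin//; last 2 first.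
  - by move=> p _; rewrite lee_fin powR_ge0.
  - exact/measurable_EFinP.
  rewrite [leRHS]EFinM lee_wpmul2l ?lee_fin//.
  have := hC rho^-1 z0; rewrite invr_gt0 => /(_ rho0); rewrite exprVn invrK; exact.
have hg := le_trans (ler_norm _) hup.
set e := a ^+ k.-1.
have Ae : A = a * e by rewrite /A /e -exprS prednK.
have e0 : 0 < e by rewrite exprn_gt0.
pose X := A ^+ 8 / a ^+ 2.
have X0 : 0 <= X by apply: divr_ge0; apply: exprn_ge0; exact: ltW.
have KC : K * (C * rho ^+ 2) <= 4096^-1 * X.
  have e1 : rho^-1 ^+ (4 * k) = A ^+ 4 / B ^+ (4 * k).
    by rewrite rhoE invfM invrK exprMn exprVn mulrC /A -exprM mulnC.
  pose Q := M * 16 ^+ k * C.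
  have -> : K * (C * rho ^+ 2) = (256 * Q * (B ^+ 2 / B ^+ (4 * k))) * X.
    rewrite /K e1 rhoE /X /Q; field.
    by rewrite !expf_neq0 ?gt_eqF.
  apply: ler_wpM2r => //.
  have hQ : 2 ^+ 20 * Q <= B by rewrite /B /Q !mulrA; lra.
  have hB : B * (B ^+ 2 / B ^+ (4 * k)) <= 1.
    rewrite mulrA -exprS ler_pdivrMr ?exprn_gt0// mul1r.
    by apply: ler_weXn2l.
  have hB0 : 0 <= B ^+ 2 / B ^+ (4 * k) by apply: divr_ge0; apply: exprn_ge0; exact: ltW.
  have e20 : 2 ^+ 20 = 256 * 4096 :> R by ring.
  rewrite e20 in hQ.
  have : 256 * 4096 * Q * (B ^+ 2 / B ^+ (4 * k)) <= B * (B ^+ 2 / B ^+ (4 * k)).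
    exact: ler_wpM2r.
  lra.
have r0E : 2^-1 * A ^+ 8 * r0 ^+ 2 = 2048^-1 * X.
  by rewrite /r0 /X; field; rewrite gt_eqF.
have XE : X = A ^+ 6 * e ^+ 2 by rewrite /X Ae; field; rewrite gt_eqF.
have A6 : 0 < A ^+ 6 by exact: exprn_gt0.
have : 64 * A ^+ 6 * J < 64 * A ^+ 6 * (e ^+ 2 / 2 ^+ 18).
  rewrite ltr_pM2l ?mulr_gt0//; move: hI; rewrite -muln2 exprM; exact.
have -> : 64 * A ^+ 6 * (e ^+ 2 / 2 ^+ 18) = 4096^-1 * X by rewrite XE; field.
rewrite r0E in main; move: main hg; rewrite /W; lra.
Qed.

End AveragingLower.

(** * Real parts of complex integrals, and bounds for phi *)

Section ComplexIntegral.
Variable R : realType.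
Notation plane := (measurableTypeR R * measurableTypeR R)%type.

Lemma echar0 : echar (0 : R[i]) = 1.
Proof. by rewrite echarE /= addr0 mulr0 /expi cos0 sin0. Qed.

Lemma Re_mul_integral (u : R[i]) (f : plane -> R[i]) M :
  bsupp M (fun p => complex.Re (f p)) -> bsupp M (fun p => complex.Im (f p)) ->
  complex.Re (u * ((\int[@lebesgueC R]_p complex.Re (f p))%R +i*
                   (\int[@lebesgueC R]_p complex.Im (f p))%R)%C) =
  (\int[@lebesgueC R]_p complex.Re (u * f p))%R.
Proof.
move=> /bsupp_integrable i1 /bsupp_integrable i2.
rewrite ReCM /= -!RintegralZl// -RintegralB//.
- by apply: eq_Rintegral => p _; rewrite ReCM.
- exact: (integrableZl measurableT (complex.Re u) i1).
- exact: (integrableZl measurableT (complex.Im u) i2).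
Qed.

Lemma cmeas_mul_bsupp (f g : plane -> R[i]) (M : R) : cmeas f -> (forall p, cabs (f p) = 1) ->
  cmeas g -> (forall p, cabs (g p) <= M) -> (forall p, 1 < cabs (toC p) -> g p = 0) ->
  bsupp M (fun p => complex.Re (f p * g p)) /\ bsupp M (fun p => complex.Im (f p * g p)).
Proof.
move=> mf f1 mg gM g0; have [m1 m2] := cmeasM mf mg; split; split => //.
- by move=> p; apply: le_trans (Re_cabs _) _; rewrite cabsM f1 mul1r.
- by move=> p p1; rewrite g0// mulr0.
- by move=> p; apply: le_trans (Im_cabs _) _; rewrite cabsM f1 mul1r.
- by move=> p p1; rewrite g0// mulr0.
Qed.

Lemma Cc_oo_bound (phi : R[i] -> R[i]) : Cc_oo_disk phi -> exists2 M : R, 0 <= M &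
  (forall p : plane, cabs (phi (toC p)) <= M) /\
  (forall p : plane, 1 < cabs (toC p) -> phi (toC p) = 0).
Proof.
move=> /Cc_oo_C1supp[M [fx [fy [gx [gy [/C1_f[m1 b1 z1] /C1_f[m2 b2 z2]]]]]]].
have M0 : 0 <= M by apply: le_trans (b1 (0, 0)).
exists (M + M); first exact: addr_ge0.
split=> p; first by apply: le_trans (cabs_ReIm _) _; exact: lerD.
by move=> p1; apply/eqP; rewrite eq_complex z1// z2// !eqxx.
Qed.

End ComplexIntegral.

(** * Windows in coefficient space *)

Section Window.
Variable R : realType.
Notation plane := (measurableTypeR R * measurableTypeR R)%type.
Variables (n : nat) (k : nat -> nat) (B dl : R).
Hypothesis B1 : 1 <= B.
Hypothesis dl0 : 0 < dl.
Hypothesis dl4 : dl <= 4^-1.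

(** Chosen so that n terms, each at most 4 [wunit] on the disk of radius dl, add up to at most
    1/32. *)
Definition wunit : R := (128 * n.+1%:R)^-1.
(** With the radii below, every later coefficient has modulus between 2 and 4 times wunit / dl^k:
    the upper bound tames the phase, the lower one pins down the centre z. The first coefficient
    ranges over the disk of radius 8 A required by [averaging_lower]. *)
Definition wcen (j : nat) : R := if j is 0 then 0 else 3 * wunit / dl ^+ k j.+1.
Definition wrad (j : nat) : R :=
  if j is 0 then 8 * (B / dl) ^+ k 1 else wunit / dl ^+ k j.+1.
Definition wbump (j : nat) (u _ : R[i]) : R := ((cabs (u - (wcen j)%:C%C) <= wrad j)%R)%:R.
Definition window (z : R[i]) (w : n.+1.-tuple plane) : R :=
  triprod wbump (matA k z) (fun _ _ => 0) w.
Definition window_tail (z : R[i]) (t : n.-tuple plane) : R :=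
  triprod (fun j => wbump j.+1) (fun j l => matA k z j.+1 l.+1) (fun _ _ => 0) t.

Lemma wunit_gt0 : 0 < wunit.
Proof. by rewrite invr_gt0 mulr_gt0// ltr0n. Qed.

Lemma wrad_gt0 j : 0 < wrad j.
Proof.
case: j => [|j] /=; last by rewrite divr_gt0 ?wunit_gt0// exprn_gt0.
by rewrite mulr_gt0// exprn_gt0// divr_gt0// (lt_le_trans _ B1).
Qed.

Lemma bump_ge0 j u v : 0 <= wbump j u v. Proof. exact: ler0n. Qed.

Lemma bimeas_bump j : bimeas (wbump j).
Proof.
move=> dX X u v mu mv; rewrite /wbump.
have mS : measurable [set x | cabs (u x - (wcen j)%:C%C) <= wrad j].
  apply: measurable_le_set => //; apply: measurable_cabs.
  by apply: cmeasD => //; exact: cmeas_cst.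
rewrite (_ : (fun x => _) = \1_[set x | cabs (u x - (wcen j)%:C%C) <= wrad j]).
  exact: measurable_indic.
apply/funext => x; rewrite indicE; congr (_%:R); congr nat_of_bool.
by apply/idP/idP; rewrite inE.
Qed.

Lemma window_ge0 z w : 0 <= window z w.
Proof. by apply: triprod_ge0 => *; exact: bump_ge0. Qed.

Lemma measurable_window z : measurable_fun setT (window z).
Proof. by apply: measurable_triprod => j; exact: bimeas_bump. Qed.

Lemma integral_bump j (a b b' : R[i]) : a = 1 ->
  (\int[@lebesgueC R]_x (wbump j (a * toC x + b)%R b')%:E =
   lebesgueC (disk ((wcen j)%:C%C - b)%R (wrad j)))%E.
Proof.
move=> ->; rewrite -(setIT (disk _ _)) -integral_indic//; last exact: measurable_disk.
apply: eq_integral => x _; rewrite indicE /wbump; congr (_%:R%:E); congr nat_of_bool.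
have -> : 1 * toC x + b - (wcen j)%:C%C = toC x - ((wcen j)%:C%C - b).
  by rewrite mul1r opprB addrA.
by apply/idP/idP; rewrite inE.
Qed.

Lemma matA_diag (z : R[i]) j : matA k z j j = 1.
Proof. by rewrite /matA ltnn binn subnn expr0 mulr1. Qed.

Lemma matA_tri (z : R[i]) j l : (l < j)%N -> matA k z j l = 0.
Proof. by rewrite /matA => ->. Qed.

Lemma integral_window_le z :
  (\int[lebesgueCn R n.+1]_w (window z w)%:E <= (\prod_(j < n.+1) (4 * wrad j ^+ 2))%:E)%E.
Proof.
apply: (@integral_triprod_le _ _ (fun j => 4 * wrad j ^+ 2)) => //.
- exact: bimeas_bump.
- by move=> j; rewrite mulr_ge0// sqr_ge0.
- exact: matA_tri.
move=> j b b' jn; rewrite integral_bump ?matA_diag//.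
by apply: lebesgueC_disk_le; exact/ltW/wrad_gt0.
Qed.

Lemma integral_window_tail_ge z :
  ((\prod_(j < n) wrad j.+1 ^+ 2)%:E <= \int[lebesgueCn R n]_t (window_tail z t)%:E)%E.
Proof.
apply: (@integral_triprod_ge _ _ (fun j => wrad j.+1 ^+ 2)) => //.
- by move=> j; exact: bimeas_bump.
- by move=> j; rewrite sqr_ge0.
- by move=> j l jl; rewrite matA_tri.
move=> j b b' jn; rewrite integral_bump ?matA_diag//.
by apply: lebesgueC_disk_ge; exact/ltW/wrad_gt0.
Qed.

Lemma window_consC z t x :
  window z (consC (t, x)) = window_tail z t *
    wbump 0 (toC x + linform (fun j l => matA k z j l.+1) 0 t) 0.
Proof.
rewrite /window triprod_cons//; last exact: matA_tri.
by rewrite /window_tail matA_diag mul1r.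
Qed.

Lemma triprod_bump1 m (g : nat -> R[i] -> R[i] -> R) A A' (t : m.-tuple plane) :
  (forall j u v, g j u v = 0 \/ g j u v = 1) ->
  triprod g A A' t = 0 \/
  forall j : 'I_m, g j (linform A j t) (linform A' j t) = 1.
Proof.
move=> g01; have [h|h] := pselect (forall j : 'I_m, g j (linform A j t) (linform A' j t) = 1).
  by right.
left; have [j hj] : exists j : 'I_m, g j (linform A j t) (linform A' j t) <> 1.
  by apply: contrapT => h'; apply: h => j; apply: contrapT => hj; apply: h'; exists j.
by rewrite /triprod (bigD1 j)//=; case: (g01 j (linform A j t) (linform A' j t)) => // ->; rewrite mul0r.
Qed.

Lemma bump01 j u v : wbump j u v = 0 \/ wbump j u v = 1.
Proof. by rewrite /wbump; case: (_ <= _); [right|left]. Qed.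

Lemma bump_eq1 j u v : wbump j u v = 1 -> cabs (u - (wcen j)%:C%C) <= wrad j.
Proof. by rewrite /wbump; case: (_ <= _) => // /eqP; rewrite eq_sym oner_eq0. Qed.

Lemma bump_tail_le j u v : wbump j.+1 u v = 1 -> cabs u <= 4 * wunit / dl ^+ k j.+2.
Proof.
move=> /bump_eq1 h; rewrite -[u](subrK (wcen j.+1)%:C%C); apply: le_trans (cabsD _ _) _.
have c0 : 0 <= wcen j.+1.
  by rewrite /= divr_ge0 ?mulr_ge0 ?(ltW wunit_gt0)// exprn_ge0// ltW.
rewrite cabs_real ger0_norm//; apply: le_trans (lerD h (lexx _)) _.
by rewrite /= -mulrDl le_eqVlt; apply/orP; left; apply/eqP; congr (_ / _); ring.
Qed.

End Window.

(** * Lower bound for the integral of |E1| over a window *)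

Section WindowLowerBound.
Variable R : realType.
Notation plane := (measurableTypeR R * measurableTypeR R)%type.

(** With all coordinates but the first frozen, the phase is a constant plus (x + be) (z - z0)^(k 1)
    plus a remainder that is small for |z - z0| <= dl; [averaging_lower] applies with rho = dl after
    translating x by be. The hypothesis on c0 says that recentring at z0 stays within the given
    exponents, up to a constant. *)
Lemma window_extension_ge n (k : nat -> nat) (phi : R[i] -> R[i]) :
  Cc_oo_disk phi -> (forall z : R[i], cabs z <= 2^-1 -> phi z = 1) -> (0 < k 1)%N ->
  exists2 B : R, 1 <= B & forall (dl : R) (z0 : R[i]), 0 < dl -> dl <= 4^-1 ->
  cabs z0 <= 4^-1 ->
  (exists c0 : n.+1.-tuple plane -> R[i], forall w z,
    \sum_(j < n.+1) toC (tnth w j) * z ^+ k j.+1 =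
    c0 w + \sum_(j < n.+1) linform (matA k z0) j w * (z - z0) ^+ k j.+1) ->
  (((B / dl) ^+ (k 1).-1.*2 / 2 ^+ 18 * \prod_(j < n) wrad n k B dl j.+1 ^+ 2)%:E <=
   \int[lebesgueCn R n.+1]_w
     (window k B dl z0 w * cabs (extension k phi (fun=> 1%R) w))%:E)%E.
Proof.
move=> hphi hphi1 k1; have [M M0 [hM hz]] := Cc_oo_bound hphi.
have mphi := cmeas_Cc_oo hphi.
have [B B1 hB] := averaging_lower M0 k1; exists B => // dl z0 dl0 dl4 z04 [c0 hc0].
set cB := _ / 2 ^+ 18 in hB *.
have mE : measurable_fun setT (fun w : n.+1.-tuple plane => cabs (extension k phi (fun=> 1) w)).
  by apply: measurable_cabs; exact: cmeas_extension.
have cB0 : 0 <= cB.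
  by rewrite /cB divr_ge0// exprn_ge0// divr_ge0 ?(ltW dl0)// (le_trans _ B1).
pose F (w : n.+1.-tuple plane) := window k B dl z0 w * cabs (extension k phi (fun=> 1) w).
have F0 w : 0 <= F w by rewrite mulr_ge0// window_ge0.
have mF : measurable_fun setT F.
  by apply: measurable_funM => //; exact: measurable_window.
rewrite integral_lebesgueCnS; last 2 first.
- exact/measurable_EFinP.
- by move=> w; rewrite lee_fin; exact: F0.
apply: (@le_trans _ _ (\int[lebesgueCn R n]_t (cB%:E * (window_tail k B dl z0 t)%:E))%E).
  rewrite ge0_integralZl_EFin//; last 2 first.
  - by move=> t _; rewrite lee_fin; apply: triprod_ge0 => j *; exact: bump_ge0.
  - by apply/measurable_EFinP; apply: measurable_triprod => j; exact: bimeas_bump.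
  by rewrite EFinM lee_wpmul2l ?lee_fin//; exact: integral_window_tail_ge.
have mFc : measurable_fun setT (F \o @consC R n).
  by apply: measurableT_comp => //; exact: measurable_consC.
apply: ge0_le_integral => //.
- move=> t _; rewrite -EFinM lee_fin mulr_ge0//.
  by apply: triprod_ge0 => j *; exact: bump_ge0.
- apply: measurable_funeM; apply/measurable_EFinP; apply: measurable_triprod => j.
  exact: bimeas_bump.
- apply: (@measurable_fun_fubini_tonelli_F _ _ _ _ _ (@lebesgueC R)
    (fun p => (F (consC p))%:E)); first by apply/measurable_EFinP.
  by move=> p; rewrite lee_fin.
move=> t _; rewrite -EFinM.
have [G0|G1] := @triprod_bump1 R n (fun j => wbump n k B dl j.+1)
    (fun j l => matA k z0 j.+1 l.+1) (fun _ _ => 0) t (fun j => @bump01 R n k B dl j.+1).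
  rewrite /window_tail G0 mulr0; apply: integral_ge0 => x _; rewrite lee_fin; exact: F0.
have Gt : window_tail k B dl z0 t = 1 by rewrite /window_tail /triprod big1.
rewrite Gt mulr1.
set be := linform (fun j l => matA k z0 j l.+1) 0 t.
pose ga (j : 'I_n) := linform (fun j l => matA k z0 j.+1 l.+1) j t.
pose S z := \sum_(j < n) ga j * (z - z0) ^+ k j.+2.
pose H (p : plane) := echar (S (toC p)) * phi (toC p).
pose v (p : plane) := (toC p - z0) ^+ k 1.
have mz : cmeas (fun p : plane => toC p - z0).
  by apply: cmeasD; [exact: cmeas_toC|exact: cmeas_cst].
have mS : cmeas (fun p : plane => S (toC p)).
  by apply: cmeas_sum => j; apply: cmeasM; [exact: cmeas_cst|exact: cmeasX].
have mH : cmeas H by apply: cmeasM => //; exact: cmeas_echar.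
have HM p : cabs (H p) <= M by rewrite cabsM cabs_echar mul1r.
have H0 (p : plane) : 1 < cabs (toC p) -> H p = 0 by move=> p1; rewrite /H hz// mulr0.
have hS p : cabs (toC p - z0) <= dl -> cabs (S (toC p)) <= 32^-1.
  move=> hp; apply: le_trans (cabs_sum _ _ _) _.
  apply: (@le_trans _ _ (\sum_(j < n) 4 * wunit R n)).
    apply: ler_sum => j _; rewrite cabsM cabsX.
    have hg := bump_tail_le dl0 (G1 j); rewrite -/(ga j) in hg.
    have dk : 0 < dl ^+ k j.+2 by rewrite exprn_gt0.
    apply: (@le_trans _ _ (4 * wunit R n / dl ^+ k j.+2 * dl ^+ k j.+2)).
      apply: ler_pM => //; first by apply: exprn_ge0.
      by apply: lerXn2r => //; rewrite nnegrE// ltW.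
    by rewrite divfK// gt_eqF.
  rewrite sumr_const card_ord -[_ *+ n]mulr_natr /wunit.
  have : n%:R <= n.+1%:R :> R by rewrite ler_nat.
  have : 0 < n.+1%:R :> R by rewrite ltr0n.
  move=> n0 nn; have -> : 4 * (128 * n.+1%:R)^-1 * n%:R = 32^-1 * (n%:R / n.+1%:R) :> R.
    by move: (n.+1%:R : R) (n%:R : R) n0 {nn} => u u' u0; field; rewrite gt_eqF.
  by rewrite ler_piMr// ler_pdivrMr// mul1r.
(* Here |z| <= 1/4 + 1/4, so phi = 1, and the phase is at most 8 (1/32 + 1/32) = 1/2. *)
have HR p : cabs (toC p - z0) <= dl -> 2^-1 <= complex.Re (H p).
  move=> hp; rewrite /H hphi1 ?mulr1; last first.
    rewrite -[toC p](subrK z0); apply: le_trans (cabsD _ _) _.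
    apply: le_trans (lerD hp z04) _; lra.
  rewrite echarE /=; apply: cos_ge_half.
  have := hS p hp; have := Re_cabs (S (toC p)); have := Im_cabs (S (toC p)).
  have [/andP[_ pi4] _] := @pihalf_02_cos_pihalf R; have pi0 := @pi_gt0 R.
  move=> h1 h2 h3; rewrite normrM ger0_norm; last by rewrite mulr_ge0// ltW.
  apply: (@le_trans _ _ (8 * (32^-1 + 32^-1))); last by lra.
  apply: ler_pM => //; first by rewrite mulr_ge0// ltW.
    by lra.
  by apply: le_trans (ler_normD _ _) _; apply: lerD; [apply: le_trans h2 h3|apply: le_trans h1 h3].
have := hB H z0 dl mH HM H0 dl0 HR.
rewrite -/v => /le_trans; apply.
have [b hb] := toC_surj be.
pose A := (B / dl) ^+ k 1.
pose f (p : plane) : \bar R := (\1_(disk (0%R : R[i]) (8 * A)) p * `|wavg H v (fun=> 1) (toC p)|)%:E.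
have mv : cmeas v by exact: cmeasX.
have m1 : measurable_fun setT ((fun=> 1) : plane -> R) by exact: measurable_cst.
have mf : measurable_fun setT f.
  apply/measurable_EFinP; apply: measurable_funM.
    by apply: measurable_indic; exact: measurable_disk.
  apply: measurableT_comp => //.
  by have := measurable_wavg mH mv m1 0; under eq_fun do rewrite add0r.
rewrite -/A -/(f _) -(ge0_integral_plane_add b mf); last by move=> p; rewrite lee_fin mulr_ge0.
apply: ge0_le_integral => //.
- by move=> x _; rewrite lee_fin mulr_ge0.
- apply: (measurableT_comp mf); apply/measurable_fun_pairP; split => /=.
    by apply: measurable_funD => //; exact: measurable_fst.
  by apply: measurable_funD => //; exact: measurable_snd.
- apply/measurable_EFinP; apply: (measurableT_comp mFc).
  exact: measurable_pair1.
move=> x _; rewrite /f lee_fin.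
have e : toC (x.1 + b.1, x.2 + b.2) = toC x + be :> R[i].
  by rewrite -hb /toC; simpc.
rewrite e window_consC -/be Gt mul1r; apply: ler_pM => //.
  rewrite indicE /wbump; have -> : ((x.1 + b.1, x.2 + b.2) \in disk (0 : R[i]) (8 * A)) =
      (cabs (toC x + be - (wcen n k dl 0)%:C%C) <= wrad n k B dl 0).
    rewrite /= subr0; apply/idP/idP; first by rewrite inE disk0E e.
    by rewrite inE disk0E e.
  by [].
set w := consC (t, x).
have phE z : \sum_(j < n.+1) toC (tnth w j) * z ^+ k j.+1 =
    c0 w + ((toC x + be) * (z - z0) ^+ k 1 + S z).
  rewrite hc0 big_ord_recl; congr (_ + (_ + _)).
    by rewrite linform_cons matA_diag mul1r.
  apply: eq_bigr => j _; rewrite linform_cons matA_tri// mul0r add0r.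
  by rewrite /ga.
pose g (p : plane) := echar (\sum_(j < n.+1) toC (tnth w j) * toC p ^+ k j.+1) * 1 * phi (toC p).
have mg : cmeas (fun p : plane => echar (\sum_(j < n.+1) toC (tnth w j) * toC p ^+ k j.+1) * 1).
  apply: cmeasM; last exact: cmeas_cst.
  apply: cmeas_echar; apply: cmeas_sum => j; apply: cmeasM; first exact: cmeas_cst.
  by apply: cmeasX; exact: cmeas_toC.
have g1 (p : plane) : cabs (echar (\sum_(j < n.+1) toC (tnth w j) * toC p ^+ k j.+1) * 1) = 1.
  by rewrite cabsM cabs_echar cabs1 mulr1.
have [bs1 bs2] := cmeas_mul_bsupp mg g1 mphi hM hz.
(* The constant c0 only rotates E1, so the average is the real part of a rotation of E1 and is
   dominated by |E1|. *)
have -> : wavg H v (fun=> 1) (toC x + be) =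
    complex.Re (echar (- c0 w) * extension k phi (fun=> 1) w).
  rewrite /extension /integralC (Re_mul_integral _ bs1 bs2) /wavg.
  apply: eq_Rintegral => p _; rewrite mulr1 /amp; congr complex.Re.
  have -> : echar (\sum_(j < n.+1) toC (tnth w j) * toC p ^+ k j.+1) * 1 * phi (toC p) =
      echar (c0 w) * (H p * echar ((toC x + be) * v p)).
    by rewrite phE !echarD /H /v; ring.
  by rewrite [RHS]mulrA -echarD addNr echar0 mul1r.
by apply: le_trans (Re_cabs _) _; rewrite cabsM cabs_echar mul1r.
Qed.

End WindowLowerBound.

(** * A divergence criterion at a critical exponent *)

Section YoungDivergence.
Context {R : realType} {dT} {T : measurableType dT}.
Variable mu : {measure set T -> \bar R}.
Variables (f : T -> R) (q : R).
Hypotheses (mf : measurable_fun setT f) (f0 : forall x, 0 <= f x) (q1 : 1 < q).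
Hypothesis fq : (\int[mu]_x (f x `^ q)%:E < +oo)%E.

Let g (n : nat) (x : T) : R := f x `^ q * (f x <= n.+1%:R^-1)%R%:R.

Let mfq : measurable_fun setT (fun x => f x `^ q).
Proof. exact: (measurableT_comp (measurable_powR q)). Qed.

Let mg n : measurable_fun setT (g n).
Proof.
apply: measurable_funM => //.
rewrite (_ : (fun x => _) = \1_[set x | f x <= n.+1%:R^-1]).
  by apply: measurable_indic; exact: measurable_le_set.
apply/funext => x; rewrite indicE; congr (_%:R); congr nat_of_bool.
by apply/idP/idP; rewrite inE.
Qed.

(** Dominated convergence: f^q cut off to f <= 1/(n+1) tends to 0 pointwise. This little-o is what
    excludes the threshold exponent itself. *)
Lemma small_values_integral (ka : R) : 0 < ka ->
  exists n, (\int[mu]_x (g n x)%:E <= ka%:E)%E.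
Proof.
move=> ka0.
have ifq : mu.-integrable setT (EFin \o (fun x => f x `^ q)).
  apply/integrableP; split; first exact/measurable_EFinP.
  by under eq_integral do rewrite /= ger0_norm ?powR_ge0//.
have q0 : q != 0 by rewrite gt_eqF// (lt_trans ltr01 q1).
have g0 n x : 0 <= g n x by rewrite mulr_ge0// powR_ge0.
have ptw : {ae mu, forall x, setT x -> (EFin \o g n) x @[n --> \oo] --> (cst 0%E : T -> \bar R) x}.
  apply: aeW => x _; apply: cvg_near_cst.
  have := f0 x; rewrite le_eqVlt => /predU1P[fx|fx].
    by near=> n; rewrite /= /g -fx powR0// mul0r.
  have := near_infty_natSinv_lt (PosNum fx); apply: filterS => n /= h.
  by rewrite /g leNgt h mulr0.
have dom : {ae mu, forall x n, setT x -> (`|(EFin \o g n) x| <= (EFin \o (fun x => f x `^ q)%R) x)%E}.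
  apply: aeW => x n _; rewrite /= lee_fin ger0_norm// ler_piMr ?powR_ge0//.
  by rewrite lern1 leq_b1.
have [] := @dominated_convergence _ _ _ mu setT measurableT
   (fun n => EFin \o g n) (cst 0%E) (EFin \o (fun x => f x `^ q))
   (fun n => (measurable_EFinP _ _).2 (@mg n)) (measurable_cst _) ptw ifq dom.
move=> _ _; rewrite integral0 => /fine_cvgP[hfin hcv].
have : \forall n \near \oo, `|0 - fine (\int[mu]_x (EFin \o g n) x)| < ka.
  by move/cvgrPdist_lt : hcv => /(_ _ ka0).
move=> hlt; have [n [n1 n2]] : exists n, (\int[mu]_x (EFin \o g n) x)%E \is a fin_num /\
    `|0 - fine (\int[mu]_x (EFin \o g n) x)| < ka.
  have [N _ hN] := filterI hfin hlt; exists N; exact: (hN N (leqnn _)).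
exists n; rewrite -[leLHS]fineK// lee_fin; apply: le_trans (ltW n2).
by rewrite sub0r normrN ler_norm.
Unshelve. all: by end_near.
Qed.

(** [nu] is a weight of mass O(L) and height O(D^q L), against which f integrates to at least c D L.
    If f^q is integrable, the integral of nu f is at most 3/4 of c D L once D L is large. *)
Lemma divergence_of_weights (c C : R) : 0 < c -> 0 < C ->
  ~ (forall X : R, exists (nu : T -> R) (D L : R), [/\ 0 < D, 0 < L & X <= D * L] /\
   [/\ measurable_fun setT nu, forall x, 0 <= nu x <= C,
       forall x, nu x <= C * D `^ q * L,
       (\int[mu]_x (nu x)%:E <= (C * L)%:E)%E &
       ((c * D * L)%:E <= \int[mu]_x (nu x * f x)%:E)%E]).
Proof.
move=> c0 C0 H.
(* Each of three ranges of f is to cost at most a quarter of c D L: eps serves the values below eps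
   D, ka the values between eps D and al, and X = 4 Y F / c the values above al. *)
pose eps := c / (4 * C); have eps0 : 0 < eps by rewrite divr_gt0// mulr_gt0.
pose E := eps `^ (1 - q); have E0 : 0 < E by rewrite powR_gt0.
pose ka := c / (4 * C * E); have ka0 : 0 < ka by rewrite divr_gt0// !mulr_gt0.
have [n hn] := small_values_integral ka0.
pose al : R := n.+1%:R^-1.
have al0 : 0 < al by rewrite invr_gt0.
have [F hF] : exists F : R, (\int[mu]_x (f x `^ q)%:E = F%:E)%E.
  exists (fine (\int[mu]_x (f x `^ q)%:E)); rewrite fineK// ge0_fin_numE//.
  by apply: integral_ge0 => x _; rewrite lee_fin powR_ge0.
pose Y := C * al `^ (1 - q).
have Y0 : 0 < Y by rewrite mulr_gt0// powR_gt0.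
have [nu [D [L [[D0 L0 hX] [mnu nu01 nuL nuI nuf]]]]] := H (4 * Y * F / c).
(* Where f > a one has f <= a^(1 - q) f^q. This is used with a = al and nu <= C for large values,
   and with a = eps D and nu <= C D^q L for the middle ones. *)
have pw x : nu x * f x <= Y * f x `^ q + (eps * D * nu x + C * E * D * L * g n x).
  have /andP[n0 nC] := nu01 x.
  have q0 : q != 0 by rewrite gt_eqF// (lt_trans ltr01 q1).
  have gx0 : 0 <= g n x by rewrite mulr_ge0// powR_ge0.
  have r1 : 0 <= C * E * D * L * g n x by nneg.
  have r2 : 0 <= eps * D * nu x by nneg.
  have r3 : 0 <= Y * f x `^ q by nneg.
  have split a : 0 < a -> a < f x -> f x <= a `^ (1 - q) * f x `^ q.
    move=> a0 af; have fx0 : 0 < f x by apply: lt_trans af.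
    have {1}-> : f x = f x `^ (1 - q) * f x `^ q.
      by rewrite -powRD_gt0// subrK powRr1.
    rewrite ler_wpM2r ?powR_ge0// -(opprB q 1) powRN_le ?(ltW af)//.
    by rewrite subr_ge0 ltW.
  have [fal|fal] := leP (f x) al; last first.
    apply: (@le_trans _ _ (Y * f x `^ q)); last by rewrite lerDl addr_ge0.
    by rewrite -mulrA; apply: ler_pM => //; exact: split.
  have gE : g n x = f x `^ q by rewrite /g -/al fal mulr1.
  have [fD|fD] := leP (f x) (eps * D).
    apply: (@le_trans _ _ (eps * D * nu x)); first by rewrite mulrC ler_wpM2r.
    by lra.
  apply: (@le_trans _ _ (C * E * D * L * g n x)); last by lra.
  rewrite gE; apply: (@le_trans _ _ ((C * D `^ q * L) * ((eps * D) `^ (1 - q) * f x `^ q))).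
    by apply: ler_pM => //; apply: split => //; exact: mulr_gt0.
  rewrite powRM ?(ltW D0) ?(ltW eps0)// -/E.
  rewrite le_eqVlt; apply/orP; left; apply/eqP.
  have -> : C * D `^ q * L * (E * D `^ (1 - q) * f x `^ q) =
     C * E * L * f x `^ q * (D `^ q * D `^ (1 - q)) by ring.
  by rewrite -powRD_gt0// addrC subrK powRr1 ?(ltW D0)//; ring.
have g0 x : 0 <= g n x by rewrite mulr_ge0// powR_ge0.
have nu0 x : 0 <= nu x by have /andP[] := nu01 x.
have c1 : 0 <= eps * D by nneg.
have c2 : 0 <= C * E * D * L by nneg.
have : (\int[mu]_x (nu x * f x)%:E <=
    (Y * F)%:E + ((eps * D * (C * L))%:E + (C * E * D * L * ka)%:E))%E.
  apply: (@le_trans _ _ (\int[mu]_x (Y%:E * (f x `^ q)%:E +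
      ((eps * D)%:E * (nu x)%:E + (C * E * D * L)%:E * (g n x)%:E)))%E).
    apply: ge0_le_integral => //.
    - by move=> x _; rewrite lee_fin mulr_ge0.
    - by apply/measurable_EFinP; exact: measurable_funM.
    - apply: emeasurable_funD; first by apply: measurable_funeM; exact/measurable_EFinP.
      by apply: emeasurable_funD; apply: measurable_funeM; exact/measurable_EFinP.
    - by move=> x _; rewrite -!EFinM -!EFinD lee_fin.
  rewrite ge0_integralD//; last 4 first.
  - by move=> x _; rewrite -EFinM lee_fin mulr_ge0 ?powR_ge0// ltW.
  - by apply: measurable_funeM; exact/measurable_EFinP.
  - by move=> x _; rewrite adde_ge0// -EFinM lee_fin mulr_ge0.
  - by apply: emeasurable_funD; apply: measurable_funeM; exact/measurable_EFinP.
  rewrite ge0_integralD//; last 4 first.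
  - by move=> x _; rewrite -EFinM lee_fin mulr_ge0.
  - by apply: measurable_funeM; exact/measurable_EFinP.
  - by move=> x _; rewrite -EFinM lee_fin mulr_ge0.
  - by apply: measurable_funeM; exact/measurable_EFinP.
  rewrite !ge0_integralZl_EFin//; try (by move=> x _; rewrite lee_fin ?powR_ge0);
    try exact/measurable_EFinP; last exact: ltW.
  rewrite hF -EFinM leeD2l// leeD//.
    by rewrite [leRHS]EFinM lee_wpmul2l ?lee_fin.
  by rewrite [leRHS]EFinM lee_wpmul2l ?lee_fin.
apply/negP; rewrite -ltNge; apply: lt_le_trans nuf; rewrite -!EFinD lte_fin.
have e1 : eps * D * (C * L) = 4^-1 * (c * D * L) by rewrite /eps; field; rewrite gt_eqF.
have e2 : C * E * D * L * ka = 4^-1 * (c * D * L).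
  by rewrite /ka; field; rewrite !gt_eqF.
have e3 : Y * F <= 4^-1 * (c * D * L).
  move: hX; rewrite ler_pdivrMr// => hX; lra.
have : 0 < c * D * L by rewrite !mulr_gt0.
rewrite e1 e2; lra.
Qed.

End YoungDivergence.

(** * Failure of integrability at the threshold exponents *)

Section Necessity.
Variable R : realType.
Notation plane := (measurableTypeR R * measurableTypeR R)%type.

Definition wcoef (n : nat) (k : nat -> nat) (B : R) (j : nat) : R :=
  if j is 0 then 8 * B ^+ k 1 else wunit R n.

Lemma wradE n k (B dl : R) j : dl != 0 -> wrad n k B dl j = wcoef n k B j / dl ^+ k j.+1.
Proof. by move=> d0; case: j => [|j]//=; rewrite expr_div_n mulrA. Qed.

Lemma wcoef_gt0 n k (B : R) j : 1 <= B -> 0 < wcoef n k B j.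
Proof.
move=> B1; case: j => [|j] /=; last exact: wunit_gt0.
by rewrite mulr_gt0// exprn_gt0// (lt_le_trans _ B1).
Qed.

Lemma prod_sum_expr (dl : R) m (h : nat -> nat) (c : nat -> R) :
  \prod_(j < m) (c j / dl ^+ h j) ^+ 2 = (\prod_(j < m) c j ^+ 2) / dl ^+ (2 * \sum_(j < m) h j).
Proof.
elim: m => [|m IH]; first by rewrite !big_ord0 muln0 expr0 divr1.
rewrite !big_ord_recr/= IH mulnDr exprD invfM expr_div_n -exprM (mulnC (h m)).
ring.
Qed.

Definition wupper n k (B : R) : R := \prod_(j < n.+1) (2 * wcoef n k B j) ^+ 2.
Definition wlower n (k : nat -> nat) (B : R) : R :=
  B ^+ (k 1).-1.*2 / 2 ^+ 18 * \prod_(j < n) wunit R n ^+ 2.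

Lemma wupper_gt0 n k (B : R) : 1 <= B -> 0 < wupper n k B.
Proof. by move=> B1; apply: prodr_gt0 => j _; rewrite exprn_gt0// mulr_gt0// wcoef_gt0. Qed.

Lemma wlower_gt0 n k (B : R) : 1 <= B -> 0 < wlower n k B.
Proof.
move=> B1; rewrite mulr_gt0 ?divr_gt0 ?exprn_gt0//; first exact: lt_le_trans B1.
by apply: prodr_gt0 => j _; rewrite exprn_gt0// wunit_gt0.
Qed.

Lemma wupperE n k (B dl : R) : 0 < dl ->
  \prod_(j < n.+1) (4 * wrad n k B dl j ^+ 2) =
  wupper n k B / dl ^+ (2 * \sum_(j < n.+1) k j.+1).
Proof.
move=> d0; rewrite -(prod_sum_expr dl n.+1 (fun j => k j.+1) (fun j => 2 * wcoef n k B j)).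
apply: eq_bigr => j _; rewrite wradE ?gt_eqF// -mulrA [RHS]exprMn.
by congr (_ * _); rewrite expr2 -natrM.
Qed.

Lemma wlowerE n k (B dl : R) : (0 < k 1)%N -> 0 < dl ->
  (B / dl) ^+ (k 1).-1.*2 / 2 ^+ 18 * \prod_(j < n) wrad n k B dl j.+1 ^+ 2 =
  wlower n k B * dl ^+ 2 / dl ^+ (2 * \sum_(j < n.+1) k j.+1).
Proof.
move=> k1 d0.
rewrite (prod_sum_expr dl n (fun j => k j.+2) (fun _ => wunit R n)) /wlower.
rewrite big_ord_recl mulnDr exprD expr_div_n -[in RHS](prednK k1) mulnS exprD -mul2n.
have h m : dl ^+ m != 0 by rewrite expf_neq0// gt_eqF.
rewrite [in RHS](eq_bigr (fun j : 'I_n => k j.+2))//; field.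
by rewrite !h gt_eqF.
Qed.

(** At centre 0 the off-diagonal entries are positive powers of 0, so gaps between the exponents do
    no harm. *)
Lemma recentring_at0 n (k : nat -> nat) :
  (forall l j, (l < j)%N -> (j < n.+1)%N -> (k l.+1 < k j.+1)%N) ->
  exists c0 : n.+1.-tuple plane -> R[i], forall w z,
    \sum_(j < n.+1) toC (tnth w j) * z ^+ k j.+1 =
    c0 w + \sum_(j < n.+1) linform (matA k 0) j w * (z - 0) ^+ k j.+1.
Proof.
move=> hk; exists (fun=> 0) => w z; rewrite add0r; apply: eq_bigr => j _.
rewrite subr0; congr (_ * _); rewrite /linform (bigD1 j)//= matA_diag mul1r.
rewrite big1 ?addr0// => l lj; rewrite /matA; case: ltnP => [|jl]; first by rewrite mul0r.
have jl' : (j < l)%N by rewrite ltn_neqAle jl andbT; apply: contra lj => /eqP e; apply/eqP/val_inj.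
by rewrite expr0n subn_eq0 leqNgt (hk _ _ jl' (ltn_ord l)) mulr0 mul0r.
Qed.

(** The exponents 1, 2, ... up to the degree are closed under translation up to a constant, so every
    centre is available. *)
Lemma recentring_id n (z0 : R[i]) :
  exists c0 : n.+1.-tuple plane -> R[i], forall w z,
    \sum_(j < n.+1) toC (tnth w j) * z ^+ id j.+1 =
    c0 w + \sum_(j < n.+1) linform (matA id z0) j w * (z - z0) ^+ id j.+1.
Proof.
exists (fun w => (shiftp z0 (Pw id w))`_0) => w z.
have /= <- := horner_Pw id w z; rewrite -[z in LHS](subrK z0) -horner_shiftp.
rewrite (@horner_coef_wide _ n.+2); last first.
  by rewrite size_shiftp; apply: size_Pw => j jn.
rewrite big_ord_recl expr0 mulr1; congr (_ + _); apply: eq_bigr => j _.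
by rewrite linform_matA.
Qed.

(** E1 is bounded, so |E1|^q0 <= M^(q0 - q) |E1|^q for q <= q0: divergence at the threshold rules
    out all smaller exponents. *)
Lemma Lq_threshold d (k : nat -> nat) phi (q0 : R) (q : \bar R) : Cc_oo_disk phi -> 0 < q0 ->
  ~ (\int[lebesgueCn R d]_w (cabs (extension k phi (fun=> 1%R) w) `^ q0)%:E < +oo)%E ->
  (0 < q)%E -> inLq (lebesgueCn R d) q (@extension R d k phi (fun=> 1)) -> (q0%:E < q)%E.
Proof.
move=> hphi q00 hq0 qp hq; rewrite ltNge; apply/negP => qq0; apply: hq0.
have mE : cmeas (@extension R d k phi (fun=> 1)) by apply: cmeas_extension; exact: cmeas_Cc_oo.
have [M M0 hM] := osc_integral_bounds hphi.
case: q qp hq qq0 => [q| |]// qp hq qq0.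
rewrite lee_fin in qq0; have qp' : 0 < q by rewrite -lte_fin.
have {hq} := (inLq_fin _ qp' mE).1 hq => hq.
have fM w : cabs (extension k phi (fun=> 1) w) <= M.
  by rewrite extensionE; have [] := hM (Pw k w).
have mf : measurable_fun setT (fun w : d.-tuple plane => cabs (extension k phi (fun=> 1) w)).
  exact: measurable_cabs.
apply: (@le_lt_trans _ _ (\int[lebesgueCn R d]_w ((M `^ (q0 - q))%:E *
    (cabs (extension k phi (fun=> 1%R) w) `^ q)%:E))%E).
  apply: ge0_le_integral => //.
  - by move=> w _; rewrite lee_fin powR_ge0.
  - by apply/measurable_EFinP; apply: (measurableT_comp (measurable_powR _) mf).
  - apply: measurable_funeM; apply/measurable_EFinP.
    by apply: (measurableT_comp (measurable_powR _) mf).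
  move=> w _; rewrite -EFinM lee_fin.
  have := cabs_ge0 (extension k phi (fun=> 1) w); rewrite le_eqVlt => /predU1P[<-|fp].
    by rewrite powR0 ?gt_eqF// mulr_ge0// powR_ge0.
  have -> : q0 = (q0 - q) + q by rewrite subrK.
  rewrite powRD_gt0// addrK ler_wpM2r ?powR_ge0//.
  by apply: ge0_ler_powR; rewrite ?nnegrE ?subr_ge0//; exact: ltW.
rewrite ge0_integralZl_EFin//; last 3 first.
- by move=> w _; rewrite lee_fin powR_ge0.
- by apply/measurable_EFinP; apply: (measurableT_comp (measurable_powR _) mf).
- exact: powR_ge0.
by apply: lte_mul_pinfty; rewrite ?lee_fin ?powR_ge0.
Qed.

Lemma small_scale (X : R) N : (0 < N)%N -> exists dl : R, [/\ 0 < dl, dl <= 4^-1 & X <= dl ^- N].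
Proof.
move=> N0; exists (`|X| + 4)^-1; have X0 := normr_ge0 X; split.
- by rewrite invr_gt0; lra.
- by rewrite lef_pV2 ?posrE//; lra.
rewrite -exprVn invrK; apply: (@le_trans _ _ (`|X| + 4)).
  by apply: le_trans (ler_norm X) _; lra.
by apply: ler_eXnr => //; lra.
Qed.

Lemma sparse_not_integrable n (k : nat -> nat) phi :
  Cc_oo_disk phi -> (forall z : R[i], cabs z <= 2^-1 -> phi z = 1) ->
  (forall l j, (l < j)%N -> (j < n.+1)%N -> (k l.+1 < k j.+1)%N) -> (0 < k 1)%N ->
  (1 < \sum_(j < n.+1) k j.+1)%N ->
  ~ (\int[lebesgueCn R n.+1]_w
      (cabs (extension k phi (fun=> 1%R) w) `^ (\sum_(j < n.+1) k j.+1)%N%:R)%:E < +oo)%E.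
Proof.
move=> hphi hphi1 hk k1; set K := (\sum_(j < n.+1) k j.+1)%N => K1 hq.
have [K2 K3] : (2 * K = 2 + (2 * K - 2))%N /\ (0 < 2 * K - 2)%N by clearbody K; lia.
have [B B1 hB] := window_extension_ge n hphi hphi1 k1.
have mE : measurable_fun setT (fun w : n.+1.-tuple plane => cabs (extension k phi (fun=> 1) w)).
  by apply: measurable_cabs; apply: cmeas_extension; exact: cmeas_Cc_oo.
have U0 := wupper_gt0 n k B1.
have q1 : 1 < K%:R :> R by rewrite ltr1n.
apply: (@divergence_of_weights _ _ _ (lebesgueCn R n.+1) _ _ mE _ q1 hq
  (wlower n k B) (1 + wupper n k B)) => //.
- exact: wlower_gt0.
- by rewrite addr_gt0.
move=> X; have [dl [dl0 dl4 hX]] := small_scale X K3.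
have dn m : dl ^+ m != 0 by rewrite expf_neq0// gt_eqF.
have dp m : 0 < dl ^+ m by exact: exprn_gt0.
(* D = dl^2 and L = dl^(-2 K) give D^K L = 1, so that windows bounded by 1 qualify, while D L =
   dl^(2 - 2 K) is unbounded because K > 1. *)
exists (@window R n k B dl 0), (dl ^+ 2), (dl ^- (2 * K)); split.
  split; rewrite ?invr_gt0//; apply: le_trans hX _.
  by rewrite {2}K2 exprD invfM mulrA divff// mul1r.
have w1 (w : n.+1.-tuple plane) : window k B dl 0 w <= 1.
  rewrite /window.
  have [->//|h] := triprod_bump1 (matA k 0) (fun _ _ => 0) w (@bump01 R n k B dl).
  by rewrite /triprod big1// => j _; exact: h.
split.
- exact: measurable_window.
- by move=> w; rewrite window_ge0/=; apply: le_trans (w1 w) _; rewrite lerDl ltW.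
- move=> w; apply: le_trans (w1 w) _.
  have e2 : (dl ^+ 2) `^ K%:R = dl ^+ (2 * K) by rewrite powR_mulrn ?ltW// exprM.
  by rewrite e2 mulfK// lerDl ltW.
- apply: le_trans (@integral_window_le R n k B dl B1 dl0 0) _.
  by rewrite lee_fin wupperE// ler_wpM2r ?invr_ge0 ?(ltW (dp _))// lerDr.
apply: le_trans (hB dl 0 dl0 dl4 _ (recentring_at0 hk)).
  by rewrite wlowerE.
by rewrite cabs0 invr_ge0.
Qed.

Lemma window_le1 n k (B dl : R) z (w : n.+1.-tuple plane) : window k B dl z w <= 1.
Proof.
rewrite /window; have [->//|h] := triprod_bump1 (matA k z) (fun _ _ => 0) w (@bump01 R n k B dl).
by rewrite /triprod big1// => j _; exact: h.
Qed.

Lemma measurable_window2 n k (B dl : R) :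
  measurable_fun setT (fun wp : n.+1.-tuple plane * plane => window k B dl (toC wp.2) wp.1).
Proof.
have mt (l : 'I_n.+1) : cmeas (fun wp : n.+1.-tuple plane * plane => toC (tnth wp.1 l)).
  apply: (cmeas_comp (f := @toC R)); first exact: cmeas_toC.
  by apply: (measurableT_comp (measurable_tnth l)).
have mz : cmeas (fun wp : n.+1.-tuple plane * plane => toC wp.2).
  by apply: (cmeas_comp (f := @toC R)); first exact: cmeas_toC.
apply: measurable_prodR => j; apply: bimeas_bump.
- apply: cmeas_sum => l; rewrite /matA; case: (l < j)%N; last exact: cmeas_natM.
  by under eq_fun do rewrite mul0r; exact: cmeas_cst.
- apply: cmeas_sum => l; under eq_fun do rewrite mul0r; exact: cmeas_cst.
Qed.

(* On the window the last coordinate is comparable to dl^-(n+2) while the centre z moves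
   the coefficient before it linearly, so z is confined to a disk of radius O(dl). *)
Lemma window_localized n (B dl : R) (z z1 : R[i]) (w : n.+2.-tuple plane) : 0 < dl -> 1 <= B ->
  window id B dl z w != 0 -> window id B dl z1 w != 0 ->
  cabs (z - z1) <= wcoef n.+1 id B n / wunit R n.+1 * dl.
Proof.
move=> dl0 B1 hz hz1.
have nz x : window id B dl x w != 0 ->
    cabs (linform (matA id x) n w - (wcen n.+1 id dl n)%:C%C) <= wrad n.+1 id B dl n /\
    cabs (linform (matA id x) n.+1 w - (wcen n.+1 id dl n.+1)%:C%C) <= wrad n.+1 id B dl n.+1.
  move=> hx; have [h0|h] := triprod_bump1 (matA id x) (fun _ _ => 0) w (@bump01 R n.+1 id B dl).
    by move: hx; rewrite /window h0 eqxx.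
  split; [have := h (inord n)|have := h (inord n.+1)]; rewrite inordK//; exact: bump_eq1.
have [h1 h2] := nz z hz; have [h3 _] := nz z1 hz1.
pose an := toC (tnth w (inord n)); pose bn := toC (tnth w ord_max).
have l2 x : linform (matA id x) n.+1 w = bn.
  rewrite /linform big_ord_recr/= big1 => [|j _]; last by rewrite matA_tri ?mul0r//= ltn_ord.
  by rewrite add0r matA_diag mul1r.
have l1 x : linform (matA id x) n w = an + n.+2%:R * x * bn.
  rewrite /linform 2!big_ord_recr/= big1 => [|j _]; last by rewrite matA_tri ?mul0r//= ltn_ord.
  rewrite add0r matA_diag mul1r; congr (_ + _ * _); first by congr (toC (tnth _ _)); apply: val_inj; rewrite /= inordK.
  by rewrite /matA ltnNge leqnSn/= binSn subSnn expr1.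
rewrite l2 in h2; rewrite !l1 in h1 h3.
have u0 := wunit_gt0 R n.+1.
have dn m : 0 < dl ^+ m by exact: exprn_gt0.
(* Centre 3 and radius 1, in units of wunit / dl^(n+2), leave a modulus of at least 2. *)
have hb : 2 * wunit R n.+1 / dl ^+ n.+2 <= cabs bn.
  have c0 : 0 <= wcen n.+1 id dl n.+1 by apply: divr_ge0; [apply: mulr_ge0 => //; exact: ltW|exact: ltW].
  have := lerB_cabs (wcen n.+1 id dl n.+1)%:C%C bn.
  rewrite cabs_real ger0_norm// [cabs (_ - bn)]cabsB => h4.
  have : wcen n.+1 id dl n.+1 - wrad n.+1 id B dl n.+1 = 2 * wunit R n.+1 / dl ^+ n.+2.
    rewrite /=; ring.
  lra.
have hd : cabs (n.+2%:R * (z - z1) * bn) <= 2 * wrad n.+1 id B dl n.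
  have -> : n.+2%:R * (z - z1) * bn =
    (an + n.+2%:R * z * bn - (wcen n.+1 id dl n)%:C%C) -
    (an + n.+2%:R * z1 * bn - (wcen n.+1 id dl n)%:C%C) by ring.
  by apply: le_trans (cabsD _ _) _; rewrite cabsN; lra.
rewrite !cabsM cabs_nat in hd.
have hz0 := cabs_ge0 (z - z1).
have n1 : 1 <= n.+2%:R :> R by rewrite ler1n.
have h5 : cabs (z - z1) * (2 * wunit R n.+1 / dl ^+ n.+2) <= 2 * wrad n.+1 id B dl n.
  apply: le_trans hd; apply: ler_pM => //; last by rewrite ler_peMl.
  by apply: divr_ge0; [apply: mulr_ge0 => //; exact: ltW|exact: ltW].
rewrite wradE ?gt_eqF// in h5.
rewrite mulrAC ler_pdivlMr// -(ler_pM2r (x := 2 / dl ^+ n.+2)) ?divr_gt0//.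
apply: le_trans (le_trans _ h5) _; first by rewrite le_eqVlt; apply/orP; left; apply/eqP; ring.
rewrite le_eqVlt; apply/orP; left; apply/eqP; rewrite /= [dl ^+ n.+2]exprS; field.
by rewrite gt_eqF// gt_eqF.
Qed.

(** The weight is the integral of the windows over the centres |z| <= 1/4. By [window_localized]
    only a disk of radius O(dl) of centres contributes for a given w, so its height is O(dl^2),
    which is D^q L for D = dl^2, L = dl^(-2 K), q = K + 1. Localization compares the last two
    coefficients, hence the dimension n + 2. *)
Lemma full_not_integrable n phi :
  Cc_oo_disk phi -> (forall z : R[i], cabs z <= 2^-1 -> phi z = 1) ->
  ~ (\int[lebesgueCn R n.+2]_w
      (cabs (extension id phi (fun=> 1%R) w) `^ ((\sum_(j < n.+2) j.+1)%N%:R + 1))%:E < +oo)%E.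
Proof.
move=> hphi hphi1; set K := (\sum_(j < n.+2) j.+1)%N => hq.
have K1 : (1 < K)%N by rewrite /K big_ord_recl big_ord_recl.
have [K2 K3] : (2 * K = 2 + (2 * K - 2))%N /\ (0 < 2 * K - 2)%N by clearbody K; lia.
have [B B1 hB] := @window_extension_ge R n.+1 id phi hphi hphi1 isT.
pose f (w : n.+2.-tuple plane) := cabs (extension id phi (fun=> 1) w).
have f0 w : 0 <= f w by exact: cabs_ge0.
have mf : measurable_fun setT f.
  by apply: measurable_cabs; apply: cmeas_extension; exact: cmeas_Cc_oo.
have U0 := wupper_gt0 n.+1 id B1; have l0 := @wlower_gt0 n.+1 id B B1.
have q1 : 1 < K%:R + 1 :> R by rewrite ltrDr ltr0n (ltnW K1).
set C2 := wcoef n.+1 id B n / wunit R n.+1.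
have C20 : 0 < C2 by rewrite divr_gt0 ?wcoef_gt0 ?wunit_gt0.
have mD4 : measurable (disk (0 : R[i]) 4^-1) by exact: measurable_disk.
have D4 : (lebesgueC (disk (0%R : R[i]) 4^-1) <= (4^-1)%:E)%E.
  apply: le_trans (lebesgueC_disk_le _ _) _; first by rewrite invr_ge0.
  by rewrite lee_fin; lra.
have D4' : ((16^-1)%:E <= lebesgueC (disk (0%R : R[i]) 4^-1))%E.
  apply: le_trans (lebesgueC_disk_ge _ _); last by rewrite invr_ge0.
  by rewrite lee_fin; lra.
apply: (@divergence_of_weights _ _ _ (lebesgueCn R n.+2) f _ mf f0 q1 hq
  (wlower n.+1 id B / 16) (1 + wupper n.+1 id B + 4 * C2 ^+ 2)) => //.
- by rewrite divr_gt0.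
- by rewrite !addr_gt0// mulr_gt0// exprn_gt0.
move=> X; have [dl [dl0 dl4 hX]] := small_scale X K3.
have dn m : dl ^+ m != 0 by rewrite expf_neq0// gt_eqF.
have dp m : 0 < dl ^+ m by exact: exprn_gt0.
have L0 : 0 < dl ^- (2 * K) by rewrite invr_gt0.
pose F (wz : n.+2.-tuple plane * plane) : R :=
  window id B dl (toC wz.2) wz.1 * \1_(disk (0 : R[i]) 4^-1) wz.2.
have F0 wz : 0 <= F wz by rewrite mulr_ge0// window_ge0.
have mi : measurable_fun setT (fun wz : n.+2.-tuple plane * plane => \1_(disk (0 : R[i]) 4^-1) wz.2 : R).
  by apply: (@measurableT_comp _ _ _ _ _ _ (\1_(disk (0 : R[i]) 4^-1) : plane -> R) _ snd).
have mF : measurable_fun setT F.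
  by apply: measurable_funM => //; exact: measurable_window2.
pose nuE w : \bar R := (\int[@lebesgueC R]_z (F (w, z))%:E)%E.
have nuE0 w : (0 <= nuE w)%E by apply: integral_ge0 => z _; rewrite lee_fin.
have mFw w : measurable_fun setT (fun z => F (w, z)).
  by apply: (measurableT_comp mF); exact: measurable_pair1.
have nuEle w (S : set plane) : measurable S -> (forall z, F (w, z) <= \1_S z) ->
    (nuE w <= lebesgueC S)%E.
  move=> mS h; rewrite -(setIT S) -integral_indic//; apply: ge0_le_integral => //.
  - by move=> z _; rewrite lee_fin.
  - exact/measurable_EFinP.
  - by apply/measurable_EFinP; exact: measurable_indic.
  - by move=> z _; rewrite lee_fin.
have nuE4 w : (nuE w <= (4^-1)%:E)%E.
  apply: le_trans D4; apply: nuEle => // z; rewrite /F /= ler_piMl//; exact: window_le1.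
have nuEf w : nuE w \is a fin_num by rewrite ge0_fin_numE// (le_lt_trans (nuE4 w)) ?ltry.
have mnuE : measurable_fun setT nuE.
  apply: (@measurable_fun_fubini_tonelli_F _ _ _ _ _ (@lebesgueC R) (EFin \o F)).
    exact/measurable_EFinP.
  by move=> x; rewrite lee_fin.
exists (fun w => fine (nuE w)), (dl ^+ 2), (dl ^- (2 * K)); split.
  split; rewrite ?invr_gt0//; apply: le_trans hX _.
  by rewrite {2}K2 exprD invfM mulrA divff// mul1r.
have nu1 w : fine (nuE w) <= 4^-1 by rewrite -lee_fin fineK.
split.
- exact: measurableT_comp.
- move=> w; rewrite fine_ge0//=; apply: le_trans (nu1 w) _.
  have : 0 < 4 * C2 ^+ 2 by rewrite mulr_gt0// exprn_gt0.
  lra.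
- move=> w.
  have e2 : (dl ^+ 2) `^ (K%:R + 1) / dl ^+ (2 * K) = dl ^+ 2.
    rewrite powRD_gt0// powR_mulrn ?ltW// powRr1 ?ltW// exprM mulrAC divff ?mul1r//.
    by rewrite -exprM.
  rewrite -mulrA e2.
  apply: (@le_trans _ _ (4 * C2 ^+ 2 * dl ^+ 2)); last first.
    by rewrite ler_wpM2r ?(ltW (dp _))//; lra.
  rewrite -lee_fin fineK//.
  (* If some centre z1 contributes, all contributing centres lie in the disk of radius C2 dl around
     z1. *)
  have [[z1 hz1]|hz] := pselect (exists z1, F (w, z1) != 0); last first.
    rewrite /nuE integral0_eq; first by rewrite lee_fin; nneg.
    by move=> z _; congr EFin; apply/eqP; apply: contrapT => /negP h; apply: hz; exists z.
  apply: (@le_trans _ _ (lebesgueC (disk (toC z1) (C2 * dl)%R))).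
    apply: nuEle; first exact: measurable_disk.
    move=> z; have [->|hz] := eqVneq (F (w, z)) 0; first exact: ler0n.
    have w0 x : F (w, x) != 0 -> window id B dl (toC x) w != 0.
      by apply: contraNN => /eqP h; rewrite /F /= h mul0r.
    rewrite indicE mem_set.
      by apply: le_trans (window_le1 id B dl (toC z) w); rewrite /F /= ler_piMr ?window_ge0.
    exact: window_localized (w0 _ hz) (w0 _ hz1).
  apply: le_trans (lebesgueC_disk_le _ _) _; first by rewrite mulr_ge0// ltW.
  by rewrite lee_fin exprMn mulrA.
- under eq_integral do rewrite fineK//.
  rewrite (@tonelli_lebesgueCn R _ (EFin \o F)); last 2 first.
  + exact/measurable_EFinP.
  + by move=> x; rewrite lee_fin.
  pose W : R := wupper n.+1 id B / dl ^+ (2 * K).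
  have W0 : 0 <= W by rewrite divr_ge0 ?ltW.
  apply: (@le_trans _ _ (\int[@lebesgueC R]_z (W%:E * (\1_(disk (0%R : R[i]) 4^-1) z)%:E))%E).
    apply: ge0_le_integral => //.
    + by move=> z _; apply: integral_ge0 => w _; rewrite lee_fin.
    + apply: (@measurable_fun_fubini_tonelli_G _ _ _ _ _ (@lebCn R n.+2) (EFin \o F)).
        exact/measurable_EFinP.
      by move=> x; rewrite lee_fin.
    + by apply: measurable_funeM; apply/measurable_EFinP; exact: measurable_indic.
    move=> z _; rewrite (eq_integral (fun w => ((\1_(disk (0%R : R[i]) 4^-1) z)%:E *
        (window id B dl (toC z) w)%:E)%E)); last by move=> w _; rewrite /= /F/= mulrC EFinM.
    rewrite ge0_integralZl_EFin//; last 2 first.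
    + by move=> w _; rewrite lee_fin window_ge0.
    + by apply/measurable_EFinP; exact: measurable_window.
    rewrite muleC lee_wpmul2r ?lee_fin//.
    apply: le_trans (@integral_window_le R n.+1 id B dl B1 dl0 (toC z)) _.
    by rewrite lee_fin wupperE.
  rewrite ge0_integralZl_EFin//; last by apply/measurable_EFinP; exact: measurable_indic.
  rewrite integral_indic// setIT; apply: (@le_trans _ _ (W%:E * 1%:E)%E).
    rewrite lee_wpmul2l ?lee_fin//; apply: le_trans D4 _; rewrite lee_fin; lra.
  rewrite mule1 lee_fin /W ler_wpM2r ?(ltW L0)//.
  have : 0 < 4 * C2 ^+ 2 by rewrite mulr_gt0// exprn_gt0.
  lra.
pose W : R := wlower n.+1 id B * dl ^+ 2 / dl ^+ (2 * K).
have W0 : 0 <= W by apply: divr_ge0; [apply: mulr_ge0; exact: ltW|exact: ltW].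
pose Ff wz := F wz * f wz.1.
have mFf : measurable_fun setT Ff by apply: measurable_funM => //; exact: measurableT_comp.
have Ff0 wz : 0 <= Ff wz by rewrite mulr_ge0.
have -> : (\int[lebesgueCn R n.+2]_w (fine (nuE w) * f w)%:E =
    \int[lebesgueCn R n.+2]_w \int[@lebesgueC R]_z (Ff (w, z))%:E)%E.
  apply: eq_integral => w _; rewrite EFinM fineK// /nuE /Ff /=.
  rewrite [RHS](eq_integral (fun z => ((f w)%:E * (F (w, z))%:E)%E)); last first.
    by move=> z _; rewrite mulrC EFinM.
  rewrite ge0_integralZl_EFin//; last 2 first.
  - by move=> z _; rewrite lee_fin.
  - exact/measurable_EFinP.
  by rewrite muleC.
rewrite (@tonelli_lebesgueCn R _ (EFin \o Ff)); last 2 first.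
- exact/measurable_EFinP.
- by move=> x; rewrite lee_fin.
apply: (@le_trans _ _ (\int[@lebesgueC R]_z (W%:E * (\1_(disk (0%R : R[i]) 4^-1) z)%:E))%E).
  rewrite ge0_integralZl_EFin//; last by apply/measurable_EFinP; exact: measurable_indic.
  rewrite integral_indic// setIT; apply: (@le_trans _ _ (W%:E * (16^-1)%:E)%E).
    by rewrite -EFinM lee_fin le_eqVlt; apply/orP; left; apply/eqP; rewrite /W; ring.
  by rewrite lee_wpmul2l ?lee_fin.
apply: ge0_le_integral => //.
- by move=> z _; rewrite -EFinM lee_fin mulr_ge0.
- by apply: measurable_funeM; apply/measurable_EFinP; exact: measurable_indic.
- apply: (@measurable_fun_fubini_tonelli_G _ _ _ _ _ (@lebCn R n.+2) (EFin \o Ff)).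
    exact/measurable_EFinP.
  by move=> x; rewrite lee_fin.
move=> z _; have [hz|hz] := pselect (disk (0 : R[i]) 4^-1 z); last first.
  rewrite indicE memNset// mule0; apply: integral_ge0 => w _; rewrite lee_fin; exact: Ff0.
rewrite indicE mem_set// mule1; move: (hz); rewrite disk0E => hz'.
have := hB dl (toC z) dl0 dl4 hz' (@recentring_id n.+1 (toC z)).
rewrite (@wlowerE n.+1 id B dl isT dl0) => h; apply: (le_trans h).
rewrite le_eqVlt; apply/orP; left; apply/eqP; apply: eq_integral => w _.
by rewrite /Ff /F /= indicE mem_set// mulr1.
Qed.

End Necessity.

(* Part (i) needs d <> 1: for d = 1 the function E1 is the Fourier transform of
   phi, which lies in every L^q although q_1 = 2. *)
Theorem proposition1p4 (R : realType) (phi : R[i] -> R[i])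
    (hphi : Cc_oo_disk phi)
    (hphi1 : forall z : R[i], cabs z <= 2^-1 -> phi z = 1)
    (d : nat) (hd : (0 < d)%N) :
  ((1 < d)%N ->
   let qd : R := 2^-1 * (d%:R ^+ 2 + d%:R) + 1 in
   forall q : \bar R, (0 < q)%E ->
     inLq (lebesgueCn R d) q (@extension R d id phi (fun=> 1))
     <-> (qd%:E < q)%E)
  /\
  (forall k : nat -> nat,
     (forall j : nat, (1 <= j <= d)%N -> (0 < k j)%N) ->
     (forall j : nat, (1 <= j < d)%N -> (k j < k j.+1)%N) ->
     let K := (\sum_(1 <= j < d.+1) k j)%N in
     K%:R < 2^-1 * ((k d)%:R * ((k d)%:R + 1)) :> R ->
     forall q : \bar R, (0 < q)%E ->
       inLq (lebesgueCn R d) q (@extension R d k phi (fun=> 1))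
       <-> (K%:R%:E < q)%E).
Proof.
split=> [d1 qd q qp|k hk0 hk K hK q qp].
  have qdE : qd = (\sum_(j < d) j.+1)%N%:R + 1.
    have := congr1 (fun n => n%:R : R) (sum_double_succ d).
    by rewrite -mul2n !natrM -natr1 /qd expr2 => h; lra.
  (* q_d - 2 d = (d - 1) (d - 2) / 2, so the condition q > 2 d of [decay] follows from q > q_d. *)
  have d2 : 2 * d%:R <= qd.
    have : 2 <= d%:R :> R by rewrite ler_nat.
    rewrite /qd; move: (d%:R : R) => x hx; nra.
  split=> [h|h].
    apply: (Lq_threshold hphi _ _ qp h); first by rewrite qdE ltr_wpDl.
    by rewrite qdE; case: d d1 {hd h qd qdE d2} => [|[|n]] // _; exact: full_not_integrable.
  (* [i0 = d] lowers no exponent, and the threshold is 1 + d (d + 1) / 2. *)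
  apply: (@extension_inLq _ d id d 2^-1) => //; rewrite ?ltnn//.
  - lra.
  - exact: le_lt_trans h.
  - by rewrite subr0 addrC -qdE.
have KE : K = (\sum_(j < d) k j.+1)%N by rewrite /K big_add1 big_mkord.
have hK' : ((\sum_(j < d) k j.+1).*2 < k d * (k d).+1)%N.
  by rewrite -(ltr_nat R) -KE -mul2n !natrM -natr1; lra.
have lt := exponents_ltn hk; have gt0 := exponents_gt0 hk0.
have dK := double_dim_le_sum hd hk0 hk hK'.
split=> [h|h].
  have K1 : (1 < K)%N by rewrite KE; lia.
  apply: (Lq_threshold hphi _ _ qp h); first by rewrite ltr0n ltnW.
  rewrite KE in K1 *; case: d hd lt gt0 K1 {hk0 hk hK hK' KE dK h K} => // n _ lt gt0 K1.
  by apply: sparse_not_integrable => //; exact: gt0.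
have [i0 i0d hi0] := exponents_gap hd hk0 hk hK'.
(* For K < q < 1 + K every tau between 1 + K - q and 1 works; the midpoint is taken. *)
have [tau ht hq] : exists2 tau : R, 0 < tau < 1 & ((1 + K%:R - tau)%:E < q)%E.
  case: q h {qp} => [q| |]//; last by exists 2^-1; [lra|exact: ltry].
  rewrite lte_fin => h.
  have [hq|hq] := leP (1 + K%:R) q; first by exists 2^-1; [|rewrite lte_fin]; lra.
  by exists (1 - (q - K%:R) / 2); [|rewrite lte_fin]; lra.
apply: (@extension_inLq _ d k i0 tau) => //.
- by apply: le_lt_trans h; rewrite lee_fin -natrM ler_nat KE mul2n.
- by rewrite i0d -KE.
Qed.
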